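(* Let $T\subset\mathbb{R}^2$ be an open equilateral triangle and let $V\subset T$ be measurable with $|V|>0$. There exist constants $\sigma_0>0$ and $c_{V,R}>0$ (which may depend on $V$ and on $T$, but not on the spectral level) such that $$\|u\|_{L^2(V)}^2\ \geq\ c_{V,R}\,\|u\|_{L^2(T)}^2$$ for every $0\leq\sigma\leq\sigma_0$, every $\lambda\in\operatorname{Spec}(-\Delta_\sigma)$ and every $u\in E_{\lambda,\sigma}$. Equivalently, $$\inf_{0\leq\sigma\leq\sigma_0}\ \inf_{\lambda\in\operatorname{Spec}(-\Delta_\sigma)}\ \inf_{0\neq u\in E_{\lambda,\sigma}}\frac{\|u\|_{L^2(V)}^2}{\|u\|_{L^2(T)}^2}>0 .$$
   Context: $T$ is the open equilateral triangle of side length $L>0$ with vertices $(0,0)$, $(L,0)$, $(L/2,\sqrt3L/2)$ (up to rigid motion). For $\sigma\geq0$, $-\Delta_\sigma$ is the nonnegative self-adjoint operator on $L^2(T)$ associated with the quadratic form $q_\sigma[u]=\int_T|\nabla u|^2\,dx+\sigma\int_{\partial T}|u|^2\,ds$ with domain $H^1(T)$, i.e. the Laplacian with Robin boundary condition $\partial_\nu u+\sigma u=0$ on $\partial T$ ($\nu$ the outward unit normal); $\sigma=0$ is the Neumann Laplacian. It has compact resolvent. For $\lambda\in\operatorname{Spec}(-\Delta_\sigma)$, $E_{\lambda,\sigma}=\ker(-\Delta_\sigma-\lambda)$ is the complete eigenspace. $|V|$ denotes Lebesgue measure. *)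

(* Defs.v *)
From HB Require Import structures.
From mathcomp Require Import all_boot all_order all_algebra.
From mathcomp Require Import complex.
From mathcomp Require Import all_classical all_reals all_analysis.

Set Implicit Arguments.
Unset Strict Implicit.
Unset Printing Implicit Defensive.

Import Order.TTheory GRing.Theory Num.Theory.
Import numFieldNormedType.Exports.

Local Open Scope classical_set_scope.
Local Open Scope ring_scope.
Local Open Scope complex_scope.

Definition plane (R : realType) : Type := (R * R)%type.

Definition borel_area (R : realType) :
    {measure set (measurableTypeR R * measurableTypeR R) -> \bar R} :=
  (@lebesgue_measure R \x @lebesgue_measure R)%E.

(* [lplane R] is [plane R] with the sigma-algebra of Lebesgue measurable sets,
   i.e. the sets that are Caratheodory measurable for the outer measure
   generated by the product measure on Borel sets; [area] is the completed
   two-dimensional Lebesgue measure. *)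
Definition lplane (R : realType) : measurableType _ :=
  caratheodory_type (mu_ext (borel_area R)).

Definition area (R : realType) : {measure set (lplane R) -> \bar R} :=
  @completed_measure_extension _ _ _ (borel_area R).

(* Not the norm of the normed module [R * R], which is the sup norm. *)
Definition edist (R : realType) (P Q : plane R) : R :=
  Num.sqrt ((P.1 - Q.1) ^+ 2 + (P.2 - Q.2) ^+ 2).

Definition equilateral (R : realType) (L : R) (p : 'I_3 -> plane R) : Prop :=
  0 < L /\ forall i j, i != j -> edist (p i) (p j) = L.

Definition open_triangle (R : realType) (p : 'I_3 -> plane R) : set (plane R) :=
  [set P | exists a : 'I_3 -> R,
     [/\ forall i, 0 < a i, \sum_(i < 3) a i = 1
       & P = (\sum_(i < 3) a i * (p i).1, \sum_(i < 3) a i * (p i).2)]].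

(* Arc-length parametrization, on [0, edist (p i) (p (i + 1))], of the side
   from [p i] to [p (i + 1)], indices being taken modulo 3. *)
Definition side_length (R : realType) (p : 'I_3 -> plane R) (i : 'I_3) : R :=
  edist (p i) (p (ordS i)).

Definition side (R : realType) (p : 'I_3 -> plane R) (i : 'I_3) (s : R) :
    plane R :=
  let q := p (ordS i) in
  ((p i).1 + s / side_length p i * (q.1 - (p i).1),
   (p i).2 + s / side_length p i * (q.2 - (p i).2)).

Definition Cintegral d (X : measurableType d) (R : realType)
    (mu : {measure set X -> \bar R}) (D : set X) (f : X -> R[i]) : R[i] :=
  Rintegral mu D (fun x => complex.Re (f x))
    +i* Rintegral mu D (fun x => complex.Im (f x)).

Definition sqnorm d (X : measurableType d) (R : realType)
    (mu : {measure set X -> \bar R}) (D : set X) (f : X -> R[i]) : \bar R :=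
  (\int[mu]_(x in D) (complex.Re (f x) ^+ 2 + complex.Im (f x) ^+ 2)%:E)%E.

Definition L2 d (X : measurableType d) (R : realType)
    (mu : {measure set X -> \bar R}) (D : set X) (f : X -> R[i]) : Prop :=
  [/\ measurable_fun D (fun x => complex.Re (f x)),
      measurable_fun D (fun x => complex.Im (f x))
    & (sqnorm mu D f < +oo)%E].

Definition boundary_integral (R : realType) (p : 'I_3 -> plane R)
    (f : plane R -> R[i]) : R[i] :=
  \sum_(i < 3) Cintegral (@lebesgue_measure R) `[0%R, side_length p i]%classic
                 (f \o side p i).

Definition boundary_sqnorm (R : realType) (p : 'I_3 -> plane R)
    (f : plane R -> R[i]) : \bar R :=
  (\sum_(i < 3) sqnorm (@lebesgue_measure R) `[0%R, side_length p i]%classic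
                  (f \o side p i))%E.

(* Elements of L^2 of the boundary are represented by Borel functions. *)
Definition boundary_L2 (R : realType) (p : 'I_3 -> plane R)
    (f : plane R -> R[i]) : Prop :=
  forall i, L2 (@lebesgue_measure R) `[0%R, side_length p i]%classic (f \o side p i).

Definition basis_vec (R : realType) (i : 'I_2) : R * R :=
  ((i == 0)%:R, (i == 1)%:R).

Definition partial (R : realType) (i : 'I_2) (f : plane R -> R) : plane R -> R :=
  fun P => 'D_(basis_vec R i) (f : R * R -> R) P.

Fixpoint Cn (R : realType) (n : nat) (f : plane R -> R) : Prop :=
  continuous (f : R * R -> R) /\
  if n is m.+1 then
    forall i, (forall P, derivable (f : R * R -> R) P (basis_vec R i)) /\
              Cn m (partial i f)
  else True.

Definition smooth (R : realType) (f : plane R -> R) : Prop :=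
  forall n, Cn n f.

Definition test_function (R : realType) (D : set (plane R))
    (f : plane R -> R) : Prop :=
  smooth f /\
  exists K : set (R * R), [/\ compact K, K `<=` D & forall P, ~ K P -> f P = 0].

Definition Csmooth (R : realType) (f : plane R -> R[i]) : Prop :=
  smooth (fun P => complex.Re (f P)) /\ smooth (fun P => complex.Im (f P)).

Definition Cpartial (R : realType) (i : 'I_2) (f : plane R -> R[i]) :
    plane R -> R[i] :=
  fun P => partial i (fun Q => complex.Re (f Q)) P
             +i* partial i (fun Q => complex.Im (f Q)) P.

(* [u] belongs to H^1(D) and [g] is its weak gradient. *)
Definition H1_grad (R : realType) (D : set (plane R)) (u : plane R -> R[i])
    (g : 'I_2 -> plane R -> R[i]) : Prop :=
  [/\ L2 (area R) D u,
      forall i, L2 (area R) D (g i)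
    & forall i f, test_function D f ->
        Cintegral (area R) D (fun P => u P * (partial i f P)%:C)
        = - Cintegral (area R) D (fun P => g i P * (f P)%:C)].

(* [h] is the boundary trace of the function [u] of H^1, with weak gradient
   [g]: the trace operator is the continuous extension to H^1 of the restriction
   to the boundary of functions smooth up to the boundary. *)
Definition is_trace (R : realType) (p : 'I_3 -> plane R) (u : plane R -> R[i])
    (g : 'I_2 -> plane R -> R[i]) (h : plane R -> R[i]) : Prop :=
  boundary_L2 p h /\
  exists f : nat -> plane R -> R[i],
    [/\ forall n, Csmooth (f n),
        sqnorm (area R) (open_triangle p) (fun P => f n P - u P)
          @[n --> \oo] --> 0%E,
        forall i, sqnorm (area R) (open_triangle p)
                    (fun P => Cpartial i (f n) P - g i P) @[n --> \oo] --> 0%E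
      & boundary_sqnorm p (fun P => f n P - h P) @[n --> \oo] --> 0%E].

(* [u] belongs to H^1 of the triangle, with weak gradient [g] and trace [h].
   By the trace theorem on a triangle, requiring a trace does not restrict [u]. *)
Definition H1_data (R : realType) (p : 'I_3 -> plane R) (u : plane R -> R[i])
    (g : 'I_2 -> plane R -> R[i]) (h : plane R -> R[i]) : Prop :=
  H1_grad (open_triangle p) u g /\ is_trace p u g h.

Definition inner (R : realType) (D : set (plane R)) (f v : plane R -> R[i]) :
    R[i] :=
  Cintegral (area R) D (fun P => f P * (v P)^*).

(* The sesquilinear form whose diagonal is
     q_sigma[u] = \int_T |grad u|^2 dx + sigma \int_(bd T) |u|^2 ds,
   in terms of the weak gradients [g], [w] and the traces [h], [k] of its two
   arguments. *)
Definition robin_form (R : realType) (p : 'I_3 -> plane R) (sigma : R)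
    (g : 'I_2 -> plane R -> R[i]) (h : plane R -> R[i])
    (w : 'I_2 -> plane R -> R[i]) (k : plane R -> R[i]) : R[i] :=
  \sum_(i < 2) inner (open_triangle p) (g i) (w i)
  + sigma%:C * boundary_integral p (fun P => h P * (k P)^*).

(* The graph of the operator associated with the form: [u] is in the domain of
   the Robin Laplacian and is mapped to [f]. *)
Definition robin_laplacian (R : realType) (p : 'I_3 -> plane R) (sigma : R)
    (u f : plane R -> R[i]) : Prop :=
  L2 (area R) (open_triangle p) f /\
  exists g h, H1_data p u g h /\
    forall v w k, H1_data p v w k ->
      robin_form p sigma g h w k = inner (open_triangle p) f v.

Definition robin_resolvent_set (R : realType) (p : 'I_3 -> plane R) (sigma : R) :
    set R[i] :=
  [set l | exists M : R, forall f, L2 (area R) (open_triangle p) f ->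
     exists u : plane R -> R[i],
       [/\ robin_laplacian p sigma u (fun P => l * u P + f P),
           (sqnorm (area R) (open_triangle p) u
              <= M%:E * sqnorm (area R) (open_triangle p) f)%E
         & forall v : plane R -> R[i],
             robin_laplacian p sigma v (fun P => l * v P + f P) ->
             {ae area R, forall P, open_triangle p P -> v P = u P}]].

Definition robin_spectrum (R : realType) (p : 'I_3 -> plane R) (sigma : R) :
    set R[i] :=
  ~` robin_resolvent_set p sigma.

Definition robin_eigenspace (R : realType) (p : 'I_3 -> plane R) (sigma : R)
    (l : R[i]) : set (plane R -> R[i]) :=
  [set u | robin_laplacian p sigma u (fun P => l * u P)].

(* Main.v *)
Require Import Defs.
From HB Require Import structures.
From mathcomp Require Import all_boot all_order all_algebra.
From mathcomp Require Import complex ring lra zify.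
From mathcomp Require Import all_classical all_reals all_analysis.
From mathcomp Require Import measurable_realfun.

(* The symmetrised exponentials [phi m], for [m] in the hexagonal lattice, are
   Neumann eigenfunctions of the triangle with eigenvalue [kappa * freq_norm m];
   they span a dense subspace of L^2, since the closed triangle is a fundamental
   domain of the affine Weyl group and hence is embedded in the plane by
   [phi (-1, 0)].

   Let u be a Robin eigenfunction with trace h. Testing its weak equation
   against [phi m] expresses the coefficient of u as sigma times the boundary
   coefficient of h, divided by the distance from the eigenvalue to the Neumann
   level of m. On each side of the triangle the boundary coefficients are
   Fourier coefficients, and along a line the levels are values of a quadratic
   polynomial; so the sum of the squared boundary coefficients divided by the
   distances is at most a constant times |h|^2. Together with the energy
   identity this bounds h by the projection w of u on the nearest Neumann level,
   and u - w by sigma w, uniformly in the eigenvalue.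

   On one Neumann level, a circle of the lattice, Zygmund's argument bounds the
   mass of w on V from below: a nonzero vector is the difference of at most two
   pairs of points of a circle, so the far pairs contribute the tail of a
   convergent series; on a large circle each point has at most one near
   neighbour, so the near pairs are controlled by the gap between the largest
   Fourier coefficient of the indicator of V and |V|; and the finitely many small
   circles are treated by linear independence. *)

Set Implicit Arguments.
Unset Strict Implicit.
Unset Printing Implicit Defensive.

Import Order.TTheory GRing.Theory Num.Theory.
Import numFieldNormedType.Exports.

Local Open Scope classical_set_scope.
Local Open Scope ring_scope.
Local Notation "x %:C" := (@real_complex _ x) : ring_scope.

(** * Planar Lebesgue measure *)

Section plane_measure.
Context {R : realType}.
Notation M := (measurableTypeR R * measurableTypeR R)%type.
Notation leb := (@lebesgue_measure R).

(** The obstacle is uniformity in the spectral level. Neumann multiplicities are unbounded, so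
    eigenfunctions cannot be followed one by one as [sigma] varies, and a trace inequality would
    bound the boundary values with a factor growing with the eigenvalue. Arithmetic replaces both.
    The Neumann levels are [kappa] times integers, so at most one of them is closer than [kappa / 2]
    to the eigenvalue. There the distance may be arbitrarily small and cannot be divided by: the
    whole projection w on that level is kept as the main term. On the other levels the distance is
    bounded below and grows quadratically along lines of the lattice, which makes its inverses
    summable uniformly in the eigenvalue. The norm of h occurs on both sides of the resulting
    estimate: by the energy identity and Bessel's inequality for gradients, [sigma] |h|^2 is at most
    a sum over frequencies, whose near part is shared between h and w by Young's inequality and
    whose far part carries one more factor [sigma]. Smallness of [sigma] is what allows h to be
    absorbed. *)

Lemma sigma_algebra_open (S : set (set (R * R))) : sigma_algebra setT S ->
  (forall a b c d : R, S (`]a, b[%classic `*` `]c, d[%classic)) ->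
  forall A : set (R * R), open A -> S A.
Proof.
move=> [S0 SC SU] Sbox A oA.
(* Countability comes from the rational endpoints; a box that leaves [A] is replaced by the empty
   set, so that the union over all quadruples is exactly [A]. *)
pose F (q : rat * rat * rat * rat) : set (R * R) :=
  let B := `](ratr q.1.1.1 : R), ratr q.1.1.2[%classic `*`
           `](ratr q.1.2 : R), ratr q.2[%classic in
  if pselect (B `<=` A) then B else set0.
have -> : A = \bigcup_(n : nat) (if unpickle n is Some q then F q else set0).
  rewrite eqEsubset; split => [[x y] Axy|[x y] [n _]]; last first.
    by case: unpickle => // q; rewrite /F; case: pselect => // h /h.
  have [[P Q] /= [/nbhs_ballP[e1 /= e10 h1] /nbhs_ballP[e2 /= e20 h2]] PQA] :
    nbhs (x, y) A by exact: open_nbhs_nbhs.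
  have [q1] : exists q : rat, ratr q \in `](x - e1), x[ by apply: rat_in_itvoo; lra.
  have [q2] : exists q : rat, ratr q \in `]x, (x + e1)[ by apply: rat_in_itvoo; lra.
  have [q3] : exists q : rat, ratr q \in `](y - e2), y[ by apply: rat_in_itvoo; lra.
  have [q4] : exists q : rat, ratr q \in `]y, (y + e2)[ by apply: rat_in_itvoo; lra.
  rewrite !in_itv/= => /andP[q41 q42] /andP[q31 q32] /andP[q21 q22] /andP[q11 q12].
  suff Fq : F (q1, q2, q3, q4) (x, y).
    by exists (pickle (q1, q2, q3, q4)); [exact: I|rewrite pickleK].
  rewrite /F /=.
  case: pselect => [hB|nB]; first by split => /=; rewrite in_itv/=; apply/andP.
  exfalso; apply: nB => -[x' y'] [] /=; rewrite !in_itv/= => /andP[? ?] /andP[? ?].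
  apply: PQA; split => /=; [apply: h1|apply: h2] => /=.
    by rewrite /ball /= ltr_distlC; apply/andP; split; lra.
  by rewrite /ball /= ltr_distlC; apply/andP; split; lra.
apply: SU => n; case: unpickle => // q; rewrite /F.
by case: pselect => // hB; exact: Sbox.
Qed.

Lemma open_measurable2 (A : set (R * R)) : open A -> measurable (A : set M).
Proof.
apply: (sigma_algebra_open (S := measurable : set (set M))).
  exact: sigma_algebra_measurable.
by move=> a b c d; apply: measurableX; exact: measurable_itv.
Qed.

Lemma continuous_measurable2 (f : R * R -> R) : continuous f ->
  measurable_fun [set: M] (f : M -> measurableTypeR R).
Proof.
move=> cf; apply: (measurability _ (RGenOpens.measurableE R)).
move=> _ [_ [a [b ->] <-]]; rewrite setTI; apply: open_measurable2.
by apply: open_comp => // x _; exact: cf.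
Qed.

Lemma lplane_measurable (A : set M) : measurable A ->
  measurable (A : set (lplane R)).
Proof. by move=> mA; apply: caratheodory_measurable_mu_ext. Qed.

Lemma area_borel (A : set M) : measurable A ->
  area R (A : set (lplane R)) = borel_area R A.
Proof. by move=> mA; exact: (measurable_mu_extE (borel_area R) mA). Qed.

Lemma lplane_id_measurable : measurable_fun [set: lplane R] (idfun : lplane R -> M).
Proof. by move=> _ A mA; rewrite setTI; exact: lplane_measurable. Qed.

Lemma continuous_lplane_measurable (f : R * R -> R) (D : set (lplane R)) :
  continuous f -> measurable D ->
  measurable_fun D (f : lplane R -> measurableTypeR R).
Proof.
move=> cf mD; apply: measurable_funTS.
exact: (measurableT_comp (continuous_measurable2 cf) lplane_id_measurable).
Qed.

(** By uniqueness of Lebesgue measure only half-open intervals have to be compared; for negative [c]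
    their preimages are half-open on the other side, with the same length. *)
Lemma lebesgue_affine (c d : R) (X : set (measurableTypeR R)) : c != 0 ->
  measurable X ->
  leb ((fun x => c * x + d) @^-1` X) = ((`|c|^-1)%:E * leb X)%E.
Proof.
move=> c0 mX.
have mf : measurable_fun setT ((fun x => c * x + d) : measurableTypeR R -> measurableTypeR R).
  by apply: measurable_funD => //; exact: measurable_funM.
have c00 : 0 <= `|c| by [].
pose pf : {measure set (measurableTypeR R) -> \bar R} :=
  pushforward leb ((fun x => c * x + d) : measurableTypeR R -> measurableTypeR R).
pose m := mscale (NngNum c00) (pf mf).
have : leb X = m X.
  apply: (lebesgue_measure_unique (mu := m)) => // _ [[a b] _ <-] /=.
  rewrite /m /mscale /pf /= /pushforward.
  have -> : (fun x => c * x + d) @^-1` [set` `]a, b]] =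
      if 0 < c then `](a - d) / c, (b - d) / c]%classic
               else `[(b - d) / c, (a - d) / c[%classic.
    apply/seteqP; split => x /=; rewrite in_itv/=.
      move=> /andP[h1 h2]; case: ltP => cp /=; rewrite in_itv/=; apply/andP; split.
      - by rewrite ltr_pdivrMr//; lra.
      - by rewrite ler_pdivlMr//; lra.
      - have {}cp : c < 0 by rewrite lt_neqAle c0.
        by rewrite ler_ndivrMr//; lra.
      - have {}cp : c < 0 by rewrite lt_neqAle c0.
        by rewrite ltr_ndivlMr//; lra.
    case: ltP => cp /=; rewrite in_itv/= => /andP[].
    - by rewrite ltr_pdivrMr// ler_pdivlMr// => h1 h2; apply/andP; split; lra.
    - have {}cp : c < 0 by rewrite lt_neqAle c0.
      by rewrite ler_ndivrMr// ltr_ndivlMr// => h1 h2; apply/andP; split; lra.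
  case: ltP => cp; rewrite !lebesgue_measure_itv/= !lte_fin.
    rewrite ltr_pM2r ?invr_gt0// ltrD2r gtr0_norm//; case: ifPn => _; last by rewrite mule0.
    by rewrite -!EFinB -EFinM; congr EFin; field.
  have {}cp : c < 0 by rewrite lt_neqAle c0.
  rewrite ltr_nM2r ?invr_lt0// ltrD2r ltr0_norm//; case: ifPn => _; last by rewrite mule0.
  by rewrite -!EFinB -EFinM; congr EFin; field.
move=> ->; rewrite /m /mscale /= /pf /= /pushforward muleA -EFinM mulVf ?normr_eq0//.
by rewrite mul1e.
Qed.

End plane_measure.

Section area_affine.
Context {R : realType}.
Notation M := (measurableTypeR R * measurableTypeR R)%type.
Notation leb := (@lebesgue_measure R).

Lemma borel_area_swap (B : set M) : measurable B ->
  borel_area R (B : set M) = borel_area R ((fun P : M => (P.2, P.1)) @^-1` B).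
Proof.
move=> mB.
have mf : measurable_fun setT ((fun P : M => (P.2, P.1)) : M -> M).
  by apply: measurable_fun_pair.
pose m : {measure set M -> \bar R} :=
  pushforward (borel_area R) ((fun P : M => (P.2, P.1)) : M -> M).
rewrite /borel_area.
apply: (product_measure_unique (m' := m mf)) => // X Y mX mY.
rewrite /m /= /pushforward.
have -> : (fun P : M => (P.2, P.1)) @^-1` (X `*` Y) = Y `*` X.
  by apply/seteqP; split => -[x y] [].
by rewrite /= /borel_area product_measure1E// muleC.
Qed.

Lemma measurable_affine2 (u a b v c d : R) : measurable_fun setT
  ((fun P : M => (u + a * P.1 + b * P.2, v + c * P.1 + d * P.2)) : M -> M).
Proof.
apply: measurable_fun_pair; (apply: measurable_funD; [apply: measurable_funD => //|]);
  by apply: measurable_funM.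
Qed.

Lemma borel_area_shear (u a b : R) (B : set M) : b != 0 -> measurable B ->
  borel_area R ((fun P : M => (P.1, u + a * P.1 + b * P.2)) @^-1` B)
  = ((`|b|^-1)%:E * borel_area R B)%E.
Proof.
move=> b0 mB.
rewrite /borel_area /product_measure1 -ge0_integralZl//=; last first.
  exact: (measurable_fun_xsection leb mB).
apply: eq_integral => x _ /=.
rewrite -(@lebesgue_affine R b (u + a * x) (xsection B x))//; last exact: measurable_xsection.
congr (leb _); apply/seteqP; split => y;
  by rewrite /xsection/= !inE/=; rewrite (addrC (b * y)).
Qed.

Lemma preimage_measurableT (g : M -> M) (C : set M) : measurable_fun setT g ->
  measurable C -> measurable (g @^-1` C).
Proof. by move=> mg mC; rewrite -[X in measurable X]setTI; exact: mg. Qed.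

Lemma measurable_swap : measurable_fun setT ((fun P : M => (P.2, P.1)) : M -> M).
Proof.
by apply: measurable_fun_pair.
Qed.

Lemma borel_area_shear1 (u a b : R) (B : set M) : a != 0 -> measurable B ->
  borel_area R ((fun P : M => (u + a * P.1 + b * P.2, P.2)) @^-1` B)
  = ((`|a|^-1)%:E * borel_area R B)%E.
Proof.
move=> a0 mB.
have mB' := preimage_measurableT measurable_swap mB.
rewrite (borel_area_swap mB) -(borel_area_shear u b a0 mB').
have mS : measurable_fun setT ((fun P : M => (P.1, u + b * P.1 + a * P.2)) : M -> M).
  apply: measurable_fun_pair; first exact: measurable_fst.
  apply: measurable_funD; [apply: measurable_funD => //|];
  by apply: measurable_funM.
rewrite [in RHS]borel_area_swap; last exact: preimage_measurableT.
congr (borel_area R _); apply/funext => -[x y] /=.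
by rewrite -addrA (addrC (a * x)) addrA.
Qed.

(** An LU factorisation: a shear of the first coordinate with diagonal entry [a], then a shear of
    the second one with diagonal entry [e = (a * d - b * c) / a]. By Fubini the preimage under a
    shear has its area divided by the absolute value of that entry. *)
Lemma borel_area_affine_neq0 (u a b v c d : R) (B : set M) :
  a != 0 -> a * d - b * c != 0 -> measurable B ->
  borel_area R ((fun P : M =>
    (u + a * P.1 + b * P.2, v + c * P.1 + d * P.2)) @^-1` B)
  = ((`|a * d - b * c|^-1)%:E * borel_area R B)%E.
Proof.
move=> a0 det0 mB.
pose e := (a * d - b * c) / a.
have e0 : e != 0 by rewrite mulf_neq0// invr_eq0.
have mS : measurable_fun setT
    ((fun P : M => (P.1, (v - c / a * u) + c / a * P.1 + e * P.2)) : M -> M).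
  apply: measurable_fun_pair; first exact: measurable_fst.
  apply: measurable_funD; [apply: measurable_funD => //|];
  by apply: measurable_funM.
have -> : `|a * d - b * c|^-1 = `|a|^-1 * `|e|^-1.
  by rewrite -invfM -normrM /e; congr (`|_|^-1); field.
rewrite EFinM -muleA -(borel_area_shear (v - c / a * u) (c / a) e0 mB).
rewrite -(borel_area_shear1 u b a0 (preimage_measurableT mS mB)).
congr (borel_area R _); apply/funext => -[x y] /=.
suff -> : v + c * x + d * y = v - c / a * u + c / a * (u + a * x + b * y) + e * y by [].
by rewrite /e; field.
Qed.

(** When the pivot [a] vanishes, [b] does not, and exchanging the coordinates makes [b] the
    pivot. *)
Lemma borel_area_affine (u a b v c d : R) (B : set M) :
  a * d - b * c != 0 -> measurable B ->
  borel_area R ((fun P : M =>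
    (u + a * P.1 + b * P.2, v + c * P.1 + d * P.2)) @^-1` B)
  = ((`|a * d - b * c|^-1)%:E * borel_area R B)%E.
Proof.
have [-> det0 mB|a0 det0 mB] := eqVneq a 0; last exact: borel_area_affine_neq0.
have b0 : b != 0 by apply: contra_neq det0 => ->; ring.
have det0' : b * c - 0 * d != 0 by rewrite -oppr_eq0 opprB.
rewrite borel_area_swap; last exact: preimage_measurableT (measurable_affine2 _ _ _ _ _ _) mB.
have -> : `|0 * d - b * c| = `|b * c - 0 * d| by rewrite distrC.
rewrite -(borel_area_affine_neq0 u v b0 det0' mB).
congr (borel_area R _); apply/funext => -[x y] /=.
by rewrite -addrA (addrC (0 * y)) addrA -(addrA v) (addrC (c * y)) addrA.
Qed.

End area_affine.

(** * The affine chart of the triangle *)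

(** Used twice for integrals over the triangle: with the identity map, to pass from the completed
    measure to the Borel one, and with the affine chart, where [k] is the absolute value of the
    determinant. *)
Lemma ge0_integral_transport d1 d2 (X : measurableType d1) (Y : measurableType d2)
    (R : realType) (mu : {measure set X -> \bar R}) (nu : {measure set Y -> \bar R})
    (f : X -> Y) (mf : measurable_fun setT f) (k : {nonneg R}) :
    (forall C, measurable C -> nu C = k%:num%:E * mu (f @^-1` C))%E ->
  forall (B : set Y) (F : Y -> \bar R), measurable B -> measurable_fun B F ->
  (forall P, B P -> 0 <= F P)%E ->
  (\int[nu]_(y in B) F y = k%:num%:E * \int[mu]_(x in f @^-1` B) F (f x))%E.
Proof.
move=> nuE B F mB mF F0.
pose pf : {measure set Y -> \bar R} := pushforward mu f.
transitivity (\int[mscale k (pf mf)]_(y in B) F y)%E.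
  by apply: eq_measure_integral => C mC CB; rewrite nuE.
rewrite (ge0_integral_mscale (pf mf) mB _ mF F0); congr (_ * _)%E.
by rewrite [LHS]ge0_integral_pushforward// => y /set_mem; exact: F0.
Qed.

Section triangle_coordinates.
Context {R : realType}.
Notation M := (measurableTypeR R * measurableTypeR R)%type.
Variable p : 'I_3 -> plane R.

Definition vtx0 := p ord0.
Definition vtx1 := p (ordS ord0).
Definition vtx2 := p (ordS (ordS ord0)).

Definition tri_map (a : R * R) : plane R :=
  (vtx0.1 + (vtx1.1 - vtx0.1) * a.1 + (vtx2.1 - vtx0.1) * a.2,
   vtx0.2 + (vtx1.2 - vtx0.2) * a.1 + (vtx2.2 - vtx0.2) * a.2).

Definition tri_det : R :=
  (vtx1.1 - vtx0.1) * (vtx2.2 - vtx0.2) - (vtx2.1 - vtx0.1) * (vtx1.2 - vtx0.2).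

(** Cramer's rule for the inverse of [tri_map]. *)
Definition tri_coord (P : plane R) : R * R :=
  (((P.1 - vtx0.1) * (vtx2.2 - vtx0.2) - (vtx2.1 - vtx0.1) * (P.2 - vtx0.2)) / tri_det,
   ((vtx1.1 - vtx0.1) * (P.2 - vtx0.2) - (P.1 - vtx0.1) * (vtx1.2 - vtx0.2)) / tri_det).

Definition std_triangle : set (R * R) :=
  [set a | [/\ 0 < a.1, 0 < a.2 & a.1 + a.2 < 1]].

Lemma sum3E (F : 'I_3 -> R) :
  \sum_(i < 3) F i = F ord0 + F (ordS ord0) + F (ordS (ordS ord0)).
Proof.
rewrite !big_ord_recl big_ord0 addr0 addrA.
by congr (_ + _ + _); congr F; apply: val_inj.
Qed.

Lemma forall3P (P : 'I_3 -> Prop) :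
  (forall i, P i) <-> [/\ P ord0, P (ordS ord0) & P (ordS (ordS ord0))].
Proof.
split=> [h|[h0 h1 h2] i]; first by split.
have : (i == ord0) || (i == ordS ord0) || (i == ordS (ordS ord0)).
  by case: i => -[|[|[|]]].
by case/orP => [/orP[]|] /eqP ->.
Qed.

Lemma tri_coordK : tri_det != 0 -> cancel tri_coord tri_map.
Proof.
move=> D0 [x y]; rewrite /tri_map /tri_coord /=.
by congr (_, _); rewrite /tri_det in D0 *; field.
Qed.

Lemma tri_mapK : tri_det != 0 -> cancel tri_map tri_coord.
Proof.
move=> D0 [x y]; rewrite /tri_map /tri_coord /=.
by congr (_, _); rewrite /tri_det in D0 *; field.
Qed.

Lemma open_triangle_map : tri_det != 0 ->
  tri_map @^-1` (open_triangle p) = std_triangle.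
Proof.
move=> D0; apply/seteqP; split => -[s t] /=.
  move=> [a [/forall3P[a0 a1 a2]]]; rewrite !sum3E => asum aE.
  have : tri_map (s, t) = tri_map (a (ordS ord0), a (ordS (ordS ord0))).
    rewrite aE /tri_map /= /vtx0 /vtx1 /vtx2.
    have -> : a ord0 = 1 - a (ordS ord0) - a (ordS (ordS ord0)) by lra.
    by congr (_, _); ring.
  move/(can_inj (tri_mapK D0)) => -[-> ->]; split => //=; lra.
move=> [/= s0 t0 st].
exists (fun i => if i == ord0 then 1 - s - t else if i == ordS ord0 then s else t).
split; first by apply/forall3P; split => /=; lra.
  by rewrite sum3E /=; ring.
by rewrite /tri_map !sum3E /= /vtx0 /vtx1 /vtx2; congr (_, _); ring.
Qed.

Lemma open_triangleE : tri_det != 0 ->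
  open_triangle p = tri_coord @^-1` std_triangle.
Proof.
move=> D0; rewrite -(open_triangle_map D0); apply/funext => P /=.
by rewrite tri_coordK.
Qed.

Lemma continuous_affine2 (u a b : R) : continuous (fun P : R * R => u + a * P.1 + b * P.2).
Proof.
move=> P; apply: cvgD; first apply: cvgD; first exact: cvg_cst.
  by apply: cvgM; [exact: cvg_cst|exact: cvg_fst].
by apply: cvgM; [exact: cvg_cst|exact: cvg_snd].
Qed.

Lemma continuous_pair (T : topologicalType) (f g : T -> R) :
  continuous f -> continuous g -> continuous ((fun x => (f x, g x)) : T -> R * R).
Proof. by move=> cf cg x; exact: (cvg_pair (cf x) (cg x)). Qed.

Lemma continuous_tri_map : continuous (tri_map : R * R -> R * R).
Proof. by apply: continuous_pair; exact: continuous_affine2. Qed.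

Lemma continuous_tri_coord : continuous (tri_coord : R * R -> R * R).
Proof.
have c (u a b : R) (f : R * R -> R) : (forall P, f P = u + a * P.1 + b * P.2) ->
  continuous f by move=> /funext ->; exact: continuous_affine2.
apply: continuous_pair.
  apply: (c (- (vtx0.1 * (vtx2.2 - vtx0.2) - (vtx2.1 - vtx0.1) * vtx0.2) / tri_det)
    ((vtx2.2 - vtx0.2) / tri_det) (- (vtx2.1 - vtx0.1) / tri_det)) => P.
  by ring.
apply: (c (- ((vtx1.1 - vtx0.1) * vtx0.2 - vtx0.1 * (vtx1.2 - vtx0.2)) / tri_det)
  (- (vtx1.2 - vtx0.2) / tri_det) ((vtx1.1 - vtx0.1) / tri_det)) => P.
by ring.
Qed.

Lemma open_gt0 (f : R * R -> R) : continuous f -> open [set a | 0 < f a].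
Proof.
move=> cf; apply: (@open_comp _ _ f [set y | 0 < y]) => [x _|]; first exact: cf.
exact: open_gt.
Qed.

Lemma open_std_triangle : open std_triangle.
Proof.
have -> : std_triangle = [set a | 0 < (fun P : R * R => 0 + 1 * P.1 + 0 * P.2) a] `&`
   ([set a | 0 < (fun P : R * R => 0 + 0 * P.1 + 1 * P.2) a] `&`
    [set a | 0 < (fun P : R * R => 1 + (-1) * P.1 + (-1) * P.2) a]).
  apply/seteqP; split => -[s t] /=.
    by move=> [/= h1 h2 h3]; split; [lra|split; lra].
  by move=> [h1 [h2 h3]]; split => /=; lra.
by apply: openI; last apply: openI; apply: open_gt0; exact: continuous_affine2.
Qed.

Lemma open_open_triangle : tri_det != 0 -> open (open_triangle p : set (R * R)).
Proof.
move=> D0; rewrite open_triangleE//; apply: open_comp => [? _|].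
  exact: continuous_tri_coord.
exact: open_std_triangle.
Qed.

Lemma measurable_triangle : tri_det != 0 ->
  measurable (open_triangle p : set (lplane R)).
Proof.
by move=> D0; apply: lplane_measurable; apply: open_measurable2; exact: open_open_triangle.
Qed.

Lemma borel_area_map (B : set M) : tri_det != 0 -> measurable B ->
  borel_area R B = (`|tri_det|%:E * borel_area R (tri_map @^-1` B))%E.
Proof.
move=> D0 mB; rewrite borel_area_affine// muleA -EFinM mulfV ?mul1e//.
by rewrite normr_eq0.
Qed.

Lemma area_map_ge0_integral (B : set M) (F : R * R -> \bar R) : tri_det != 0 ->
  measurable B ->
  measurable_fun B (F : M -> \bar R) -> (forall P, B P -> 0 <= F P)%E ->
  (\int[area R]_(P in B) F P =
   `|tri_det|%:E * \int[borel_area R]_(a in tri_map @^-1` B) F (tri_map a))%E.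
Proof.
move=> D0 mB mF F0.
have mA : measurable_fun setT (tri_map : M -> M) by exact: measurable_affine2.
have e1 := @ge0_integral_transport _ _ _ _ _ (area R) (borel_area R) idfun
  lplane_id_measurable (NngNum ler01) _ _ _ mB mF F0.
have e2 := @ge0_integral_transport _ _ _ _ _ (borel_area R) (borel_area R) tri_map
  mA (NngNum (normr_ge0 tri_det)) _ _ _ mB mF F0.
rewrite -e2; last by move=> C mC; exact: borel_area_map.
rewrite e1 ?mul1e// => C mC; rewrite /= mul1e.
by rewrite -(area_borel mC).
Qed.

End triangle_coordinates.

Section triangle_integral.
Context {R : realType}.
Notation M := (measurableTypeR R * measurableTypeR R)%type.
Notation leb := (@lebesgue_measure R).

Lemma measurable_std_triangle : measurable (std_triangle : set M).
Proof. exact: open_measurable2 (@open_std_triangle R). Qed.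

Lemma std_triangle_finite : (borel_area R (std_triangle : set M) < +oo)%E.
Proof.
apply: (@le_lt_trans _ _ (borel_area R (`[0, 1]%classic `*` `[0, 1]%classic))).
  apply: le_measure; rewrite ?inE.
  - exact: measurable_std_triangle.
  - by apply: measurableX; exact: measurable_itv.
  - by move=> [s t] [/= h1 h2 h3]; split; rewrite /= in_itv/=; apply/andP; split; lra.
rewrite (_ : borel_area R _ = leb `[0%R, 1%R] * leb `[0%R, 1%R])%E; last first.
  by apply: product_measure1E; exact: measurable_itv.
by rewrite !lebesgue_measure_itv/= lte01 oppr0 adde0 mul1e ltry.
Qed.

Lemma continuous_bounded_unit_square (H : R * R -> R) : continuous H ->
  exists C, forall a, a.1 \in `[0, 1] -> a.2 \in `[0, 1] -> `|H a| <= C.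
Proof.
move=> cH.
have cK : compact (`[0, 1]%classic `*` `[0, 1]%classic : set (R * R)).
  by apply: compact_setX; exact: segment_compact.
have cHK : compact (H @` (`[0, 1]%classic `*` `[0, 1]%classic)).
  by apply: continuous_compact => //; apply: continuous_subspaceT.
have [C [_ hC]] := compact_bounded cHK.
exists (C + 1) => a a1 a2; apply: hC; first by rewrite ltrDl.
by exists a.
Qed.

Lemma std_triangle_integrable (H : R * R -> R) : continuous H ->
  (borel_area R).-integrable (std_triangle : set M) (EFin \o H).
Proof.
move=> cH; apply: measurable_bounded_integrable.
- exact: measurable_std_triangle.
- exact: std_triangle_finite.
- by apply: measurable_funTS; exact: continuous_measurable2.
- have [C hC] := continuous_bounded_unit_square cH.
  exists C; split; first exact: num_real.
  move=> x Cx [s t] [/= h1 h2 h3]; apply: le_trans (ltW Cx).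
  by apply: hC; rewrite /= in_itv/=; apply/andP; split; lra.
Qed.

Lemma std_triangle_fubini1 (H : R * R -> R) : continuous H ->
  (\int[borel_area R]_(a in std_triangle) (H a)%:E =
  \int[leb]_(t in `]0%R, 1%R[) \int[leb]_(s in `[0%R, (1 - t)%R]) (H (s, t))%:E)%E.
Proof.
move=> cH; have mT := measurable_std_triangle.
have /(integrable_mkcond _ mT) iH := std_triangle_integrable cH.
rewrite integral_mkcond -(integral21_prod_meas1 iH) [RHS]integral_mkcond.
apply: eq_integral => t _; rewrite /fubini_G patchE.
have [/set_mem|/negP tn] := boolP (t \in `]0, 1[%classic); last first.
  apply: integral0_eq => s _; rewrite patchE; case: ifPn => // /set_mem[/= h1 h2 h3].
  by exfalso; apply: tn; rewrite inE /= in_itv/=; apply/andP; split; lra.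
rewrite /= in_itv/= => /andP[t0 t1].
have mHt : measurable_fun setT (fun s => (H (s, t))%:E : \bar R).
  apply/measurable_EFinP.
  exact: (measurableT_comp (continuous_measurable2 cH)
    (measurable_fun_pair (@measurable_id _ _ setT) (@measurable_cst _ _ _ _ setT t))).
rewrite -(integral_itv_obnd_cbnd (measurable_funTS mHt)).
rewrite -(integral_itv_bndo_bndc (measurable_funTS mHt)).
rewrite [RHS]integral_mkcond; apply: eq_integral => s _.
rewrite !patchE; congr (if _ then _ else _).
apply/idP/idP => [/set_mem[/= h1 h2 h3]|].
  by rewrite inE /= in_itv/=; apply/andP; split; lra.
by rewrite !inE /= in_itv/= => /andP[? ?]; split => /=; lra.
Qed.

Lemma std_triangle_fubini2 (H : R * R -> R) : continuous H ->
  (\int[borel_area R]_(a in std_triangle) (H a)%:E =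
  \int[leb]_(s in `]0%R, 1%R[) \int[leb]_(t in `[0%R, (1 - s)%R]) (H (s, t))%:E)%E.
Proof.
move=> cH; have mT := measurable_std_triangle.
have /(integrable_mkcond _ mT) iH := std_triangle_integrable cH.
rewrite integral_mkcond -(integral12_prod_meas1 iH) [RHS]integral_mkcond.
apply: eq_integral => s _; rewrite /fubini_F patchE.
have [/set_mem|/negP sn] := boolP (s \in `]0, 1[%classic); last first.
  apply: integral0_eq => t _; rewrite patchE; case: ifPn => // /set_mem[/= h1 h2 h3].
  by exfalso; apply: sn; rewrite inE /= in_itv/=; apply/andP; split; lra.
rewrite /= in_itv/= => /andP[t0 t1].
have mHs : measurable_fun setT (fun t => (H (s, t))%:E : \bar R).
  apply/measurable_EFinP.
  exact: (measurableT_comp (continuous_measurable2 cH)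
    (measurable_fun_pair (@measurable_cst _ _ _ _ setT s) (@measurable_id _ _ setT))).
rewrite -(integral_itv_obnd_cbnd (measurable_funTS mHs)).
rewrite -(integral_itv_bndo_bndc (measurable_funTS mHs)).
rewrite [RHS]integral_mkcond; apply: eq_integral => t _.
rewrite !patchE; congr (if _ then _ else _).
apply/idP/idP => [/set_mem[/= h1 h2 h3]|].
  by rewrite inE /= in_itv/=; apply/andP; split; lra.
by rewrite !inE /= in_itv/= => /andP[? ?]; split => /=; lra.
Qed.

Lemma FTC_segment (F f : R -> R) (b : R) : 0 < b -> continuous f ->
  (forall x : R, is_derive x 1 F (f x)) ->
  (\int[leb]_(x in `[0%R, b]) (f x)%:E)%E = (F b - F 0)%:E.
Proof.
move=> b0 cf dF; rewrite (continuous_FTC2 (F := F) b0) ?EFinB//.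
- exact: continuous_subspaceT.
- have cF : continuous F.
    by move=> x; apply/differentiable_continuous/derivable1_diffP; case: (dF x).
  split; first by move=> x _; case: (dF x).
    by apply: cvg_at_right_filter; exact: cF.
  by apply: cvg_at_left_filter; exact: cF.
- by move=> x _; rewrite derive1E; case: (dF x).
Qed.

(* The three hypotheses on [G1] and [G2] say that the vector field with these
   components in the basis of the two sides at the first vertex is tangent to
   the three sides. *)
Lemma std_triangle_divergence (G1 G2 g1 g2 : R * R -> R) :
  continuous G1 -> continuous G2 -> continuous g1 -> continuous g2 ->
  (forall s t : R, is_derive s 1 (fun s => G1 (s, t)) (g1 (s, t))) ->
  (forall s t : R, is_derive t 1 (fun t => G2 (s, t)) (g2 (s, t))) ->
  (forall t, G1 (0, t) = 0) -> (forall s, G2 (s, 0) = 0) ->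
  (forall s, G1 (s, 1 - s) + G2 (s, 1 - s) = 0) ->
  \int[borel_area R]_(a in (std_triangle : set M)) (g1 a + g2 a) = 0.
Proof.
move=> cG1 cG2 cg1 cg2 dG1 dG2 G10 G20 G12.
rewrite RintegralD; [|exact: measurable_std_triangle|exact: std_triangle_integrable..].
rewrite /Rintegral std_triangle_fubini1// std_triangle_fubini2//.
have cline (f g : R -> R) (H : R * R -> R) : continuous f -> continuous g ->
    continuous H -> continuous (fun x => H (f x, g x)).
  move=> cf cg cH x.
  by apply: (continuous_comp (f := fun x => (f x, g x)) (g := H)); 
    [exact: (cvg_pair (cf x) (cg x))|exact: cH].
have cid : continuous (@idfun R) by move=> x; exact: cvg_id.
have ccst (c : R) : continuous (fun _ : R => c) by exact: cst_continuous.
have c1 : continuous (fun x : R => 1 - x).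
  by move=> x; apply: cvgB; [exact: cvg_cst|exact: cvg_id].
(* The inner integral reduces to a value on the hypotenuse, since [G1] vanishes on the side [s = 0];
   the same happens below with [G2] on [t = 0]. *)
rewrite (@eq_integral _ _ _ leb `]0, 1[%classic (fun t => (G1 (1 - t, t))%:E)); last first.
  move=> t /set_mem; rewrite /= in_itv/= => /andP[t0 t1].
  rewrite (FTC_segment (F := fun s => G1 (s, t)) (f := fun s => g1 (s, t)))//.
  - by rewrite G10 subr0.
  - by lra.
  - exact: (cline idfun (fun=> t)).
rewrite [X in _ + fine X](@eq_integral _ _ _ leb `]0, 1[%classic (fun s => (- G1 (s, 1 - s))%:E) _); last first.
  move=> s /set_mem; rewrite /= in_itv/= => /andP[s0 s1].
  rewrite (FTC_segment (F := fun t => G2 (s, t)) (f := fun t => g2 (s, t)))//.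
  - by congr EFin; apply/eqP; rewrite G20 subr0 -addr_eq0 addrC G12.
  - by lra.
  - exact: (cline (fun=> s) idfun).
have mE (f : R -> R) (D : set R) : continuous f -> measurable_fun D (fun x : R => (f x)%:E).
  move=> cf; apply/measurable_EFinP; apply: measurable_funTS.
  exact: continuous_measurable_fun.
have cA : continuous (fun x : R => G1 (1 - x, x)) by exact: cline.
have cB : continuous (fun x : R => G1 (x, 1 - x)) by exact: cline.
have mA : measurable_fun `](0 : R), 1[ (fun x : R => (G1 (1 - x, x))%:E).
  exact: mE.
have mB : measurable_fun `](0 : R), 1[ (fun x : R => (- G1 (x, 1 - x))%:E).
  by apply: mE => x; apply: cvgN; exact: cB.
rewrite (integral_itv_bndo_bndc mA) (integral_itv_bndo_bndc mB).
have mA' : measurable_fun `](0 : R), 1] (fun x : R => (G1 (1 - x, x))%:E).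
  exact: mE.
have mB' : measurable_fun `](0 : R), 1] (fun x : R => (- G1 (x, 1 - x))%:E).
  by apply: mE => x; apply: cvgN; exact: cB.
rewrite (integral_itv_obnd_cbnd mA') (integral_itv_obnd_cbnd mB').
(* The reflection of [[0, 1]] exchanges the two parametrizations of the hypotenuse; after it the two
   boundary terms cancel. *)
have := @Rintegration_by_substitution_onem R (fun x : R => - G1 (x, 1 - x)) 1.
rewrite ler01 lexx => /(_ isT) h.
have iA : leb.-integrable `[(0 : R), 1] (EFin \o (fun x : R => G1 (1 - x, x))).
  apply: continuous_compact_integrable; first exact: segment_compact.
  exact: continuous_subspaceT.
have iB : leb.-integrable `[(0 : R), 1] (EFin \o (fun x : R => - G1 (1 - x, x))).
  by apply: continuous_compact_integrable; [exact: segment_compact|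
    apply: continuous_subspaceT => x; apply: cvgN; exact: cA].
have {}h : \int[leb]_(x in `[0, 1]) (- G1 (x, 1 - x)) =
    \int[leb]_(x in `[0, 1]) (- G1 (1 - x, x)).
  rewrite h; last by apply: continuous_subspaceT => x; apply: cvgN; exact: cB.
  rewrite unstable.onem1; apply: eq_Rintegral => x _.
  by rewrite /unstable.onem subKr.
transitivity (\int[leb]_(x in `[0, 1]) (G1 (1 - x, x)) +
    \int[leb]_(x in `[0, 1]) (- G1 (x, 1 - x))); first by [].
rewrite h -RintegralD//.
by rewrite (@eq_Rintegral _ _ _ _ _ (cst 0)) ?Rintegral_cst ?mul0r//= => x _; rewrite subrr.
Qed.

End triangle_integral.

(** * Hermitian forms and complex square integrable functions *)

Section complex_normsq.
Context {R : realType}.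
Notation C := R[i].

Definition nsq (z : C) : R := complex.Re z ^+ 2 + complex.Im z ^+ 2.

Lemma nsq_ge0 z : 0 <= nsq z.
Proof. by rewrite addr_ge0 ?sqr_ge0. Qed.

Lemma nsqM (z w : C) : nsq (z * w) = nsq z * nsq w.
Proof. by case: z w => [a b] [c d]; rewrite /nsq /=; ring. Qed.

Lemma nsq_conj (z : C) : nsq z^* = nsq z.
Proof. by case: z => a b; rewrite /nsq /=; ring. Qed.

Lemma nsqN (z : C) : nsq (- z) = nsq z.
Proof. by case: z => a b; rewrite /nsq /=; ring. Qed.

Lemma nsq_real (x : R) : nsq x%:C = x ^+ 2.
Proof. by rewrite /nsq /=; ring. Qed.

Lemma nsqD_le (z w : C) : nsq (z + w) <= 2 * nsq z + 2 * nsq w.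
Proof.
case: z w => [a b] [c d]; rewrite /nsq /= -subr_ge0.
have -> : 2 * (a ^+ 2 + b ^+ 2) + 2 * (c ^+ 2 + d ^+ 2) -
  ((a + c) ^+ 2 + (b + d) ^+ 2) = (a - c) ^+ 2 + (b - d) ^+ 2 by ring.
by rewrite addr_ge0 ?sqr_ge0.
Qed.

Lemma nsq_eq0 (z : C) : nsq z = 0 -> z = 0.
Proof.
case: z => a b /eqP; rewrite /nsq /= paddr_eq0 ?sqr_ge0// !sqrf_eq0.
by move=> /andP[/eqP -> /eqP ->].
Qed.

Lemma Re_mulconj (z : C) : z * z^* = (nsq z)%:C.
Proof. by case: z => a b; apply/eqP; rewrite eq_complex /nsq /=; apply/andP; split; apply/eqP; ring. Qed.

Lemma conjcM (z w : C) : (z * w)^* = z^* * w^*.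
Proof. exact: rmorphM. Qed.

Lemma conjcD (z w : C) : (z + w)^* = z^* + w^*.
Proof. exact: rmorphD. Qed.

Lemma ReD (z w : C) : complex.Re (z + w) = complex.Re z + complex.Re w.
Proof. by case: z w => [a b] [c d]. Qed.

Lemma ReN (z : C) : complex.Re (- z) = - complex.Re z.
Proof. by case: z. Qed.

Lemma ImD (z w : C) : complex.Im (z + w) = complex.Im z + complex.Im w.
Proof. by case: z w => [a b] [c d]. Qed.

Lemma Re_sum I (r : seq I) (F : I -> C) :
  complex.Re (\sum_(i <- r) F i) = \sum_(i <- r) complex.Re (F i).
Proof. by elim/big_rec2: _ => // i x y _ <-; rewrite ReD. Qed.

Lemma Im_sum I (r : seq I) (F : I -> C) :
  complex.Im (\sum_(i <- r) F i) = \sum_(i <- r) complex.Im (F i).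
Proof. by elim/big_rec2: _ => // i x y _ <-; rewrite ImD. Qed.

Lemma conjc_sum I (r : seq I) (F : I -> C) :
  (\sum_(i <- r) F i)^* = \sum_(i <- r) (F i)^*.
Proof. exact: rmorph_sum. Qed.

Lemma Re_realM (x : R) (z : C) : complex.Re (x%:C * z) = x * complex.Re z.
Proof. by case: z => a b /=; ring. Qed.

End complex_normsq.

Section hermitian_forms.
Context {R : realType}.
Notation C := R[i].

(** The form lives on a predicate [S] because square integrable functions are a predicate on all
    functions, and it is only semidefinite because functions vanishing almost everywhere have norm
    zero. It is instantiated on the triangle, on [V], on a side and on pairs of gradient
    components. *)
Record herm_form (V : lmodType C) (S : V -> Prop) (B : V -> V -> C) : Prop :=
  HermForm {
    herm0 : S 0;
    hermD : forall u v, S u -> S v -> S (u + v);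
    hermZ : forall c u, S u -> S (c *: u);
    hermDl : forall u v w, S u -> S v -> S w -> B (u + v) w = B u w + B v w;
    hermZl : forall c u w, S u -> S w -> B (c *: u) w = c * B u w;
    hermC : forall u v, S u -> S v -> B v u = (B u v)^*;
    herm_ge0 : forall u, S u -> 0 <= complex.Re (B u u) }.

Arguments hermC {V S B} _ u v _ _.

Variables (V : lmodType C) (S : V -> Prop) (B : V -> V -> C).
Hypothesis HB : herm_form S B.

Let SN u : S u -> S (- u).
Proof. by move=> Su; rewrite -scaleN1r; exact: (hermZ HB). Qed.

Lemma herm_closedB u v : S u -> S v -> S (u - v).
Proof. by move=> Su /SN; exact: (hermD HB). Qed.

Lemma herm_closed_sum I (r : seq I) (c : I -> C) (e : I -> V) :
  (forall i, S (e i)) -> S (\sum_(i <- r) c i *: e i).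
Proof.
move=> Se; elim/big_rec: _ => [|i v _ Sv]; first exact: (herm0 HB).
by apply: (hermD HB) => //; exact: (hermZ HB).
Qed.

Lemma hermNl u w : S u -> S w -> B (- u) w = - B u w.
Proof. by move=> Su Sw; rewrite -scaleN1r (hermZl HB)// mulN1r. Qed.

Lemma hermBl u v w : S u -> S v -> S w -> B (u - v) w = B u w - B v w.
Proof. by move=> Su Sv Sw; rewrite (hermDl HB)// ?hermNl//; exact: SN. Qed.

Lemma herm0l w : S w -> B 0 w = 0.
Proof. by move=> Sw; rewrite -(scale0r 0) (hermZl HB)// ?mul0r//; exact: (herm0 HB). Qed.

Lemma herm_suml I (r : seq I) (c : I -> C) (e : I -> V) w :
  (forall i, S (e i)) -> S w ->
  B (\sum_(i <- r) c i *: e i) w = \sum_(i <- r) c i * B (e i) w.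
Proof.
move=> Se Sw; elim: r => [|i r IH]; first by rewrite !big_nil herm0l.
rewrite !big_cons (hermDl HB)// ?IH ?(hermZl HB)//; first exact: (hermZ HB).
exact: herm_closed_sum.
Qed.

Lemma herm_sumr I (r : seq I) (c : I -> C) (e : I -> V) w :
  (forall i, S (e i)) -> S w ->
  B w (\sum_(i <- r) c i *: e i) = \sum_(i <- r) (c i)^* * B w (e i).
Proof.
move=> Se Sw; have Sr := herm_closed_sum r c Se.
rewrite (hermC HB)// herm_suml// conjc_sum.
by apply: eq_bigr => i _; rewrite conjcM (hermC HB (e i) w).
Qed.

Lemma hermNr u w : S u -> S w -> B w (- u) = - B w u.
Proof.
move=> Su Sw; have SNu := SN Su.
by rewrite (hermC HB (- u) w)// hermNl// rmorphN /= -(hermC HB u w).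
Qed.

Lemma herm_sqrB u v : S u -> S v ->
  complex.Re (B (u - v) (u - v)) =
  complex.Re (B u u) - 2 * complex.Re (B u v) + complex.Re (B v v).
Proof.
move=> Su Sv; have Suv := herm_closedB Su Sv.
rewrite hermBl// (hermC HB (u - v) u)// (hermC HB (u - v) v)// !hermBl//.
rewrite (hermC HB u v)//.
case: (B u u) (B u v) (B v v) => [a b] [c d] [e f] /=; ring.
Qed.

Lemma herm_sqrD_le u v : S u -> S v ->
  complex.Re (B (u + v) (u + v)) <=
  2 * complex.Re (B u u) + 2 * complex.Re (B v v).
Proof.
move=> Su Sv; have := herm_ge0 HB (herm_closedB Su Sv).
have -> : u + v = u - (- v) by rewrite opprK.
have SNv := SN Sv; rewrite !herm_sqrB// hermNr// hermNr// hermNl// opprK ReN; lra.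
Qed.

(** The square of [u - t * B(u, v) v] is nonnegative for every real [t]. The choice
    [t = 1 / B(v, v)] gives the claim; if [B(v, v) = 0], a large [t] forces [B(u, v) = 0]. *)
Lemma herm_CS u v : S u -> S v ->
  nsq (B u v) <= complex.Re (B u u) * complex.Re (B v v).
Proof.
move=> Su Sv.
have key (t : R) : 0 <= complex.Re (B u u) - 2 * t * nsq (B u v) +
    t ^+ 2 * nsq (B u v) * complex.Re (B v v).
  have := herm_ge0 HB (herm_closedB Su (hermZ HB (t%:C * B u v) Sv)).
  rewrite herm_sqrB//; last exact: (hermZ HB).
  rewrite (hermZl HB)//; last exact: (hermZ HB).
  rewrite (hermC HB ((t%:C * B u v) *: v) u)//; last exact: (hermZ HB).
  rewrite (hermC HB ((t%:C * B u v) *: v) v)//; last exact: (hermZ HB).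
  rewrite !(hermZl HB)// (hermC HB u v)//.
  have : (B v v) = (B v v)^* by rewrite -(hermC HB).
  case: (B u u) (B u v) (B v v) => [a b] [c d] [e f] /= [] fE.
  by move=> h; apply: (le_trans h); rewrite le_eqVlt; apply/orP; left; apply/eqP; rewrite /nsq/=; ring.
have [v0|v0] := eqVneq (complex.Re (B v v)) 0.
  rewrite v0 mulr0 leNgt; apply/negP => n0.
  have := key ((complex.Re (B u u) + 1) / (2 * nsq (B u v))).
  rewrite v0 mulr0 addr0.
  have -> : 2 * ((complex.Re (B u u) + 1) / (2 * nsq (B u v))) * nsq (B u v)
    = complex.Re (B u u) + 1 by field; rewrite gt_eqF.
  lra.
have vp : 0 < complex.Re (B v v) by rewrite lt_def v0 (herm_ge0 HB).
have := key (complex.Re (B v v))^-1.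
rewrite -(pmulr_lge0 _ vp).
by rewrite -[in X in _ -> X]subr_ge0 => h; apply: (le_trans h); rewrite le_eqVlt;
  apply/orP; left; apply/eqP; field.
Qed.

Section expansion.
Variables (I : eqType) (F : seq I) (e : I -> V) (n : I -> R) (c : I -> C).
Hypothesis Se : forall i, S (e i).
Let w := \sum_(i <- F) c i *: e i.
Hypothesis Bwe : forall i, i \in F -> B w (e i) = (n i)%:C * c i.

(** The hypothesis [Bwe] plays the role of orthogonality. Unlike orthogonality of the family it is
    compatible with repetitions, which occur here because [phi m] depends only on the Weyl orbit of
    [m]. *)
Lemma herm_comb_sqr : complex.Re (B w w) = \sum_(i <- F) n i * nsq (c i).
Proof.
have Sw : S w by exact: herm_closed_sum.
rewrite {2}/w herm_sumr// Re_sum; apply: eq_big_seq => i iF.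
by rewrite Bwe// mulrCA Re_realM (mulrC _^*) Re_mulconj.
Qed.

Lemma herm_dist_sqr u : S u ->
  complex.Re (B (u - w) (u - w)) = complex.Re (B u u)
  - 2 * (\sum_(i <- F) complex.Re ((c i)^* * B u (e i)))
  + \sum_(i <- F) n i * nsq (c i).
Proof.
move=> Su; have Sw : S w by exact: herm_closed_sum.
by rewrite herm_sqrB// herm_comb_sqr {1}/w herm_sumr// Re_sum.
Qed.

End expansion.

Lemma herm_proj_dist (I : eqType) (F : seq I) (e : I -> V) (n : I -> R) u :
  (forall i, S (e i)) -> S u ->
  let w := \sum_(i <- F) ((n i)^-1%:C * B u (e i)) *: e i in
  (forall i, i \in F -> B w (e i) = (n i)%:C * ((n i)^-1%:C * B u (e i))) ->
  complex.Re (B (u - w) (u - w)) =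
  complex.Re (B u u) - \sum_(i <- F) nsq (B u (e i)) / n i.
Proof.
move=> Se Su w Bwe; rewrite (herm_dist_sqr Se Bwe)// -addrA; congr (_ + _).
rewrite mulr_sumr -!sumrN -big_split /=; apply: eq_bigr => i _.
rewrite conjcM -mulrA (mulrC (B u (e i))^*) Re_mulconj nsqM nsq_real.
have -> : ((n i)^-1%:C : C)^* = (n i)^-1%:C by apply/eqP; rewrite eq_complex /= oppr0 !eqxx.
(* A vanishing [n i] contributes nothing because [0^-1 = 0]; this case occurs for the gradient of
   the constant [phi (0, 0)]. *)
rewrite Re_realM /=; have [->|n0] := eqVneq (n i) 0; first by rewrite invr0; ring.
by field.
Qed.

Lemma herm_bessel (I : eqType) (F : seq I) (e : I -> V) (n : I -> R) u :
  (forall i, S (e i)) -> S u ->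
  let w := \sum_(i <- F) ((n i)^-1%:C * B u (e i)) *: e i in
  (forall i, i \in F -> B w (e i) = (n i)%:C * ((n i)^-1%:C * B u (e i))) ->
  \sum_(i <- F) nsq (B u (e i)) / n i <= complex.Re (B u u).
Proof.
move=> Se Su w Bwe; rewrite -subr_ge0 -(herm_proj_dist Se Su Bwe).
by apply: (herm_ge0 HB); apply: herm_closedB => //; exact: herm_closed_sum.
Qed.

End hermitian_forms.

Section L2_hermitian.
Context d (X : measurableType d) (R : realType).
Variables (mu : {measure set X -> \bar R}) (D : set X).
Hypothesis mD : measurable D.
Notation C := R[i].

Definition Cintegrable (f : X -> C) : Prop :=
  mu.-integrable D (EFin \o (fun x => complex.Re (f x))) /\
  mu.-integrable D (EFin \o (fun x => complex.Im (f x))).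

Definition ip (f g : X -> C) : C := Cintegral mu D (fun x => f x * (g x)^*).

Lemma CintegralD (f g : X -> C) : Cintegrable f -> Cintegrable g ->
  Cintegral mu D (fun x => f x + g x) = Cintegral mu D f + Cintegral mu D g.
Proof.
move=> [rf jf] [rg jg]; rewrite /Cintegral; apply/eqP; rewrite eq_complex /=.
apply/andP; split; apply/eqP; rewrite -RintegralD//; apply: eq_Rintegral => x _.
  by rewrite ReD.
by rewrite ImD.
Qed.

Lemma CintegralZ (c : C) (f : X -> C) : Cintegrable f ->
  Cintegral mu D (fun x => c * f x) = c * Cintegral mu D f.
Proof.
case: c => a b [rf jf]; rewrite /Cintegral; apply/eqP; rewrite eq_complex /=.
have iZ (r : R) (h : X -> R) : mu.-integrable D (EFin \o h) ->
    mu.-integrable D (EFin \o (fun x => r * h x)).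
  by move=> ih; have := integrableZl mD r ih; apply: eq_integrable.
apply/andP; split; apply/eqP.
  rewrite -!RintegralZl// -RintegralB//; [|exact: iZ..].
  by apply: eq_Rintegral => x _; case: (f x).
rewrite -!RintegralZl// -RintegralD//; [|exact: iZ..].
by apply: eq_Rintegral => x _; case: (f x) => /= u v; rewrite addrC (addrC (_ * _)).
Qed.

Lemma Cintegral_conj (f : X -> C) : Cintegrable f ->
  Cintegral mu D (fun x => (f x)^*) = (Cintegral mu D f)^*.
Proof.
move=> [rf jf]; rewrite /Cintegral; apply/eqP; rewrite eq_complex /=.
apply/andP; split; apply/eqP.
  by apply: eq_Rintegral => x _; case: (f x).
rewrite -mulN1r -RintegralZl//.
by apply: eq_Rintegral => x _; case: (f x) => a b /=; rewrite mulN1r.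
Qed.

Lemma eq_Cintegral (f g : X -> C) : (forall x, D x -> f x = g x) ->
  Cintegral mu D f = Cintegral mu D g.
Proof.
move=> fg; rewrite /Cintegral; congr (Complex _ _);
  by apply: eq_Rintegral => x /set_mem Dx; rewrite fg.
Qed.

Lemma eq_Cintegrable (f g : X -> C) : (forall x, f x = g x) ->
  Cintegrable f -> Cintegrable g.
Proof. by move=> /funext ->. Qed.

Lemma CintegrableD (f g : X -> C) : Cintegrable f -> Cintegrable g ->
  Cintegrable (fun x => f x + g x).
Proof.
move=> [rf jf] [rg jg]; split.
  by have := integrableD mD rf rg; apply: eq_integrable => // x _; rewrite /= ReD.
by have := integrableD mD jf jg; apply: eq_integrable => // x _; rewrite /= ImD.
Qed.

Lemma Cintegral_sum n (F : 'I_n -> X -> C) : (forall i, Cintegrable (F i)) ->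
  Cintegral mu D (fun x => \sum_(i < n) F i x) = \sum_(i < n) Cintegral mu D (F i).
Proof.
move=> iF; suff [] : Cintegrable (fun x => \sum_(i < n) F i x) /\
  Cintegral mu D (fun x => \sum_(i < n) F i x) = \sum_(i < n) Cintegral mu D (F i) by [].
elim: (index_enum _) => [|i s [i1 IH]].
  split.
    apply: (@eq_Cintegrable (fun=> 0)) => [x|]; first by rewrite big_nil.
    by split; exact: integrable0.
  rewrite big_nil -[RHS](_ : Cintegral mu D (fun=> 0) = 0).
    by apply: eq_Cintegral => x _; rewrite big_nil.
  by rewrite /Cintegral /= !Rintegral_cst ?mul0r.
split.
  have := CintegrableD (iF i) i1; apply: eq_Cintegrable => x.
  by rewrite big_cons.
rewrite big_cons -IH -CintegralD//; apply: eq_Cintegral => x _.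
by rewrite big_cons.
Qed.

Lemma measurable_nsq (f : X -> C) : measurable_fun D (fun x => complex.Re (f x)) ->
  measurable_fun D (fun x => complex.Im (f x)) ->
  measurable_fun D (fun x => nsq (f x)).
Proof. by move=> mr mi; apply: measurable_funD; exact: measurable_funX. Qed.

Lemma L2_nsq_integrable (f : X -> C) : L2 mu D f ->
  mu.-integrable D (EFin \o (fun x => nsq (f x))).
Proof.
move=> [mr mi fin]; apply/integrableP; split.
  by apply/measurable_EFinP; exact: measurable_nsq.
apply: le_lt_trans fin; rewrite /sqnorm le_eqVlt; apply/orP; left; apply/eqP.
by apply: eq_integral => x _ /=; rewrite ger0_norm ?nsq_ge0.
Qed.

Lemma L2P (f : X -> C) : measurable_fun D (fun x => complex.Re (f x)) ->
  measurable_fun D (fun x => complex.Im (f x)) ->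
  mu.-integrable D (EFin \o (fun x => nsq (f x))) -> L2 mu D f.
Proof.
move=> mr mi /integrableP[_ fin]; split => //; apply: le_lt_trans fin.
rewrite /sqnorm le_eqVlt; apply/orP; left; apply/eqP.
by apply: eq_integral => x _ /=; rewrite ger0_norm ?nsq_ge0.
Qed.

Lemma L2_dominated (f : X -> C) (h : X -> R) :
  measurable_fun D (fun x => complex.Re (f x)) ->
  measurable_fun D (fun x => complex.Im (f x)) ->
  mu.-integrable D (EFin \o h) -> (forall x, D x -> nsq (f x) <= h x) -> L2 mu D f.
Proof.
move=> mr mi ih fh; apply: L2P => //; apply: le_integrable ih => //.
  by apply/measurable_EFinP; exact: measurable_nsq.
move=> x Dx; rewrite lee_fin ger0_norm ?nsq_ge0//.
by rewrite (le_trans (fh x Dx))// ler_norm.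
Qed.

Lemma L2_0 : L2 mu D (fun=> 0).
Proof.
apply: (@L2_dominated _ (cst 0)) => //=.
- exact: integrable0.
- by move=> x _; rewrite /nsq /=; lra.
Qed.

Lemma L2D (f g : X -> C) : L2 mu D f -> L2 mu D g -> L2 mu D (fun x => f x + g x).
Proof.
move=> Lf Lg; have [rf jf _] := Lf; have [rg jg _] := Lg.
apply: (@L2_dominated _ (fun x => 2 * nsq (f x) + 2 * nsq (g x))).
- by under eq_fun do rewrite ReD; exact: measurable_funD.
- by under eq_fun do rewrite ImD; exact: measurable_funD.
- have i1 := integrableZl mD 2 (L2_nsq_integrable Lf).
  have i2 := integrableZl mD 2 (L2_nsq_integrable Lg).
  by have := integrableD mD i1 i2; apply: eq_integrable.
- by move=> x _; exact: nsqD_le.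
Qed.

Lemma L2Z (c : C) (f : X -> C) : L2 mu D f -> L2 mu D (fun x => c * f x).
Proof.
move=> Lf; have [rf jf _] := Lf.
apply: (@L2_dominated _ (fun x => nsq c * nsq (f x))).
- apply: (@eq_measurable_fun _ _ _ _ _ (fun x => complex.Re c * complex.Re (f x) - complex.Im c * complex.Im (f x))).
    by move=> x _; case: c (f x) => [a b] [u v].
  by apply: measurable_funB; exact: measurable_funM.
- apply: (@eq_measurable_fun _ _ _ _ _ (fun x => complex.Re c * complex.Im (f x) + complex.Im c * complex.Re (f x))).
    by move=> x _; case: c (f x) => [a b] [u v].
  by apply: measurable_funD; exact: measurable_funM.
- by have := integrableZl mD (nsq c) (L2_nsq_integrable Lf); apply: eq_integrable.
- by move=> x _; rewrite nsqM.
Qed.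

Let abs_le (a b u v : R) :
  `|a * u - b * - v| <= a ^+ 2 + b ^+ 2 + (u ^+ 2 + v ^+ 2) /\
  `|a * - v + b * u| <= a ^+ 2 + b ^+ 2 + (u ^+ 2 + v ^+ 2).
Proof.
have h x y : 0 <= (x - y : R) ^+ 2 /\ 0 <= (x + y) ^+ 2 by split; exact: sqr_ge0.
have [h1 h2] := h a u; have [h3 h4] := h b v.
have [h5 h6] := h a v; have [h7 h8] := h b u.
have k1 := sqr_ge0 a; have k2 := sqr_ge0 b; have k3 := sqr_ge0 u; have k4 := sqr_ge0 v.
by split; rewrite ler_norml; apply/andP; split; nra.
Qed.

Lemma L2M_integrable (f g : X -> C) : L2 mu D f -> L2 mu D g ->
  Cintegrable (fun x => f x * (g x)^*).
Proof.
move=> Lf Lg; have [rf jf _] := Lf; have [rg jg _] := Lg.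
have ih : mu.-integrable D (EFin \o (fun x => nsq (f x) + nsq (g x))).
  by have := integrableD mD (L2_nsq_integrable Lf) (L2_nsq_integrable Lg);
    apply: eq_integrable.
split; apply: le_integrable ih => //.
- apply/measurable_EFinP.
  apply: (@eq_measurable_fun _ _ _ _ _ (fun x => complex.Re (f x) * complex.Re (g x) + complex.Im (f x) * complex.Im (g x))).
    by move=> x _; case: (f x) (g x) => [a b] [u v] /=; ring.
  by apply: measurable_funD; exact: measurable_funM.
- move=> x _; rewrite lee_fin [leRHS](ger0_norm (addr_ge0 (nsq_ge0 _) (nsq_ge0 _))).
  case: (f x) (g x) => [a b] [u v]; rewrite /nsq /=.
  exact: (abs_le _ _ _ _).1.
- apply/measurable_EFinP.
  apply: (@eq_measurable_fun _ _ _ _ _ (fun x => complex.Im (f x) * complex.Re (g x) - complex.Re (f x) * complex.Im (g x))).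
    by move=> x _; case: (f x) (g x) => [a b] [u v] /=; ring.
  by apply: measurable_funB; exact: measurable_funM.
- move=> x _; rewrite lee_fin [leRHS](ger0_norm (addr_ge0 (nsq_ge0 _) (nsq_ge0 _))).
  case: (f x) (g x) => [a b] [u v]; rewrite /nsq /=.
  exact: (abs_le _ _ _ _).2.
Qed.

(** This is the square of the L2 norm. The triangle inequality therefore appears with factors 2, and
    tolerances are divided by 4. *)
Definition normL2 (f : X -> C) : R := fine (sqnorm mu D f).

Lemma ip_self (f : X -> C) : ip f f = (normL2 f)%:C.
Proof.
rewrite /ip /Cintegral /normL2 /sqnorm /Rintegral; congr (Complex _ _).
  by congr fine; apply: eq_integral => x _; rewrite Re_mulconj.
rewrite integral0_eq//= => x _; rewrite Re_mulconj.
by [].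
Qed.

Lemma sqnorm_fin (f : X -> C) : L2 mu D f -> sqnorm mu D f = (normL2 f)%:E.
Proof.
move=> [_ _ fin]; rewrite /normL2 fineK// ge0_fin_numE//.
by apply: integral_ge0 => x _; rewrite lee_fin nsq_ge0.
Qed.

Lemma normL2_ge0 (f : X -> C) : 0 <= normL2 f.
Proof. by apply: fine_ge0; apply: integral_ge0 => x _; rewrite lee_fin nsq_ge0. Qed.

Lemma L2_hermitian : @herm_form R (X -> R[i]^o) (L2 mu D) ip.
Proof.
split.
- exact: L2_0.
- exact: L2D.
- exact: L2Z.
- move=> u v w Lu Lv Lw; rewrite /ip -CintegralD; [|exact: L2M_integrable..].
  by apply: eq_Cintegral => x _; rewrite /= -mulrDl.
- move=> c u w Lu Lw; rewrite /ip -CintegralZ; last exact: L2M_integrable.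
  by apply: eq_Cintegral => x _; rewrite /= mulrA.
- move=> u v Lu Lv; rewrite /ip -Cintegral_conj; last exact: L2M_integrable.
  by apply: eq_Cintegral => x _; rewrite conjcM conjCK mulrC.
- by move=> u Lu; rewrite ip_self /= normL2_ge0.
Qed.

End L2_hermitian.

(** * The Neumann eigenfunctions of the triangle *)

Section cis.
Context {R : realType}.
Notation C := R[i].

Definition cis (x : R) : C := Complex (cos x) (sin x).

Lemma cisD x y : cis (x + y) = cis x * cis y.
Proof. by rewrite /cis cosD sinD; apply/eqP; rewrite eq_complex /=; apply/andP; split; apply/eqP; ring. Qed.

Lemma cis0 : cis 0 = 1.
Proof. by rewrite /cis cos0 sin0. Qed.

Lemma cisN x : cis (- x) = (cis x)^*.
Proof. by rewrite /cis cosN sinN. Qed.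

Lemma nsq_cis x : nsq (cis x) = 1.
Proof. by rewrite /nsq /= cos2Dsin2. Qed.

End cis.

Section weyl_group.

(* The Weyl group of type A2 in the basis of fundamental weights; [wmul] and
   [winv] are its multiplication table and its inverse. *)
Definition wact (g : 'I_6) (m : int * int) : int * int :=
  let: (j, k) := m in
  match nat_of_ord g with
  | 0%N => (j, k)
  | 1%N => (- j, j + k)
  | 2%N => (j + k, - k)
  | 3%N => (- j - k, j)
  | 4%N => (k, - j - k)
  | _ => (- k, - j)
  end.

Definition wmul (h g : 'I_6) : 'I_6 :=
  inord (nth 0 (nth [::] [:: [:: 0; 1; 2; 3; 4; 5]; [:: 1; 0; 3; 2; 5; 4];
    [:: 2; 4; 0; 5; 1; 3]; [:: 3; 5; 1; 4; 0; 2]; [:: 4; 2; 5; 0; 3; 1];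
    [:: 5; 3; 4; 1; 2; 0]] h) g)%N.

Definition winv (g : 'I_6) : 'I_6 := inord (nth 0%N [:: 0; 1; 2; 4; 3; 5]%N g).

(** The norm form of the hexagonal lattice, up to scale the unique quadratic form invariant under
    the Weyl group. *)
Definition freq_norm (m : int * int) : int := m.1 ^+ 2 + m.1 * m.2 + m.2 ^+ 2.

Lemma wactM h g m : wact h (wact g m) = wact (wmul h g) m.
Proof.
case: m => j k; case: h g => [[|[|[|[|[|[|//]]]]]] ?] [[|[|[|[|[|[|//]]]]]] ?];
  rewrite /wact /wmul /= !inordK//=; congr (_, _); lia.
Qed.

Lemma wactV g m : wact (winv g) (wact g m) = m.
Proof.
case: m => j k; case: g => [[|[|[|[|[|[|//]]]]]] ?];
  rewrite /wact /winv /= !inordK//=; congr (_, _); lia.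
Qed.

Lemma wactVr g m : wact g (wact (winv g) m) = m.
Proof.
case: m => j k; case: g => [[|[|[|[|[|[|//]]]]]] ?];
  rewrite /wact /winv /= !inordK//=; congr (_, _); lia.
Qed.

Lemma wact_inj g : injective (wact g).
Proof. exact: can_inj (wactV g). Qed.

Lemma wactB g m n : wact g (m.1 - n.1, m.2 - n.2) =
  ((wact g m).1 - (wact g n).1, (wact g m).2 - (wact g n).2).
Proof.
case: m n => [j k] [j' k']; case: g => [[|[|[|[|[|[|//]]]]]] ?];
  rewrite /wact /=; congr (_, _); lia.
Qed.

Lemma wact0 g : wact g (0, 0) = (0, 0).
Proof. by case: g => [[|[|[|[|[|[|//]]]]]] ?]. Qed.

Lemma freq_normW g m : freq_norm (wact g m) = freq_norm m.
Proof.
case: m => j k; case: g => [[|[|[|[|[|[|//]]]]]] ?];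
  rewrite /wact /freq_norm /=; ring.
Qed.

Lemma freq_norm_ge0 m : 0 <= freq_norm m.
Proof. case: m => j k; rewrite /freq_norm /=; nia. Qed.

Lemma freq_norm_eq0 m : freq_norm m = 0 -> m = (0, 0).
Proof.
case: m => j k; rewrite /freq_norm /= => h.
have j0 : j = 0 by nia.
have k0 : k = 0 by nia.
by rewrite j0 k0.
Qed.

(** The weight [(1, 3)] is regular: its six images are distinct, so a group element is determined by
    its action on it. *)
Lemma wmul_injl g : injective (wmul g).
Proof.
move=> h h' e; have := wactM g h (1, 3); rewrite e -wactM => /wact_inj.
case: h h' {e} => [[|[|[|[|[|[|//]]]]]] ?] [[|[|[|[|[|[|//]]]]]] ?];
  rewrite /wact //= => _; exact: val_inj.
Qed.

Lemma wmul_injr g : injective (wmul^~ g).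
Proof.
move=> h h' e; have := wactM h g (wact (winv g) (1, 3)).
rewrite e -wactM !wactVr.
case: h h' {e} => [[|[|[|[|[|[|//]]]]]] ?] [[|[|[|[|[|[|//]]]]]] ?];
  rewrite /wact //= => _; exact: val_inj.
Qed.

Lemma sum_wactr (V : zmodType) (f : int * int -> V) g m :
  \sum_(h < 6) f (wact h (wact g m)) = \sum_(h < 6) f (wact h m).
Proof.
under eq_bigr do rewrite wactM.
by rewrite [RHS](reindex_inj (@wmul_injr g)).
Qed.

Lemma sum_wactl (V : zmodType) (f : int * int -> V) g m :
  \sum_(h < 6) f (wact g (wact h m)) = \sum_(h < 6) f (wact h m).
Proof.
under eq_bigr do rewrite wactM.
by rewrite [RHS](reindex_inj (@wmul_injl g)).
Qed.

End weyl_group.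
Arguments wact : simpl never.

Section equilateral_facts.
Context {R : realType}.
Variables (L : R) (p : 'I_3 -> plane R).
Hypothesis p_eq : equilateral L p.

Notation v1x := ((vtx1 p).1 - (vtx0 p).1).
Notation v1y := ((vtx1 p).2 - (vtx0 p).2).
Notation v2x := ((vtx2 p).1 - (vtx0 p).1).
Notation v2y := ((vtx2 p).2 - (vtx0 p).2).

Lemma equilateral_gt0 : 0 < L. Proof. by case: p_eq. Qed.

Let sqr_edist (P Q : plane R) : Defs.edist P Q = L ->
  (P.1 - Q.1) ^+ 2 + (P.2 - Q.2) ^+ 2 = L ^+ 2.
Proof.
by move=> <-; rewrite /Defs.edist sqr_sqrtr// addr_ge0 ?sqr_ge0.
Qed.

Lemma equilateral_v11 : v1x ^+ 2 + v1y ^+ 2 = L ^+ 2.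
Proof. by apply: sqr_edist; apply: p_eq.2. Qed.

Lemma equilateral_v22 : v2x ^+ 2 + v2y ^+ 2 = L ^+ 2.
Proof. by apply: sqr_edist; apply: p_eq.2. Qed.

Lemma equilateral_v12 : v1x * v2x + v1y * v2y = L ^+ 2 / 2.
Proof.
have h : ((vtx1 p).1 - (vtx2 p).1) ^+ 2 + ((vtx1 p).2 - (vtx2 p).2) ^+ 2 = L ^+ 2.
  by apply: sqr_edist; apply: p_eq.2.
have := equilateral_v11; have := equilateral_v22; move: h.
move: (vtx0 p).1 (vtx0 p).2 (vtx1 p).1 (vtx1 p).2 (vtx2 p).1 (vtx2 p).2.
move=> a b c d e f h1 h2 h3.
have : (c - a) * (e - a) + (d - b) * (f - b) =
  (((c - a) ^+ 2 + (d - b) ^+ 2) + ((e - a) ^+ 2 + (f - b) ^+ 2)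
   - ((c - e) ^+ 2 + (d - f) ^+ 2)) / 2 by field.
by move=> ->; rewrite h1 h2 h3; field.
Qed.

Lemma tri_det_sqr : tri_det p ^+ 2 = 3 / 4 * L ^+ 4.
Proof.
have -> : tri_det p ^+ 2 = (v1x ^+ 2 + v1y ^+ 2) * (v2x ^+ 2 + v2y ^+ 2)
   - (v1x * v2x + v1y * v2y) ^+ 2 by rewrite /tri_det; ring.
by rewrite equilateral_v11 equilateral_v22 equilateral_v12; field.
Qed.

Lemma tri_det_neq0 : tri_det p != 0.
Proof.
have L0 := equilateral_gt0.
rewrite -sqrf_eq0 tri_det_sqr; apply/eqP => h.
have : 0 < L ^+ 4 by rewrite exprn_gt0.
lra.
Qed.

(** The wave vector is expanded along the two side vectors at the first vertex. The scaling makes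
    its squared length [kappa * freq_norm m] and makes phases [2 * pi / 3] times integer
    combinations of the affine coordinates. *)
Definition waven (m : int * int) : R * R :=
  (4 * pi / (3 * L ^+ 2) * (m.1%:~R * v1x + m.2%:~R * v2x),
   4 * pi / (3 * L ^+ 2) * (m.1%:~R * v1y + m.2%:~R * v2y)).

Definition phase (m : int * int) (P : plane R) : R :=
  (waven m).1 * (P.1 - (vtx0 p).1) + (waven m).2 * (P.2 - (vtx0 p).2).

Definition kappa : R := 16 * pi ^+ 2 / (9 * L ^+ 2).

Lemma kappa_gt0 : 0 < kappa.
Proof.
have L0 := equilateral_gt0.
by rewrite divr_gt0// mulr_gt0// ?exprn_gt0// pi_gt0.
Qed.

Lemma phase_map m a : phase m (tri_map p a) =
  2 * pi / 3 * ((2 * m.1 + m.2)%:~R * a.1 + (m.1 + 2 * m.2)%:~R * a.2).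
Proof.
have L0 := equilateral_gt0; rewrite /phase /waven /tri_map /=.
rewrite !rmorphD !rmorphM /=.
move: (m.1%:~R : R) (m.2%:~R : R) => j k.
transitivity (4 * pi / (3 * L ^+ 2) * (a.1 * (j * (v1x ^+ 2 + v1y ^+ 2) +
    k * (v1x * v2x + v1y * v2y)) + a.2 * (j * (v1x * v2x + v1y * v2y) +
    k * (v2x ^+ 2 + v2y ^+ 2)))).
  by ring.
rewrite equilateral_v11 equilateral_v22 equilateral_v12; field; lra.
Qed.

Lemma phaseB m n P :
  phase (m.1 - n.1, m.2 - n.2) P = phase m P - phase n P.
Proof. by rewrite /phase /waven /= !rmorphB /=; ring. Qed.

Lemma phase0 P : phase (0, 0) P = 0.
Proof. by rewrite /phase /waven /=; ring. Qed.

Definition chi (m : int * int) (P : plane R) : R[i] := cis (phase m P).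

Definition phi (m : int * int) (P : plane R) : R[i] :=
  \sum_(g < 6) chi (wact g m) P.

Lemma phiW g m : phi (wact g m) = phi m.
Proof. by apply/funext => P; rewrite /phi (sum_wactr (fun x => chi x P)). Qed.

Lemma phi0 P : phi (0, 0) P = 6%:C.
Proof.
rewrite /phi; under eq_bigr do rewrite wact0 /chi phase0 cis0.
by rewrite sumr_const card_ord -(rmorph_nat (real_complex R)).
Qed.

Lemma chi_mul_conj m n P :
  chi m P * (chi n P)^* = chi (m.1 - n.1, m.2 - n.2) P.
Proof. by rewrite /chi phaseB cisD cisN. Qed.

(** Translating the second group sum by the element [g] of the first turns each difference of
    frequencies into [wact g] of [m - wact h n], and the sum over [g] is again an orbit sum.
    Products thus stay in the span of the family; orthogonality, the algebra structure and Zygmund's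
    quadratic form all rest on this. *)
Lemma phi_mul_conj m n P : phi m P * (phi n P)^* =
  \sum_(h < 6) phi (m.1 - (wact h n).1, m.2 - (wact h n).2) P.
Proof.
rewrite {1}/phi mulr_suml exchange_big /=; apply: eq_bigr => g _.
rewrite /phi -(sum_wactl (fun x => chi x P) g n) conjc_sum mulr_sumr.
apply: eq_bigr => h _; rewrite chi_mul_conj.
by congr (chi _ P); rewrite wactB.
Qed.

End equilateral_facts.
Arguments waven : simpl never.

(** * Green's formula *)

Section directional_derivatives.
Context {R : realType}.

Lemma is_derive_plane (f : R * R -> R) (P v : R * R) (d : R) :
  (fun h : R => h^-1 * (f (P.1 + h * v.1, P.2 + h * v.2) - f P)) @ 0^' --> d ->
  is_derive P v f d.
Proof.
move=> h.
have e : (fun h : R => h^-1 *: ((f \o shift P) (h *: v) - f P)) =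
  (fun h : R => h^-1 * (f (P.1 + h * v.1, P.2 + h * v.2) - f P)).
  apply/funext => t /=; case: P v h => [x y] [a b] /= h.
  by congr (_ * (f (_, _) - _)); rewrite addrC.
apply: DeriveDef; first by rewrite /derivable e; apply/cvg_ex; exists d.
by rewrite /derive e; apply/cvg_lim.
Qed.

Lemma is_derive_plane_line (f : R * R -> R) (P v : R * R) (d t : R) :
  is_derive (P.1 + t * v.1, P.2 + t * v.2) v f d ->
  is_derive t 1 (fun h : R => f (P.1 + h * v.1, P.2 + h * v.2)) d.
Proof.
move=> [dv <-]; rewrite /derivable in dv.
have e : (fun h : R => h^-1 *: ((f \o shift (P.1 + t * v.1, P.2 + t * v.2)) (h *: v)
    - f (P.1 + t * v.1, P.2 + t * v.2))) =
  (fun h : R => h^-1 *: (((fun h : R => f (P.1 + h * v.1, P.2 + h * v.2)) \o shift t) (h *: 1)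
    - f (P.1 + t * v.1, P.2 + t * v.2))).
  apply/funext => h /=; case: P v dv => [x y] [a b] /= dv.
  congr (_ *: (f _ - _)).
  by rewrite -[X in _ = (_ + X * _, _ + X * _)]/(h * 1 + t); congr (_, _) => /=;
    rewrite mulr1 mulrDl addrCA.
by apply: DeriveDef; rewrite /derivable /derive -e.
Qed.

Lemma MVT_sym (g dg : R -> R) (u v : R) : (forall x : R, is_derive x 1 g (dg x)) ->
  exists2 c, `|c - u| <= `|v - u| & g v - g u = dg c * (v - u).
Proof.
move=> hg; have cg : continuous g.
  by move=> x; apply/differentiable_continuous/derivable1_diffP; case: (hg x).
have [uv|vu] := leP u v.
  have [c /[!in_itv]/= /andP[c1 c2] ->] := MVT_segment uv (fun x _ => hg x)
    (continuous_subspaceT cg).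
  by exists c => //; rewrite !ger0_norm; lra.
have [c /[!in_itv]/= /andP[c1 c2] e] := MVT_segment (ltW vu) (fun x _ => hg x)
  (continuous_subspaceT cg).
exists c; first by rewrite !ler0_norm; lra.
by rewrite -opprB e -mulrN opprB.
Qed.

Lemma partialE (f : plane R -> R) (i : 'I_2) (P : plane R) :
  derivable (f : R * R -> R) P (basis_vec R i) ->
  is_derive P (basis_vec R i) (f : R * R -> R) (partial i f P).
Proof. by move=> h; exact: derivableP. Qed.

(** The increment is split into a horizontal and a vertical one; the mean value theorem applies to
    each, and the intermediate points tend to [P], where the partial derivatives are continuous. *)
Lemma is_derive_C1 (f : plane R -> R) (P v : R * R) : Cn 1 f ->
  is_derive P v (f : R * R -> R)
    (v.1 * partial ord0 f P + v.2 * partial ord_max f P).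
Proof.
move=> [_ h]; apply: is_derive_plane.
have [d0 [c0 _]] := h ord0; have [d1 [c1 _]] := h ord_max.
case: P v => [x y] [a b] /=.
set p0 := partial ord0 f; set p1 := partial ord_max f.
have q0 u w : exists2 c, `|c - x| <= `|u - x| &
    f (u, w) - f (x, w) = p0 (c, w) * (u - x).
  apply: (MVT_sym (g := fun s => f (s, w)) (dg := fun s => p0 (s, w))) => s.
  have := partialE (d0 (s, w)) => /= ds.
  have := @is_derive_plane_line f (0, w) (basis_vec R ord0) (p0 (s, w)) s.
  rewrite /basis_vec /= add0r mulr1 mulr0 addr0 => /(_ ds).
  congr (is_derive _ _ _ _).
  by apply/funext => r; rewrite add0r mulr1 mulr0 addr0.
have q1 w : exists2 c, `|c - y| <= `|w - y| &
    f (x, w) - f (x, y) = p1 (x, c) * (w - y).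
  apply: (MVT_sym (g := fun s => f (x, s)) (dg := fun s => p1 (x, s))) => s.
  have := partialE (d1 (x, s)) => /= ds.
  have := @is_derive_plane_line f (x, 0) (basis_vec R ord_max) (p1 (x, s)) s.
  rewrite /basis_vec /= add0r mulr1 mulr0 addr0 => /(_ ds).
  congr (is_derive _ _ _ _).
  by apply/funext => r; rewrite add0r mulr1 mulr0 addr0.
apply/cvgrPdist_le => /= e e0.
pose e' := e / (1 + `|a| + `|b|).
have ab0 : 0 < 1 + `|a| + `|b| by rewrite -addrA ltr_wpDr// addr_ge0.
have e'0 : 0 < e' by rewrite divr_gt0.
have /cvgrPdist_lt/(_ e' e'0) /nbhs_ballP[r0 /= r00 hr0] := c0 (x, y).
have /cvgrPdist_lt/(_ e' e'0) /nbhs_ballP[r1 /= r10 hr1] := c1 (x, y).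
pose r := Num.min r0 r1.
have rp : 0 < r by rewrite lt_min r00.
apply/nbhs_ballP; exists (r / (1 + `|a| + `|b|)) => /=; first by rewrite divr_gt0.
move=> t; rewrite /ball /= sub0r normrN => tr t0.
have tab : `|t| * (1 + `|a| + `|b|) < r by rewrite -ltr_pdivlMr.
have ta : `|t * a| < r.
  by rewrite normrM; apply: le_lt_trans tab; rewrite ler_wpM2l// -addrA addrCA lerDl addr_ge0.
have tb : `|t * b| < r.
  by rewrite normrM; apply: le_lt_trans tab; rewrite ler_wpM2l// addrC lerDl addr_ge0.
have [c hc ec] := q0 (x + t * a) (y + t * b).
have [c' hc' ec'] := q1 (y + t * b).
have -> : t^-1 * (f (x + t * a, y + t * b) - f (x, y)) =
    a * p0 (c, y + t * b) + b * p1 (x, c').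
  have -> : f (x + t * a, y + t * b) - f (x, y) =
    (f (x + t * a, y + t * b) - f (x, y + t * b)) + (f (x, y + t * b) - f (x, y)) by ring.
  by rewrite ec ec'; field.
have xt : x + t * a - x = t * a by ring.
have yt : y + t * b - y = t * b by ring.
have b0 : `|p0 (x, y) - p0 (c, y + t * b)| < e'.
  apply: hr0; split => /=; rewrite /ball /=.
    rewrite distrC; apply: le_lt_trans hc _.
    by rewrite xt (lt_le_trans ta)// ge_min lexx.
  by rewrite distrC yt (lt_le_trans tb)// ge_min lexx.
have b1 : `|p1 (x, y) - p1 (x, c')| < e'.
  apply: hr1; split => /=; rewrite /ball /= ?subrr ?normr0//.
  rewrite distrC; apply: le_lt_trans hc' _.
  by rewrite yt (lt_le_trans tb)// ge_min lexx orbT.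
have -> : a * p0 (x, y) + b * p1 (x, y) - (a * p0 (c, y + t * b) + b * p1 (x, c')) =
  a * (p0 (x, y) - p0 (c, y + t * b)) + b * (p1 (x, y) - p1 (x, c')) by ring.
apply: le_trans (ler_normD _ _) _; rewrite !normrM.
have -> : e = e' * (1 + `|a| + `|b|) by rewrite /e' divfK// gt_eqF.
have := ler_wpM2l (normr_ge0 a) (ltW b0); have := ler_wpM2l (normr_ge0 b) (ltW b1).
move: e'0; clear; nra.
Qed.

End directional_derivatives.

Section trigonometric_sums.
Context {R : realType}.

Lemma is_derive_plane_of_line (f : R * R -> R) (P v : R * R) (d : R) :
  is_derive (0 : R) 1 (fun h : R => f (P.1 + h * v.1, P.2 + h * v.2)) d ->
  is_derive P v f d.
Proof.
move=> [dv <-]; apply: is_derive_plane; rewrite /derivable /derive in dv *.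
have e : (fun h : R => h^-1 * (f (P.1 + h * v.1, P.2 + h * v.2) - f P)) =
  (fun h : R => h^-1 *: (((fun h : R => f (P.1 + h * v.1, P.2 + h * v.2)) \o shift 0) (h *: 1)
    - f (P.1 + 0 * v.1, P.2 + 0 * v.2))).
  apply/funext => h /=; case: P v dv => [x y] [a b] /= dv.
  have -> : h%:A = h :> R by exact: mulr1.
  by rewrite !mul0r !addr0.
by rewrite e; exact: dv.
Qed.

Lemma is_derive_cos_line (a u t : R) :
  is_derive t 1 (fun h : R => cos (u + h * a)) (- sin (u + t * a) * a).
Proof.
apply: (@is_derive1_comp _ cos (fun h => u + h * a)).
have := @is_deriveD R _ _ (cst u) (fun h : R => h * a) t 1 0 a.
rewrite add0r; apply => /=.
have := @is_deriveM R _ id (cst a) t 1 1 0; rewrite scaler0 add0r.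
by move=> h; apply: (is_derive_eq (h _ _)); exact: mulr1.
Qed.

(** Each entry is an amplitude, a wave vector and a phase shift. Since a derivative of the cosine is
    a shift by [pi / 2], the class is closed under partial derivatives, and one induction gives
    smoothness of all orders. *)
Definition trigsum (s : seq (R * (R * R) * R)) (P : plane R) : R :=
  \sum_(c <- s) c.1.1 * cos (c.2 + c.1.2.1 * P.1 + c.1.2.2 * P.2).

Lemma continuous_trigsum s : continuous (trigsum s : R * R -> R).
Proof.
move=> P; rewrite /trigsum; elim: s => [|c s IH].
  by under eq_fun do rewrite big_nil; exact: cvg_cst.
under eq_fun do rewrite big_cons; apply: cvgD => //.
apply: cvgM; first exact: cvg_cst.
apply: (continuous_comp (f := fun P : R * R => c.2 + c.1.2.1 * P.1 + c.1.2.2 * P.2) (g := cos)).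
  exact: continuous_affine2.
exact: continuous_cos.
Qed.

Lemma is_derive_trigsum s (P v : R * R) :
  is_derive P v (trigsum s : R * R -> R)
    (\sum_(c <- s) c.1.1 * - sin (c.2 + c.1.2.1 * P.1 + c.1.2.2 * P.2) *
       (c.1.2.1 * v.1 + c.1.2.2 * v.2)).
Proof.
apply: is_derive_plane_of_line; rewrite /trigsum; elim: s => [|c s IH].
  by under eq_fun do rewrite big_nil; rewrite big_nil; exact: is_derive_cst.
under eq_fun do rewrite big_cons; rewrite big_cons.
apply: (@is_deriveD R _ _ (fun h : R => c.1.1 * cos (c.2 + c.1.2.1 * (P.1 + h * v.1) + c.1.2.2 * (P.2 + h * v.2)))) => //.
have := is_derive_cos_line (c.1.2.1 * v.1 + c.1.2.2 * v.2)
  (c.2 + c.1.2.1 * P.1 + c.1.2.2 * P.2) 0.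
move/(@is_deriveZ R _ _ _ c.1.1).
rewrite mul0r addr0 => h; apply: (is_derive_eq (f' := c.1.1 *:
  (- sin (c.2 + c.1.2.1 * P.1 + c.1.2.2 * P.2) * (c.1.2.1 * v.1 + c.1.2.2 * v.2)))).
  move: h; congr (is_derive _ _ _ _); apply/funext => h /=.
  by congr (_ * cos _); ring.
by rewrite -mulrA.
Qed.

Definition coordn (i : 'I_2) (v : R * R) : R := if i == ord0 then v.1 else v.2.

Lemma coordn_basis (i : 'I_2) (v : R * R) :
  v.1 * (basis_vec R i).1 + v.2 * (basis_vec R i).2 = coordn i v.
Proof.
rewrite /basis_vec /coordn; case: i => [[|[|//]]] ? /=; ring.
Qed.

Lemma partial_trigsum i s : partial i (trigsum s) =
  trigsum [seq (c.1.1 * coordn i c.1.2, c.1.2, c.2 + pi / 2) | c <- s].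
Proof.
apply/funext => P; rewrite /partial.
have [_ ->] := is_derive_trigsum s P (basis_vec R i).
rewrite /trigsum big_map; apply: eq_bigr => c _ /=.
rewrite coordn_basis (_ : c.2 + pi / 2 + _ + _ =
  (c.2 + c.1.2.1 * P.1 + c.1.2.2 * P.2) + pi / 2); last by ring.
by rewrite cosD cos_pihalf sin_pihalf; ring.
Qed.

Lemma Cn_trigsum n s : Cn n (trigsum s).
Proof.
elim: n s => [|n IH] s; split => //; try exact: continuous_trigsum.
move=> i; split; last by rewrite partial_trigsum; exact: IH.
by move=> P; have [] := is_derive_trigsum s P (basis_vec R i).
Qed.

End trigonometric_sums.

Section green.
Context {R : realType}.
Variables (L : R) (p : 'I_3 -> plane R).
Hypothesis p_eq : equilateral L p.
Notation M := (measurableTypeR R * measurableTypeR R)%type.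
Notation wv := (waven L p).
Notation ph := (phase L p).

Lemma periodic2pi (z : int) (x : R) :
  cos (x + 2 * pi * z%:~R) = cos x /\ sin (x + 2 * pi * z%:~R) = sin x.
Proof.
have pn (n : nat) (y : R) : cos (y + 2 * pi * n%:R) = cos y /\ sin (y + 2 * pi * n%:R) = sin y.
  have -> : 2 * pi * n%:R = (pi *+ 2) *+ n :> R by rewrite -[pi *+ 2]mulr_natl -[RHS]mulr_natr.
  by rewrite (periodicn (@cosD2pi R)) (periodicn (@sinD2pi R)).
case: z => n; first exact: pn.
have := pn n.+1 (x + 2 * pi * (Negz n)%:~R).
rewrite NegzE rmorphN /= -addrA mulrN addNr addr0.
by move=> [-> ->].
Qed.

(** The shift [d] treats real and imaginary parts of [phi m] together: they are the cases [d = 0]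
    and [d = - (pi / 2)]. *)
Definition twave (m : int * int) (d : R) (P : plane R) : R :=
  \sum_(g < 6) cos (ph (wact g m) P + d).

Definition dtwave (i : 'I_2) (m : int * int) (d : R) (P : plane R) : R :=
  \sum_(g < 6) - sin (ph (wact g m) P + d) * coordn i (wv (wact g m)).

Let tseq m d := [seq (1 : R, wv (wact g m), d - ((wv (wact g m)).1 * (vtx0 p).1
   + (wv (wact g m)).2 * (vtx0 p).2)) | g <- enum 'I_6].

Let twaveE m d : twave m d = trigsum (tseq m d).
Proof.
apply/funext => P; rewrite /trigsum /twave big_map big_enum.
apply: eq_bigr => g _; rewrite /phase; move: (wv (wact g m)) => w /=.
by rewrite mul1r; congr cos; ring.
Qed.

Lemma Cn_twave n m d : Cn n (twave m d).
Proof. by rewrite twaveE; exact: Cn_trigsum. Qed.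

Lemma continuous_twave m d : continuous (twave m d : R * R -> R).
Proof. by case: (Cn_twave 0 m d). Qed.

Lemma partial_twave i m d : partial i (twave m d) = dtwave i m d.
Proof.
rewrite twaveE partial_trigsum; apply/funext => P.
rewrite /trigsum /dtwave big_map /tseq big_map big_enum; apply: eq_bigr => g _.
rewrite -cosDpihalf /phase; move: (wv (wact g m)) => w /=.
by rewrite mul1r mulrC; congr (cos _ * _); ring.
Qed.

Lemma continuous_dtwave i m d : continuous (dtwave i m d : R * R -> R).
Proof. by rewrite -partial_twave; case: (Cn_twave 1 m d) => _ /(_ i)[_ []]. Qed.

Lemma Rintegral_triangle (F : R * R -> R) : continuous F ->
  \int[area R]_(P in (open_triangle p : set (lplane R))) F P =
  `|tri_det p| * \int[borel_area R]_(a in (std_triangle : set M)) F (tri_map p a).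
Proof.
move=> cF; have D0 := tri_det_neq0 p_eq.
have mT : measurable (open_triangle p : set M).
  by apply: open_measurable2; exact: open_open_triangle.
have mF : measurable_fun (open_triangle p : set M) (EFin \o F : M -> \bar R).
  apply/measurable_EFinP; apply: measurable_funTS; exact: continuous_measurable2.
have cFm : continuous (F \o tri_map p : R * R -> R).
  by move=> a; apply: continuous_comp; [exact: continuous_tri_map|exact: cF].
have iF := std_triangle_integrable cFm.
rewrite /Rintegral integralE [in RHS]integralE.
rewrite (area_map_ge0_integral D0 mT (measurable_funepos mF)); last by move=> *; exact: funepos_ge0.
rewrite (area_map_ge0_integral D0 mT (measurable_funeneg mF)); last by move=> *; exact: funeneg_ge0.
rewrite (open_triangle_map D0).
have f1 := integrable_fin_num measurable_std_triangle (integrable_funepos measurable_std_triangle iF).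
have f2 := integrable_fin_num measurable_std_triangle (integrable_funeneg measurable_std_triangle iF).
have key (c : R) (x y : \bar R) : x \is a fin_num -> y \is a fin_num ->
    fine (c%:E * x - c%:E * y)%E = c * fine (x - y)%E.
  by case: x => [x| |]//; case: y => [y| |]// _ _; rewrite /= mulrBr.
have e1 := funepos_comp (EFin \o F) (tri_map p).
have e2 := funeneg_comp (EFin \o F) (tri_map p).
rewrite -[EFin \o (F \o _)]/((EFin \o F) \o tri_map p) e1 in f1.
rewrite -[EFin \o (F \o _)]/((EFin \o F) \o tri_map p) e2 in f2.
rewrite (key _ _ _ f1 f2); congr (_ * fine (_ - _)%E).
  by apply: eq_integral => x _; rewrite /= !funeposE.
by apply: eq_integral => x _; rewrite /= !funenegE.
Qed.

Lemma triangle_integrable (F : R * R -> R) : continuous F ->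
  (area R).-integrable (open_triangle p : set (lplane R)) (EFin \o F).
Proof.
move=> cF; have D0 := tri_det_neq0 p_eq.
have mT : measurable (open_triangle p : set M).
  by apply: open_measurable2; exact: open_open_triangle.
have cFm : continuous (F \o tri_map p : R * R -> R).
  by move=> a; apply: continuous_comp; [exact: continuous_tri_map|exact: cF].
have mF : measurable_fun (open_triangle p : set M) (abse \o (EFin \o F) : M -> \bar R).
  apply: measurableT_comp => //; apply/measurable_EFinP.
  apply: measurable_funTS; exact: continuous_measurable2.
apply/integrableP; split.
  apply/measurable_EFinP; apply: continuous_lplane_measurable => //.
  exact: measurable_triangle.
have /integrableP[_ fin] := std_triangle_integrable cFm.
have := area_map_ge0_integral D0 mT mF (fun _ _ => abse_ge0 _).
rewrite (open_triangle_map D0) => h; rewrite [ltLHS]h.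
by rewrite lte_mul_pinfty.
Qed.

Lemma area_triangle_fin : (area R (open_triangle p : set (lplane R)) < +oo)%E.
Proof.
have mT := measurable_triangle (tri_det_neq0 p_eq).
have := triangle_integrable (@cst_continuous _ _ (1 : R)).
move=> /integrableP[_]; apply: le_lt_trans.
under eq_integral do rewrite /= normr1.
by rewrite integral_cst// mul1e.
Qed.

End green.

Section green_identity.
Context {R : realType}.
Variables (L : R) (p : 'I_3 -> plane R).
Hypothesis p_eq : equilateral L p.
Notation M := (measurableTypeR R * measurableTypeR R)%type.
Notation ph := (phase L p).
Notation kap := (kappa L).
Notation c0 := (4 * pi / (3 * L ^+ 2) : R).

Lemma continuous_sum_ord (T : topologicalType) n (F : 'I_n -> T -> R) :
  (forall i, continuous (F i)) -> continuous (fun x => \sum_(i < n) F i x).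
Proof.
move=> cF x; rewrite /continuous_at; elim: (index_enum _) => [|i s IH].
  by under eq_fun do rewrite big_nil; rewrite big_nil; exact: cvg_cst.
by under eq_fun do rewrite big_cons; rewrite big_cons; apply: cvgD => //; exact: cF.
Qed.

(** With [q = - sin] and [u] a multiple of one coordinate, this is a component of the gradient of
    [twave] in the basis of the two sides at the first vertex; with [q = - cos] it gives the
    derivatives of these components. *)
Definition side_wave (u : int * int -> R) (q : R -> R) (m : int * int) (d : R)
    (a : R * R) : R :=
  \sum_(g < 6) q (ph (wact g m) (tri_map p a) + d) * u (wact g m).

Lemma continuous_side_wave u q m d : continuous q ->
  continuous (side_wave u q m d : R * R -> R).
Proof.
move=> cq; apply: continuous_sum_ord => g a.
apply: cvgM; last exact: cvg_cst.
apply: (continuous_comp (f := fun a : R * R => ph (wact g m) (tri_map p a) + d)); last exact: cq.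
set n := wact g m.
have -> : (fun a : R * R => ph n (tri_map p a) + d) = (fun a : R * R =>
   d + 2 * pi / 3 * (2 * n.1 + n.2)%:~R * a.1 + 2 * pi / 3 * (n.1 + 2 * n.2)%:~R * a.2).
  by apply/funext => b; rewrite (phase_map p_eq); ring.
exact: continuous_affine2.
Qed.

Let wave_calc (A B c x : R) :
  c *: (- sin (B + pi / 2 + x * A) * ((0 + 1) * (x *: 0 + A%:A))) =
  - cos (B + x * A) * (A * c).
Proof.
rewrite scaler0 !add0r mul1r (_ : A%:A = A); last exact: mulr1.
by rewrite addrAC sinDpihalf -[LHS]/(_ * _); ring.
Qed.

Lemma is_derive_side_wave1 u m d (s t : R) :
  is_derive s 1 (fun s => side_wave u (fun x => - sin x) m d (s, t))
    (side_wave (fun n => 2 * pi / 3 * (2 * n.1 + n.2)%:~R * u n)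
       (fun x => - cos x) m d (s, t)).
Proof.
have -> : (fun s => side_wave u (fun x => - sin x) m d (s, t)) =
  \sum_(g < 6) (fun s : R => u (wact g m) *: cos ((2 * pi / 3 * ((wact g m).1 + 2 * (wact g m).2)%:~R * t + d + pi / 2)
   + s * (2 * pi / 3 * (2 * (wact g m).1 + (wact g m).2)%:~R))).
  apply/funext => r; rewrite fct_sumE; apply: eq_bigr => g _.
  rewrite -cosDpihalf (phase_map p_eq) /= mulrC; congr (_ * cos _); ring.
apply: is_derive_eq.
rewrite /side_wave; apply: eq_bigr => g _; rewrite (phase_map p_eq) /= wave_calc.
by rewrite !rmorphD !rmorphM /=; congr (- cos _ * _); ring.
Qed.

Lemma is_derive_side_wave2 u m d (s t : R) :
  is_derive t 1 (fun t => side_wave u (fun x => - sin x) m d (s, t))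
    (side_wave (fun n => 2 * pi / 3 * (n.1 + 2 * n.2)%:~R * u n)
       (fun x => - cos x) m d (s, t)).
Proof.
have -> : (fun t => side_wave u (fun x => - sin x) m d (s, t)) =
  \sum_(g < 6) (fun t : R => u (wact g m) *: cos ((2 * pi / 3 * (2 * (wact g m).1 + (wact g m).2)%:~R * s + d + pi / 2)
   + t * (2 * pi / 3 * ((wact g m).1 + 2 * (wact g m).2)%:~R))).
  apply/funext => r; rewrite fct_sumE; apply: eq_bigr => g _.
  rewrite -cosDpihalf (phase_map p_eq) /= mulrC; congr (_ * cos _); ring.
apply: is_derive_eq.
rewrite /side_wave; apply: eq_bigr => g _; rewrite (phase_map p_eq) /= wave_calc.
by rewrite !rmorphD !rmorphM /=; congr (- cos _ * _); ring.
Qed.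

Lemma sum_wact_odd (F : int * int -> R) (g : 'I_6) m :
  (forall n, F (wact g n) = - F n) -> \sum_(h < 6) F (wact h m) = 0.
Proof.
move=> Fg; have : \sum_(h < 6) F (wact h m) = - \sum_(h < 6) F (wact h m).
  rewrite -[LHS](sum_wactl F g m) -sumrN.
  by apply: eq_bigr => h _; rewrite Fg.
lra.
Qed.

(** The Neumann condition on the side [s = 0]: the reflection [inord 1] leaves the phases on that
    side unchanged and reverses the component of the wave vector transversal to it, so the terms
    cancel in pairs. The other two sides use [inord 2] and [inord 5]. *)
Lemma side_wave_left m d t :
  side_wave (fun n => c0 * n.1%:~R) (fun x => - sin x) m d (0, t) = 0.
Proof.
rewrite /side_wave (sum_wact_odd (F := fun n => - sin (ph n (tri_map p (0, t)) + d) * (c0 * n.1%:~R)) (g := inord 1))//.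
move=> n; rewrite /wact inordK//; case: n => j k.
rewrite !(phase_map p_eq) /= !mulr0 !add0r rmorphN /=.
have -> : - j + 2 * (j + k) = j + 2 * k by ring.
by ring.
Qed.

Lemma side_wave_bottom m d s :
  side_wave (fun n => c0 * n.2%:~R) (fun x => - sin x) m d (s, 0) = 0.
Proof.
rewrite /side_wave (sum_wact_odd (F := fun n => - sin (ph n (tri_map p (s, 0)) + d) * (c0 * n.2%:~R)) (g := inord 2))//.
move=> n; rewrite /wact inordK//; case: n => j k.
rewrite !(phase_map p_eq) /= !mulr0 !addr0 rmorphN /=.
have -> : 2 * (j + k) + - k = 2 * j + k by ring.
by ring.
Qed.

Lemma side_wave_hyp m d s :
  side_wave (fun n => c0 * n.1%:~R) (fun x => - sin x) m d (s, 1 - s) +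
  side_wave (fun n => c0 * n.2%:~R) (fun x => - sin x) m d (s, 1 - s) = 0.
Proof.
rewrite /side_wave -big_split /=.
pose F (n : int * int) := - sin (ph n (tri_map p (s, 1 - s)) + d) * (c0 * n.1%:~R) +
  - sin (ph n (tri_map p (s, 1 - s)) + d) * (c0 * n.2%:~R).
rewrite -/(\sum_(h < 6) F (wact h m)) (sum_wact_odd (F := F) (g := inord 5))//.
move=> n; rewrite /F /wact inordK//; case: n => j k.
rewrite !(phase_map p_eq) /=.
(* The third side does not pass through the first vertex, so its reflection is affine; the
   translation part changes the phase by an integer multiple of [2 * pi]. *)
have -> : 2 * pi / 3 * ((2 * j + k)%:~R * s + (j + 2 * k)%:~R * (1 - s)) + d =
  2 * pi / 3 * ((2 * - k + - j)%:~R * s + (- k + 2 * - j)%:~R * (1 - s)) + d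
  + 2 * pi * (j + k)%:~R :> R.
  by rewrite !rmorphD !rmorphM !rmorphN /=; field.
rewrite (periodic2pi _ _).2 !rmorphN /=; ring.
Qed.

Notation dt0 := (dtwave L p ord0).
Notation dt1 := (dtwave L p ord_max).
Notation tw := (twave L p).

(** The divergence theorem for [f] times the gradient of [twave]: the flux vanishes by the Neumann
    condition on the three sides, and the divergence of the gradient is [- kappa * freq_norm m]
    times [twave]. *)
Theorem green_real (f : plane R -> R) m d : Cn 1 f ->
  \int[area R]_(P in (open_triangle p : set (lplane R)))
    (partial ord0 f P * dt0 m d P + partial ord_max f P * dt1 m d P
     - kap * (freq_norm m)%:~R * (f P * tw m d P)) = 0.
Proof.
move=> Cf; have [cf h] := Cf.
have [_ [c0f _]] := h ord0; have [_ [c1f _]] := h ord_max.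
rewrite (Rintegral_triangle p_eq); last first.
  move=> P; apply: cvgB; first apply: cvgD; apply: cvgM.
  - exact: c0f.
  - exact: continuous_dtwave.
  - exact: c1f.
  - exact: continuous_dtwave.
  - exact: cvg_cst.
  - by apply: cvgM; [exact: cf|exact: continuous_twave].
pose v1 : R * R := ((vtx1 p).1 - (vtx0 p).1, (vtx1 p).2 - (vtx0 p).2).
pose v2 : R * R := ((vtx2 p).1 - (vtx0 p).1, (vtx2 p).2 - (vtx0 p).2).
pose df (v : R * R) (a : R * R) := v.1 * partial ord0 f (tri_map p a)
  + v.2 * partial ord_max f (tri_map p a).
pose u1 (n : int * int) : R := c0 * n.1%:~R.
pose u2 (n : int * int) : R := c0 * n.2%:~R.
pose w1 (n : int * int) := 2 * pi / 3 * (2 * n.1 + n.2)%:~R * u1 n.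
pose w2 (n : int * int) := 2 * pi / 3 * (n.1 + 2 * n.2)%:~R * u2 n.
pose S u := side_wave u (fun x => - sin x) m d.
pose K u := side_wave u (fun x => - cos x) m d.
have cS u : continuous (S u : R * R -> R).
  by apply: continuous_side_wave => x; apply: cvgN; exact: continuous_sin.
have cK u : continuous (K u : R * R -> R).
  by apply: continuous_side_wave => x; apply: cvgN; exact: continuous_cos.
have cfm : continuous (f \o tri_map p : R * R -> R).
  by move=> a; apply: continuous_comp; [exact: continuous_tri_map|exact: cf].
have cdf v : continuous (df v : R * R -> R).
  move=> a; apply: cvgD; apply: cvgM; try exact: cvg_cst.
    by apply: (continuous_comp (g := partial ord0 f)); [exact: continuous_tri_map|exact: c0f].
  by apply: (continuous_comp (g := partial ord_max f)); [exact: continuous_tri_map|exact: c1f].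
have e1 (t r : R) : tri_map p (r, t) =
    ((tri_map p (0, t)).1 + r * v1.1, (tri_map p (0, t)).2 + r * v1.2).
  by rewrite /tri_map /v1 /=; congr (_, _); ring.
have e2 (s r : R) : tri_map p (s, r) =
    ((tri_map p (s, 0)).1 + r * v2.1, (tri_map p (s, 0)).2 + r * v2.2).
  by rewrite /tri_map /v2 /=; congr (_, _); ring.
have D1 (s t : R) : is_derive s 1 (fun s => f (tri_map p (s, t))) (df v1 (s, t)).
  have := is_derive_C1 (tri_map p (s, t)) v1 Cf; rewrite -/(df v1 (s, t)) (e1 t s).
  move/is_derive_plane_line; congr (is_derive _ _ _ _).
  by apply/funext => r; rewrite (e1 t r).
have D2 (s t : R) : is_derive t 1 (fun t => f (tri_map p (s, t))) (df v2 (s, t)).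
  have := is_derive_C1 (tri_map p (s, t)) v2 Cf; rewrite -/(df v2 (s, t)) (e2 s t).
  move/is_derive_plane_line; congr (is_derive _ _ _ _).
  by apply/funext => r; rewrite (e2 s r).
pose G1 a := f (tri_map p a) * S u1 a.
pose G2 a := f (tri_map p a) * S u2 a.
pose g1 a := f (tri_map p a) * K w1 a + S u1 a * df v1 a.
pose g2 a := f (tri_map p a) * K w2 a + S u2 a * df v2 a.
transitivity (`|tri_det p| *
    \int[borel_area R]_(a in (std_triangle : set M)) (g1 a + g2 a)).
  congr (_ * _); apply: eq_Rintegral => a _; rewrite /g1 /g2.
  have -> : partial ord0 f (tri_map p a) * dt0 m d (tri_map p a) +
     partial ord_max f (tri_map p a) * dt1 m d (tri_map p a) =
     S u1 a * df v1 a + S u2 a * df v2 a.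
    rewrite /dtwave /S /side_wave !mulr_sumr !mulr_suml -!big_split /=.
    apply: eq_bigr => g _; rewrite /df /u1 /u2 /v1 /v2 /coordn /= /waven /=; ring.
  have -> : kap * (freq_norm m)%:~R * (f (tri_map p a) * tw m d (tri_map p a)) =
     - (f (tri_map p a) * (K w1 a + K w2 a)).
    rewrite mulrCA -mulrN; congr (_ * _).
    rewrite /twave /K /side_wave mulr_sumr -big_split -sumrN /=.
    apply: eq_bigr => g _; rewrite -(freq_normW g m) /w1 /w2 /u1 /u2.
    have L0 := equilateral_gt0 p_eq.
    rewrite /kappa /freq_norm !rmorphD !rmorphM /=; field; lra.
  by ring.
suff -> : \int[borel_area R]_(a in (std_triangle : set M)) (g1 a + g2 a) = 0.
  by rewrite mulr0.
refine (std_triangle_divergence (G1 := G1) (G2 := G2) _ _ _ _ _ _ _ _ _).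
- by move=> a; apply: cvgM; [exact: cfm|exact: cS].
- by move=> a; apply: cvgM; [exact: cfm|exact: cS].
- by move=> a; apply: cvgD; apply: cvgM; [exact: cfm|exact: cK|exact: cS|exact: cdf].
- by move=> a; apply: cvgD; apply: cvgM; [exact: cfm|exact: cK|exact: cS|exact: cdf].
- by move=> s t; exact: (is_deriveM (D1 s t) (is_derive_side_wave1 u1 m d s t)).
- by move=> s t; exact: (is_deriveM (D2 s t) (is_derive_side_wave2 u2 m d s t)).
- by move=> t; rewrite /G1 /S side_wave_left mulr0.
- by move=> s; rewrite /G2 /S side_wave_bottom mulr0.
- by move=> s; rewrite /G1 /G2 /S -mulrDr side_wave_hyp mulr0.
Qed.

End green_identity.

(** * Orthogonality relations of the Neumann eigenfunctions *)

Section phi_system.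
Context {R : realType}.
Variables (L : R) (p : 'I_3 -> plane R).
Hypothesis p_eq : equilateral L p.
Notation M := (measurableTypeR R * measurableTypeR R)%type.
Notation C := R[i].
Notation T := (open_triangle p : set (lplane R)).
Notation kap := (kappa L).
Notation Phi := (phi L p).
Notation ipT := (@ip _ _ R (area R) T).

Definition tri_area : R := fine (area R T).

Lemma tri_areaE : area R T = tri_area%:E.
Proof.
by rewrite /tri_area fineK// ge0_fin_numE//; exact: area_triangle_fin p_eq.
Qed.

Lemma tri_area_gt0 : 0 < tri_area.
Proof.
have D0 := tri_det_neq0 p_eq.
have mT : measurable (open_triangle p : set M).
  by apply: open_measurable2; exact: open_open_triangle.
rewrite -lte_fin -tri_areaE (area_borel mT) (borel_area_map D0 mT) (open_triangle_map D0).
rewrite mule_gt0 ?lte_fin ?normr_gt0//.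
pose B : set M := `](1/4 : R), (1/2)[%classic `*` `](1/4 : R), (1/2)[%classic.
have mB : measurable B by apply: measurableX; exact: measurable_itv.
apply: (@lt_le_trans _ _ (borel_area R B)); last first.
  apply: le_measure; rewrite ?inE//; first exact: measurable_std_triangle.
  by move=> [s t] [] /=; rewrite !in_itv/= => /andP[? ?] /andP[? ?]; split => /=; lra.
rewrite (_ : borel_area R B = lebesgue_measure `](1/4 : R)%R, (1/2)%R[%classic *
   lebesgue_measure `](1/4 : R)%R, (1/2)%R[%classic)%E; last first.
  by apply: product_measure1E; exact: measurable_itv.
rewrite lebesgue_measure_itv/= lte_fin ifT; last by lra.
by rewrite -EFinB -EFinM lte_fin; lra.
Qed.

Lemma Re_phi m P : complex.Re (Phi m P) = twave L p m 0 P.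
Proof.
rewrite /phi Re_sum; apply: eq_bigr => g _; rewrite addr0.
by [].
Qed.

Lemma Im_phi m P : complex.Im (Phi m P) = twave L p m (- (pi / 2)) P.
Proof. by rewrite /phi Im_sum; apply: eq_bigr => g _; rewrite cosBpihalf. Qed.

Lemma Csmooth_phi m : Csmooth (Phi m).
Proof.
split => n.
  by rewrite (_ : (fun P => _) = twave L p m 0);
    [exact: Cn_twave|apply/funext => P; exact: Re_phi].
by rewrite (_ : (fun P => _) = twave L p m (- (pi / 2)));
  [exact: Cn_twave|apply/funext => P; exact: Im_phi].
Qed.

Lemma Cpartial_phi i m P : Cpartial i (Phi m) P =
  Complex (dtwave L p i m 0 P) (dtwave L p i m (- (pi / 2)) P).
Proof.
rewrite /Cpartial -!partial_twave; congr (Complex (partial i _ P) (partial i _ P));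
  apply/funext => Q; [exact: Re_phi|exact: Im_phi].
Qed.

Lemma continuous_L2 (f : plane R -> C) :
  continuous ((fun P => complex.Re (f P)) : R * R -> R) ->
  continuous ((fun P => complex.Im (f P)) : R * R -> R) -> L2 (area R) T f.
Proof.
move=> cr ci; have mT := measurable_triangle (tri_det_neq0 p_eq).
apply: L2P; [exact: (continuous_lplane_measurable cr mT)|
  exact: (continuous_lplane_measurable ci mT)|].
apply: (triangle_integrable p_eq (F := fun P => nsq (f P))) => P.
by apply: cvgD; apply: cvgM; (exact: cr || exact: ci).
Qed.

Lemma Csmooth_L2 (f : plane R -> C) : Csmooth f -> L2 (area R) T f.
Proof. by move=> [h1 h2]; apply: continuous_L2; [case: (h1 0)|case: (h2 0)]. Qed.

Lemma Csmooth_partial_L2 i (f : plane R -> C) : Csmooth f ->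
  L2 (area R) T (Cpartial i f).
Proof.
move=> [h1 h2]; apply: continuous_L2.
  by case: (h1 1) => _ /(_ i)[_ []].
by case: (h2 1) => _ /(_ i)[_ []].
Qed.

Lemma phi_L2 m : L2 (area R) T (Phi m).
Proof. exact: Csmooth_L2 (Csmooth_phi m). Qed.

Lemma sum2E (V : nmodType) (F : 'I_2 -> V) : \sum_(i < 2) F i = F ord0 + F ord_max.
Proof.
by rewrite big_ord_recl big_ord1; congr (_ + F _); apply: val_inj.
Qed.

Let I (f : plane R -> R) m d (P : plane R) :=
  partial ord0 f P * dtwave L p ord0 m d P +
  partial ord_max f P * dtwave L p ord_max m d P
  - kap * (freq_norm m)%:~R * (f P * twave L p m d P).

Let I_integrable f m d : Cn 1 f -> (area R).-integrable T (EFin \o I f m d).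
Proof.
move=> [cf h]; have [_ [c0f _]] := h ord0; have [_ [c1f _]] := h ord_max.
apply: (triangle_integrable p_eq) => P.
apply: cvgB; first apply: cvgD; apply: cvgM.
- exact: c0f.
- exact: continuous_dtwave.
- exact: c1f.
- exact: continuous_dtwave.
- exact: cvg_cst.
- by apply: cvgM; [exact: cf|exact: continuous_twave].
Qed.

Lemma green_complex (f : plane R -> C) m : Csmooth f ->
  \sum_(i < 2) ipT (Cpartial i f) (Cpartial i (Phi m)) =
  (kap * (freq_norm m)%:~R)%:C * ipT f (Phi m).
Proof.
move=> sf; have [s1 s2] := sf.
have mT := measurable_triangle (tri_det_neq0 p_eq).
apply/eqP; rewrite -subr_eq0 sum2E -mulNr.
have iM f g := @L2M_integrable _ _ _ (area R) T mT f g.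
have iP i := iM _ _ (Csmooth_partial_L2 i sf) (Csmooth_partial_L2 i (Csmooth_phi m)).
have i0 := iM _ _ (Csmooth_L2 sf) (phi_L2 m).
have iZ : Cintegrable (area R) T (fun P => - (kap * (freq_norm m)%:~R)%:C * (f P * (Phi m P)^*)).
  have := iM _ _ (L2Z mT (- (kap * (freq_norm m)%:~R)%:C) (Csmooth_L2 sf)) (phi_L2 m).
  by apply: eq_Cintegrable => P; rewrite mulrA.
have iD := CintegrableD mT (iP ord0) (iP ord_max).
rewrite /ip -CintegralZ// -CintegralD// -CintegralD//.
pose f1 P := complex.Re (f P); pose f2 P := complex.Im (f P).
pose h := - (pi / 2) : R.
have ER P : complex.Re (Cpartial ord0 f P * (Cpartial ord0 (Phi m) P)^* +
   Cpartial ord_max f P * (Cpartial ord_max (Phi m) P)^* +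
   - (kap * (freq_norm m)%:~R)%:C * (f P * (Phi m P)^*)) = I f1 m 0 P + I f2 m h P.
  rewrite !Cpartial_phi /I -Re_phi -Im_phi /Cpartial -/f1 -/f2 /f1 /f2.
  by case: (f P) (Phi m P) => [a b] [c d] /=; ring.
have EI P : complex.Im (Cpartial ord0 f P * (Cpartial ord0 (Phi m) P)^* +
   Cpartial ord_max f P * (Cpartial ord_max (Phi m) P)^* +
   - (kap * (freq_norm m)%:~R)%:C * (f P * (Phi m P)^*)) = I f2 m 0 P - I f1 m h P.
  rewrite !Cpartial_phi /I -Re_phi -Im_phi /Cpartial -/f1 -/f2 /f1 /f2.
  by case: (f P) (Phi m P) => [a b] [c d] /=; ring.
rewrite /Cintegral eq_complex /=; apply/andP; split; apply/eqP.
  under eq_Rintegral do rewrite ER.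
  rewrite RintegralD//; [|exact: I_integrable (s1 1)|exact: I_integrable (s2 1)].
  by rewrite !(green_real p_eq) ?addr0//.
under eq_Rintegral do rewrite EI.
rewrite RintegralB//; [|exact: I_integrable (s2 1)|exact: I_integrable (s1 1)].
by rewrite !(green_real p_eq) ?subr0//.
Qed.

Lemma Csmooth_cst (c : C) : Csmooth (fun=> c : C).
Proof.
have h n (r : R) : Cn n (fun=> r : R).
  elim: n r => [|n IH] r; split => //; try exact: cst_continuous.
  move=> i; split; first by move=> P; exact: derivable_cst.
  rewrite (_ : partial i _ = fun=> 0); first exact: IH.
  by apply/funext => P; rewrite /partial derive_cst.
by split => n; exact: h.
Qed.

(** Green's formula for the constant function 1 has zero left-hand side, and the eigenvalue of a
    nonzero frequency does not vanish. *)
Lemma Cintegral_phi m : Cintegral (area R) T (Phi m) =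
  if m == (0, 0) then (6 * tri_area)%:C else 0.
Proof.
have mT := measurable_triangle (tri_det_neq0 p_eq).
have [->|m0] := eqVneq m (0, 0).
  rewrite /Cintegral; apply/eqP; rewrite eq_complex /=; apply/andP; split; apply/eqP.
    by under eq_Rintegral do rewrite phi0 /=; rewrite Rintegral_cst.
  by under eq_Rintegral do rewrite phi0 /=; rewrite Rintegral_cst ?mul0r.
have h := green_complex m (Csmooth_cst 1).
have c1 i : ipT (Cpartial i (fun=> 1 : C)) (Cpartial i (Phi m)) = 0.
  rewrite /ip -[RHS](_ : Cintegral (area R) T (fun=> 0) = 0).
    apply: eq_Cintegral => P _.
    by rewrite /Cpartial /partial /= !derive_cst mul0r.
  by rewrite /Cintegral /= !Rintegral_cst ?mul0r.
rewrite sum2E !c1 addr0 in h.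
have k0 : (kap * (freq_norm m)%:~R)%:C != 0 :> C.
  have kp := kappa_gt0 p_eq.
  rewrite eq_complex /= eqxx andbT; apply: mulf_neq0; first by rewrite gt_eqF.
  by rewrite intr_eq0; apply: contra_neq m0; exact: freq_norm_eq0.
have /eqP : ipT (fun=> 1 : C) (Phi m) = 0.
  by apply/eqP; move/esym/eqP: h; rewrite mulf_eq0 (negbTE k0).
rewrite /ip.
have -> : Cintegral (area R) T (fun P => 1 * (Phi m P)^*) = (Cintegral (area R) T (Phi m))^*.
  have i1 : Cintegrable (area R) T (Phi m).
    have := L2M_integrable mT (phi_L2 m) (Csmooth_L2 (Csmooth_cst 1)).
    by apply: eq_Cintegrable => P; rewrite conjC1 mulr1.
  by rewrite -Cintegral_conj//; apply: eq_Cintegral => P _; rewrite mul1r.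
by rewrite fmorph_eq0 => /eqP.
Qed.

Lemma ip_phi m n : ipT (Phi m) (Phi n) =
  \sum_(h < 6) if m == wact h n then (6 * tri_area)%:C else 0.
Proof.
have mT := measurable_triangle (tri_det_neq0 p_eq).
have i1 x : Cintegrable (area R) T (Phi x).
  have := L2M_integrable mT (phi_L2 x) (Csmooth_L2 (Csmooth_cst 1)).
  by apply: eq_Cintegrable => P; rewrite conjC1 mulr1.
transitivity (Cintegral (area R) T
    (fun P => \sum_(h < 6) Phi (m.1 - (wact h n).1, m.2 - (wact h n).2) P)).
  by apply: eq_Cintegral => P _; exact: phi_mul_conj.
rewrite Cintegral_sum//; apply: eq_bigr => h _; rewrite Cintegral_phi.
case: m (wact h n) => [a b] [c d] /=; rewrite !xpair_eqE /=.
by rewrite !subr_eq0.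
Qed.

Section frame.
Variables (F : seq (int * int)) (c : int * int -> C).
Hypothesis F_uniq : uniq F.
Hypothesis F_wact : forall g m, (wact g m \in F) = (m \in F).
Hypothesis c_wact : forall g m, c (wact g m) = c m.

(** One factor 6 in 36 comes from the integral of the constant [phi (0, 0)], the other from the six
    group elements [h] sending [y] to a frequency with the same coefficient. Frequencies with
    nontrivial stabiliser need no separate treatment, because [F] lists frequencies rather than
    orbits. *)
Lemma ip_phi_comb y : y \in F ->
  \sum_(x <- F) c x * ipT (Phi x) (Phi y) = (36 * tri_area)%:C * c y.
Proof.
move=> yF; under eq_bigr do rewrite ip_phi mulr_sumr.
rewrite exchange_big /=.
transitivity (\sum_(h < 6) (6 * tri_area)%:C * c y); last first.
  rewrite sumr_const card_ord -mulrnAl; congr (_ * _).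
  by rewrite -(rmorphMn (real_complex R)) /= -mulr_natl; congr (_%:C); ring.
apply: eq_bigr => h _; rewrite (bigD1_seq (wact h y)) ?F_wact//= eqxx c_wact.
rewrite big1 ?addr0; first by rewrite mulrC.
by move=> x xy; rewrite (negbTE xy) mulr0.
Qed.

End frame.

End phi_system.

(** * Completeness of the Neumann eigenfunctions *)

Section trig_poly.
Context {R : realType}.
Variables (L : R) (p : 'I_3 -> plane R).
Notation C := R[i].
Notation Phi := (phi L p).

Definition trigpoly (f : plane R -> C) : Prop :=
  exists l : seq (C * (int * int)), forall P, f P = \sum_(q <- l) q.1 * Phi q.2 P.

Lemma trigpoly_phi c x : trigpoly (fun P => c * Phi x P).
Proof. by exists [:: (c, x)] => P; rewrite big_seq1. Qed.

Lemma eq_trigpoly (f g : plane R -> C) : f =1 g -> trigpoly f -> trigpoly g.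
Proof. by move=> fg [l fl]; exists l => P; rewrite -fg. Qed.

Lemma trigpolyD f g : trigpoly f -> trigpoly g -> trigpoly (fun P => f P + g P).
Proof.
by move=> [l fl] [l' gl]; exists (l ++ l') => P; rewrite big_cat fl gl.
Qed.

Lemma trigpoly0 : trigpoly (fun=> 0).
Proof. by exists [::] => P; rewrite big_nil. Qed.

Lemma trigpoly_sum I (r : seq I) (F : I -> plane R -> C) :
  (forall i, trigpoly (F i)) -> trigpoly (fun P => \sum_(i <- r) F i P).
Proof.
move=> tF; elim: r => [|i r IH].
  by apply: eq_trigpoly trigpoly0 => P; rewrite big_nil.
by apply: eq_trigpoly (trigpolyD (tF i) IH) => P; rewrite big_cons.
Qed.

Lemma trigpolyZ c f : trigpoly f -> trigpoly (fun P => c * f P).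
Proof.
move=> [l fl]; have := @trigpoly_sum _ l (fun q P => (c * q.1) * Phi q.2 P).
move/(_ (fun q => trigpoly_phi _ _)); apply: eq_trigpoly => P.
by rewrite fl mulr_sumr; apply: eq_bigr => q _; rewrite mulrA.
Qed.

Lemma conj_phi x P : (Phi x P)^* = Phi (- x.1, - x.2) P.
Proof.
rewrite /phi conjc_sum; apply: eq_bigr => g _.
rewrite /chi -cisN; congr cis; case: x => j k.
rewrite /phase /waven /wact; case: g => [[|[|[|[|[|[|//]]]]]] ?] /=;
  rewrite ?rmorphN ?rmorphD ?rmorphB ?rmorphN /=; ring.
Qed.

Lemma trigpolyM f g : trigpoly f -> trigpoly g -> trigpoly (fun P => f P * g P).
Proof.
move=> [l fl] [l' gl].
have := @trigpoly_sum _ l (fun q P => \sum_(q' <- l') (q.1 * q'.1) *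
  \sum_(h < 6) 1 * Phi (q.2.1 - (wact h (- q'.2.1, - q'.2.2)).1, q.2.2 - (wact h (- q'.2.1, - q'.2.2)).2) P).
have h q : trigpoly (fun P => \sum_(q' <- l') (q.1 * q'.1) *
  \sum_(h < 6) 1 * Phi (q.2.1 - (wact h (- q'.2.1, - q'.2.2)).1, q.2.2 - (wact h (- q'.2.1, - q'.2.2)).2) P).
  by apply: trigpoly_sum => q'; apply: trigpolyZ; apply: trigpoly_sum => i; exact: trigpoly_phi.
move/(_ h); apply: eq_trigpoly => P; rewrite fl gl mulr_suml.
apply: eq_bigr => q _; rewrite mulr_sumr; apply: eq_bigr => q' _.
under eq_bigr do rewrite mul1r.
rewrite -phi_mul_conj conj_phi /= !opprK -surjective_pairing.
by rewrite mulrACA.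
Qed.

Lemma trigpoly_cst c : trigpoly (fun=> c).
Proof.
have := trigpoly_phi (c / 6%:C) (0, 0); apply: eq_trigpoly => P.
rewrite phi0 mulfVK// (rmorph_nat (real_complex R) 6).
by rewrite pnatr_eq0.
Qed.

Lemma trigpolyX f n : trigpoly f -> trigpoly (fun P => f P ^+ n).
Proof.
move=> tf; elim: n => [|n IH]; first exact: trigpoly_cst.
by apply: eq_trigpoly (trigpolyM tf IH) => P; rewrite exprS.
Qed.

Lemma trigpolyB f g : trigpoly f -> trigpoly g -> trigpoly (fun P => f P - g P).
Proof.
move=> tf tg; apply: eq_trigpoly (trigpolyD tf (trigpolyZ (-1) tg)) => P.
by rewrite mulN1r.
Qed.

Definition rtrigpoly (f : plane R -> R) := trigpoly (fun P => (f P)%:C).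

Lemma rtrigpoly_Re x : rtrigpoly (fun P => complex.Re (Phi x P)).
Proof.
have := trigpolyZ (2^-1)%:C (trigpolyD (trigpoly_phi 1 x) (trigpoly_phi 1 (- x.1, - x.2))).
apply: eq_trigpoly => P; rewrite -conj_phi !mul1r.
by case: (Phi x P) => a b; apply/eqP; rewrite eq_complex /=; apply/andP; split; apply/eqP; field.
Qed.

Lemma rtrigpoly_Im x : rtrigpoly (fun P => complex.Im (Phi x P)).
Proof.
have := trigpolyZ (Complex 0 (- 2^-1)) (trigpolyB (trigpoly_phi 1 x) (trigpoly_phi 1 (- x.1, - x.2))).
apply: eq_trigpoly => P; rewrite -conj_phi !mul1r.
by case: (Phi x P) => a b; apply/eqP; rewrite eq_complex /=; apply/andP; split; apply/eqP; field.
Qed.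

Lemma rtrigpoly_affine f (a b : R) : rtrigpoly f -> rtrigpoly (fun P => a * f P + b).
Proof.
move=> tf; apply: eq_trigpoly (trigpolyD (trigpolyZ a%:C tf) (trigpoly_cst b%:C)) => P.
by rewrite rmorphD rmorphM.
Qed.

Lemma rtrigpolyM f g : rtrigpoly f -> rtrigpoly g -> rtrigpoly (fun P => f P * g P).
Proof. by move=> tf tg; apply: eq_trigpoly (trigpolyM tf tg) => P; rewrite rmorphM. Qed.

Lemma rtrigpolyX f n : rtrigpoly f -> rtrigpoly (fun P => f P ^+ n).
Proof. by move=> tf; apply: eq_trigpoly (trigpolyX n tf) => P; rewrite rmorphXn. Qed.

Lemma phi_bounded x P : `|complex.Re (Phi x P)| <= 6 /\ `|complex.Im (Phi x P)| <= 6.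
Proof.
have h (F : 'I_6 -> R) : (forall g, `|F g| <= 1) -> `|\sum_(g < 6) F g| <= 6.
  move=> F1; apply: le_trans (ler_norm_sum _ _ _) _.
  by apply: le_trans (ler_sum _ (fun g _ => F1 g)) _; rewrite sumr_const card_ord.
split; rewrite /phi ?Re_sum ?Im_sum; apply: h => g.
  by rewrite /= ler_norml cos_geN1 cos_le1.
by rewrite /= ler_norml sin_geN1 sin_le1.
Qed.

End trig_poly.

Section polynomial_step.
Context {R : realType}.

(* Bounded polynomial approximations of the step at 1/2; they make the
   Stone-Weierstrass theorem unnecessary. *)
Definition polystep (n : nat) (x : R) : R := (1 - x ^+ n) ^+ (n * 2 ^ n).

Lemma bernoulli (x : R) n : 0 <= x <= 1 -> 1 - n%:R * x <= (1 - x) ^+ n.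
Proof.
move=> /andP[x0 x1]; elim: n => [|n IH]; first by rewrite mul0r subr0 expr0.
rewrite exprS; have := ler_wpM2l (_ : 0 <= 1 - x) IH; rewrite subr_ge0 => /(_ x1).
apply: le_trans; rewrite -natr1 -subr_ge0.
have -> : (1 - x) * (1 - n%:R * x) - (1 - (n%:R + 1) * x) = n%:R * x ^+ 2 by ring.
by rewrite mulr_ge0 ?sqr_ge0.
Qed.

Lemma bernoulli_inv (x : R) n : 0 <= x <= 1 -> (1 - x) ^+ n * (1 + n%:R * x) <= 1.
Proof.
move=> /andP[x0 x1]; elim: n => [|n IH]; first by rewrite mul0r addr0 expr0 mul1r.
apply: le_trans IH; rewrite exprSr -mulrA ler_wpM2l ?exprn_ge0 ?subr_ge0//.
rewrite -natr1 -subr_ge0.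
have -> : 1 + n%:R * x - (1 - x) * (1 + (n%:R + 1) * x) = (n%:R + 1) * x ^+ 2 by ring.
by rewrite mulr_ge0 ?sqr_ge0// addr_ge0.
Qed.

Lemma polystep_01 n (x : R) : 0 <= x <= 1 -> 0 <= polystep n x <= 1.
Proof.
move=> /andP[x0 x1]; have xn0 := exprn_ge0 n x0; have xn1 := exprn_ile1 n x0 x1.
by rewrite exprn_ge0 ?exprn_ile1//; rewrite ?subr_ge0 ?lerBlDr ?lerDl.
Qed.

(** With [r] the square root of [q], Bernoulli's inequality bounds [n * r ^ n] by [(1 - r)^-1], and
    a second factor [r ^ n] remains. *)
Lemma cvg_natM_geometric (q : R) : 0 <= q < 1 -> (n%:R * q ^+ n) @[n --> \oo] --> 0.
Proof.
move=> /andP[q0 q1]; pose r := Num.sqrt q.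
have rE : r ^+ 2 = q by rewrite sqr_sqrtr.
have r0 : 0 <= r by exact: sqrtr_ge0.
have r1 : r < 1 by rewrite -(@ltr_pXn2r _ 2)// ?nnegrE// rE expr1n.
have d0 : 0 < 1 - r by rewrite subr_gt0.
apply: (@squeeze_cvgr _ _ _ _ (fun=> 0) (geometric (1 - r)^-1 r)).
- apply: nearW => n; rewrite mulr_ge0 ?exprn_ge0//= -rE -exprM mulnC exprM expr2 mulrA.
  rewrite ler_wpM2r ?exprn_ge0// -[leRHS]mul1r ler_pdivlMr//.
  have := @bernoulli_inv (1 - r) n; rewrite subKr => /(_ _)/(le_trans _); apply.
    rewrite -subr_ge0 (_ : _ - _ = r ^+ n) ?exprn_ge0//; ring.
  by apply/andP; split; lra.
- exact: cvg_cst.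
- by apply: cvg_geometric; rewrite ger0_norm.
Qed.

(** The product of the exponent [n * 2 ^ n] and [x ^ n] is [n * (2 * x) ^ n], which tends to 0 below
    1/2 and is at least [n] from 1/2 on; the two Bernoulli inequalities convert this into the limits
    1 and 0. At [x = 1 / 2] the limit is 0. *)
Lemma cvg_polystep (x : R) : 0 <= x <= 1 ->
  polystep n x @[n --> \oo] --> ((nat_of_bool (x < 1 / 2))%:R : R).
Proof.
move=> x01; have /andP[x0 x1] := x01.
have xn01 n : 0 <= x ^+ n <= 1 by rewrite exprn_ge0// exprn_ile1.
have mE n : (n * 2 ^ n)%:R * x ^+ n = n%:R * (2 * x) ^+ n.
  by rewrite natrM natrX -mulrA -exprMn.
have [xl|xr] := ltP x (1 / 2).
  apply: (@squeeze_cvgr _ _ _ _ (fun n => 1 - n%:R * (2 * x) ^+ n) (fun=> 1)).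
  - apply: nearW => n; rewrite -mE /polystep bernoulli//=.
    by have /andP[] := polystep_01 n x01.
  - rewrite -[X in _ --> X]subr0; apply: cvgB; first exact: cvg_cst.
    by apply: cvg_natM_geometric; apply/andP; split; lra.
  - exact: cvg_cst.
apply: (@squeeze_cvgr _ _ _ _ (fun=> 0) (fun n => n.+1%:R^-1)).
- apply: nearW => n; have /andP[h0 h1] := polystep_01 n x01.
  rewrite h0 /=; have := bernoulli_inv (n * 2 ^ n) (xn01 n).
  rewrite mE -/(polystep n x) -ler_pdivlMr ?mul1r => [h|].
    apply: (le_trans h); rewrite lef_pV2 ?posrE//.
      rewrite -natr1 addrC lerD2l ler_peMr// exprn_ege1//; lra.
    by rewrite ltr_pwDl// mulr_ge0// exprn_ge0//; lra.
  by rewrite ltr_pwDl// mulr_ge0// exprn_ge0//; lra.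
- exact: cvg_cst.
- exact: cvg_harmonic.
Qed.

End polynomial_step.

Section dominated_to_zero.
Context d (X : measurableType d) (R : realType).
Variables (mu : {measure set X -> \bar R}) (D : set X).
Hypothesis mD : measurable D.

Lemma dominated_small (h : nat -> X -> R) (H : X -> R) :
  (forall n, measurable_fun D (h n)) -> mu.-integrable D (EFin \o H) ->
  (forall n x, D x -> 0 <= h n x <= H x) ->
  (forall x, D x -> h n x @[n --> \oo] --> 0) ->
  forall e : R, 0 < e -> exists n, fine (\int[mu]_(x in D) (h n x)%:E) <= e.
Proof.
move=> mh iH hH h0 e e0.
have [||||_ _ cv] := @dominated_convergence _ _ _ mu D mD
  (fun n x => (h n x)%:E) (cst 0%E) (EFin \o H) _ _ _ iH.
- by move=> n; apply/measurable_EFinP; exact: mh.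
- exact: measurable_cst.
- by apply: aeW => x Dx; apply: cvg_EFin; [exact: nearW|exact: h0].
- apply: aeW => x n Dx; have /andP[h1 h2] := hH n x Dx.
  by rewrite /= ger0_norm.
rewrite integral0 in cv.
have cv0 : fine (\int[mu]_(x in D) (h n x)%:E) @[n --> \oo] --> (0 : R) by exact: (fine_cvg cv).
have /cvgrPdist_le hc := cv0; have [n _ hn] := hc e e0.
by exists n; have := hn n (leqnn n); rewrite /= sub0r normrN; apply: le_trans; exact: ler_norm.
Qed.

End dominated_to_zero.

Section density.
Context {R : realType}.
Variables (L : R) (p : 'I_3 -> plane R).
Hypothesis p_eq : equilateral L p.
Notation C := R[i].
Notation T := (open_triangle p : set (lplane R)).
Notation Phi := (phi L p).
Notation N := (@normL2 _ _ R (area R) T).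

Let D0 := tri_det_neq0 p_eq.
Let mT := measurable_triangle D0.
Let HT := @L2_hermitian _ _ R (area R) T mT.

Lemma normL2D_le (f g : plane R -> C) : L2 (area R) T f -> L2 (area R) T g ->
  N (fun P => f P + g P) <= 2 * N f + 2 * N g.
Proof.
move=> Lf Lg; have := herm_sqrD_le HT Lf Lg.
by rewrite !ip_self.
Qed.

Lemma eq_normL2 (f g : plane R -> C) : (forall P, T P -> f P = g P) -> N f = N g.
Proof.
move=> fg; rewrite /normL2 /sqnorm; congr fine; apply: eq_integral => P /set_mem TP.
by rewrite fg.
Qed.

Lemma trigpoly_smooth f : trigpoly L p f -> continuous ((fun P => complex.Re (f P)) : R * R -> R)
  /\ continuous ((fun P => complex.Im (f P)) : R * R -> R).
Proof.
move=> [l fl].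
have cRe x : continuous ((fun P => complex.Re (Phi x P)) : R * R -> R).
  by case: (Csmooth_phi L p x) => h _; case: (h 0%N).
have cIm x : continuous ((fun P => complex.Im (Phi x P)) : R * R -> R).
  by case: (Csmooth_phi L p x) => _ h; case: (h 0%N).
split.
  have -> : (fun P => complex.Re (f P)) = (fun P => \sum_(q <- l)
      (complex.Re q.1 * complex.Re (Phi q.2 P) - complex.Im q.1 * complex.Im (Phi q.2 P))).
    apply/funext => P; rewrite fl Re_sum; apply: eq_bigr => q _.
    by case: q.1 (Phi q.2 P) => [a b] [c d].
  elim: l {fl} => [|q l IH] P.
    by rewrite /continuous_at; under eq_fun do rewrite big_nil; rewrite big_nil; exact: cvg_cst.
  rewrite /continuous_at; under eq_fun do rewrite big_cons; rewrite big_cons.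
  apply: cvgD; last exact: IH.
  by apply: cvgB; apply: cvgM; (exact: cvg_cst || exact: cRe || exact: cIm).
have -> : (fun P => complex.Im (f P)) = (fun P => \sum_(q <- l)
    (complex.Re q.1 * complex.Im (Phi q.2 P) + complex.Im q.1 * complex.Re (Phi q.2 P))).
  apply/funext => P; rewrite fl Im_sum; apply: eq_bigr => q _.
  by case: q.1 (Phi q.2 P) => [a b] [c d].
elim: l {fl} => [|q l IH] P.
  by rewrite /continuous_at; under eq_fun do rewrite big_nil; rewrite big_nil; exact: cvg_cst.
rewrite /continuous_at; under eq_fun do rewrite big_cons; rewrite big_cons.
apply: cvgD; last exact: IH.
by apply: cvgD; apply: cvgM; (exact: cvg_cst || exact: cRe || exact: cIm).
Qed.

Lemma trigpoly_L2 f : trigpoly L p f -> L2 (area R) T f.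
Proof. by move=> /trigpoly_smooth[cr ci]; exact: (continuous_L2 p_eq). Qed.

Lemma rtrigpoly_continuous f : rtrigpoly L p f -> continuous (f : R * R -> R).
Proof. by move=> /trigpoly_smooth[]. Qed.

Definition L2closure (f : plane R -> C) : Prop := L2 (area R) T f /\
  forall e : R, 0 < e -> exists2 a, trigpoly L p a & N (fun P => f P - a P) <= e.

Let L2B (f g : plane R -> C) : L2 (area R) T f -> L2 (area R) T g ->
  L2 (area R) T (fun P => f P - g P).
Proof. by move=> Lf Lg; exact: (herm_closedB HT Lf Lg). Qed.

Lemma L2closure_lim f : L2 (area R) T f ->
  (forall e : R, 0 < e -> exists2 g, L2closure g & N (fun P => f P - g P) <= e) ->
  L2closure f.
Proof.
move=> Lf hf; split => // e e0.
have e4 : 0 < e / 4 by rewrite divr_gt0.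
have [g [Lg hg] fg] := hf _ e4; have [a ta ga] := hg _ e4.
exists a => //; have La := trigpoly_L2 ta.
have -> : (fun P => f P - a P) = (fun P => (f P - g P) + (g P - a P)).
  by apply/funext => P; rewrite addrA subrK.
apply: le_trans (normL2D_le (L2B Lf Lg) (L2B Lg La)) _; lra.
Qed.

Lemma trigpoly_L2closure f : trigpoly L p f -> L2closure f.
Proof.
move=> tf; split; first exact: trigpoly_L2.
move=> e e0; exists f => //; rewrite (@eq_normL2 _ (fun=> 0)); last first.
  by move=> P _; rewrite subrr.
have := ip_self (area R) T (fun=> 0 : C).
rewrite (herm0l HT); last exact: L2_0.
by move=> [<-]; exact: ltW.
Qed.

Lemma normL2Z c (f : plane R -> C) : L2 (area R) T f -> N (fun P => c * f P) = nsq c * N f.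
Proof.
move=> Lf; have := ip_self (area R) T (fun P => c * f P).
have Lcf := L2Z mT c Lf.
rewrite (hermZl HT c Lf Lcf) (hermC HT Lcf Lf) (hermZl HT c Lf Lf).
rewrite ip_self conjcM mulrA Re_mulconj => /(congr1 (@complex.Re _)) /=.
by rewrite oppr0 mulr0 subr0 => <-.
Qed.

Lemma L2closureD f g : L2closure f -> L2closure g -> L2closure (fun P => f P + g P).
Proof.
move=> [Lf hf] [Lg hg]; split; first exact: L2D.
move=> e e0; have e4 : 0 < e / 4 by rewrite divr_gt0.
have [a ta fa] := hf _ e4; have [b tb gb] := hg _ e4.
exists (fun P => a P + b P); first exact: trigpolyD.
have -> : (fun P => f P + g P - (a P + b P)) = (fun P => (f P - a P) + (g P - b P)).
  by apply/funext => P; rewrite opprD addrACA.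
apply: le_trans (normL2D_le (L2B Lf (trigpoly_L2 ta)) (L2B Lg (trigpoly_L2 tb))) _; lra.
Qed.

Lemma L2closureZ c f : L2closure f -> L2closure (fun P => c * f P).
Proof.
move=> [Lf hf]; split; first exact: L2Z.
move=> e e0; have e1 : 0 < e / (nsq c + 1) by rewrite divr_gt0// ltr_wpDl// nsq_ge0.
have [a ta fa] := hf _ e1; exists (fun P => c * a P); first exact: trigpolyZ.
have -> : (fun P => c * f P - c * a P) = (fun P => c * (f P - a P)).
  by apply/funext => P; rewrite mulrBr.
rewrite normL2Z; last exact: L2B Lf (trigpoly_L2 ta).
have c0 := nsq_ge0 c.
apply: (@le_trans _ _ ((nsq c + 1) * N (fun P => f P - a P))).
  by rewrite ler_wpM2r ?normL2_ge0// lerDl.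
by rewrite mulrC -ler_pdivlMr// ltr_wpDl.
Qed.

Lemma eq_L2closure f g : (forall P, T P -> f P = g P) -> L2 (area R) T g ->
  L2closure f -> L2closure g.
Proof.
move=> fg Lg [_ hf]; split => // e e0; have [a ta fa] := hf e e0; exists a => //.
by rewrite -(@eq_normL2 (fun P => f P - a P))// => P TP; rewrite fg.
Qed.

(* Bounded pointwise limits of trigonometric polynomials multiply, so this class
   is a pi-system. *)
Definition trig_limit_set (S : set (lplane R)) : Prop :=
  [/\ S `<=` T, measurable S & exists a : nat -> plane R -> R,
    [/\ forall n, rtrigpoly L p (a n), forall n P, T P -> 0 <= a n P <= 1 &
      forall P, T P -> a n P @[n --> \oo] --> (\1_S P : R)]].

Definition approx_set (S : set (lplane R)) : Prop :=
  [/\ S `<=` T, measurable S & L2closure (fun P => (\1_S P : R)%:C)].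

Lemma indic_L2 (S : set (lplane R)) : measurable S -> L2 (area R) T (fun P => (\1_S P : R)%:C).
Proof.
move=> mS; apply: (@L2_dominated _ _ _ (area R) T mT _ (cst 1)) => /=.
- exact: measurable_indic.
- exact: measurable_cst.
- exact: (triangle_integrable p_eq (@cst_continuous _ _ (1 : R))).
- by move=> P _; rewrite nsq_real indicE; case: (P \in S); rewrite ?expr1n ?expr0n.
Qed.

Lemma L2closure_dominated (f : plane R -> R) (g : nat -> plane R -> R) (H : plane R -> R) :
  L2 (area R) T (fun P => (f P)%:C) -> (forall n, L2closure (fun P => (g n P)%:C)) ->
  (area R).-integrable T (EFin \o H) ->
  (forall n P, T P -> (f P - g n P) ^+ 2 <= H P) ->
  (forall P, T P -> g n P @[n --> \oo] --> f P) -> L2closure (fun P => (f P)%:C).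
Proof.
move=> Lf Lg iH hH gf; apply: L2closure_lim => // e e0.
have [mf _ _] := Lf.
have mg n : measurable_fun T (g n) by have [[]] := Lg n.
have [|||n hn] := @dominated_small _ _ _ (area R) T mT (fun n P => (f P - g n P) ^+ 2) H _ iH _ _ e e0.
- by move=> n; apply: measurable_funX; exact: measurable_funB.
- by move=> n P TP; rewrite sqr_ge0 hH.
- move=> P TP; rewrite -[X in _ --> X](_ : (f P - f P) ^+ 2 = 0); last by rewrite subrr expr0n.
  by apply: cvgM; (apply: cvgB; [exact: cvg_cst|exact: gf]).
exists (fun P => (g n P)%:C) => //; apply: le_trans hn.
rewrite /normL2 /sqnorm le_eqVlt; apply/orP; left; apply/eqP; congr fine.
apply: eq_integral => P _; congr EFin.
by rewrite -rmorphB -[LHS]/(nsq _) nsq_real.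
Qed.

Lemma trig_limit_approx (S : set (lplane R)) : trig_limit_set S -> approx_set S.
Proof.
move=> [ST mS [a [ta a01 aS]]]; split; [exact: ST|exact: mS|].
apply: (L2closure_dominated (indic_L2 mS) (g := a) (H := cst 4)); last exact: aS.
- by move=> n; apply: trigpoly_L2closure; exact: ta.
- exact: (triangle_integrable p_eq (@cst_continuous _ _ (4 : R))).
- move=> n P TP; have /andP[h0 h1] := a01 n P TP.
  by rewrite indicE; case: (P \in S) => /=; nra.
Qed.

Lemma trig_limit_setI : setI_closed trig_limit_set.
Proof.
move=> S S' [ST mS [a [ta a01 aS]]] [S'T mS' [b [tb b01 bS']]]; split.
- by move=> P [/ST].
- exact: measurableI.
- exists (fun n P => a n P * b n P); split.
  + by move=> n; exact: rtrigpolyM.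
  + move=> n P TP; have /andP[h0 h1] := a01 n P TP; have /andP[k0 k1] := b01 n P TP.
    by rewrite mulr_ge0//= mulr_ile1.
  + by move=> P TP; rewrite indicI; apply: cvgM; [exact: aS|exact: bS'].
Qed.

(** The closure is a linear space, which gives proper differences, and is stable under dominated
    limits, which gives increasing unions. *)
Lemma approx_lambda_system : lambda_system T approx_set.
Proof.
split.
- by move=> A [].
- split; [by []|exact: mT|]; apply: (eq_L2closure (f := fun=> 1)); first by move=> P TP; rewrite indicE mem_set.
    exact: indic_L2.
  by apply: trigpoly_L2closure; exact: trigpoly_cst.
- move=> A B BA [AT mA cA] [BT mB cB]; split.
  + by move=> P [/AT].
  + exact: measurableD.
  + apply: (eq_L2closure (f := fun P => (\1_A P : R)%:C + (-1) * (\1_B P : R)%:C)).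
    * move=> P TP; rewrite mulN1r -rmorphB; congr (_%:C); rewrite !indicE in_setD.
      by have [/set_mem/BA/mem_set ->|] := boolP (P \in B); case: (P \in A) => /=; lra.
    * by apply: indic_L2; exact: measurableD.
    * exact: (L2closureD cA (L2closureZ (-1) cB)).
- move=> F ndF aF; have mU : measurable (\bigcup_i F i).
    by apply: bigcup_measurable => i _; have [] := aF i.
  split; [by move=> P [i _]; have [h _ _] := aF i; exact: h|exact: mU|].
  apply: (L2closure_dominated (indic_L2 mU) (g := fun n P => \1_(F n) P) (H := cst 4)).
  + by move=> n; have [] := aF n.
  + exact: (triangle_integrable p_eq (@cst_continuous _ _ (4 : R))).
  + by move=> n P TP; rewrite !indicE; case: (_ \in _); case: (_ \in _) => /=; lra.
  + move=> P TP; have [[n _ Fn]|nF] := pselect ((\bigcup_i F i) P).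
      apply: cvg_near_cst; exists n => // k /= nk; rewrite !indicE !mem_set//.
        by exists n.
      by move: nk => /ndF/subsetPset; apply.
    rewrite (_ : (fun n => _) = fun=> 0); first by rewrite indicE memNset//; exact: cvg_cst.
    apply/funext => n; rewrite indicE memNset// => Fn; apply: nF; by exists n.
Qed.

End density.

(** * Injectivity of the first nontrivial character sum on the closed triangle *)

Section alcove.
Context {R : realType}.

Lemma cos_eq1 (d : R) : `|d| <= 3 * pi -> cos d = 1 -> [\/ d = 0, d = 2 * pi | d = - (2 * pi)].
Proof.
have pi0 := pi_gt0 R.
have key (x : R) : `|x| <= pi -> cos x = 1 -> x = 0.
  move=> xpi cx; apply/normr0_eq0; apply: (@cos_inj R).
  - by rewrite in_itv/= normr_ge0.
  - by rewrite in_itv/= lexx ltW.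
  - by rewrite cos0; case: (ger0P x) => _; rewrite ?cosN.
move=> d3 cd; have [d0|d0] := leP 0 d.
- rewrite ger0_norm// in d3; have [dpi|dpi] := leP d pi.
    by apply: Or31; apply: key => //; rewrite ger0_norm.
  apply: Or32; apply/eqP; rewrite -subr_eq0; apply/eqP; apply: key.
    by rewrite ler_norml; apply/andP; split; lra.
  by rewrite mulr_natl -(cosD2pi (d - _)) ?subrK.
- rewrite ltr0_norm// in d3; have [dpi|dpi] := leP (- d) pi.
    by apply: Or31; apply: key => //; rewrite ltr0_norm.
  apply: Or33; apply/eqP; rewrite -subr_eq0 opprK; apply/eqP; apply: key.
    by rewrite ler_norml; apply/andP; split; lra.
  by rewrite mulr_natl cosD2pi.
Qed.

(** Both triples are the roots of one cubic: [x1] is a root of the product of the factors [X - yi],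
    and the remaining pairs have equal sum and product. *)
Lemma roots3_perm (F : fieldType) (x1 x2 x3 y1 y2 y3 : F) :
  x1 + x2 + x3 = y1 + y2 + y3 ->
  x1 * x2 + x1 * x3 + x2 * x3 = y1 * y2 + y1 * y3 + y2 * y3 ->
  x1 * x2 * x3 = y1 * y2 * y3 ->
  [\/ x1 = y1 /\ (x2 = y2 /\ x3 = y3 \/ x2 = y3 /\ x3 = y2),
      x1 = y2 /\ (x2 = y1 /\ x3 = y3 \/ x2 = y3 /\ x3 = y1) |
      x1 = y3 /\ (x2 = y2 /\ x3 = y1 \/ x2 = y1 /\ x3 = y2)].
Proof.
move=> e1 e2 e3.
have two (a b c d : F) : a + b = c + d -> a * b = c * d -> a = c /\ b = d \/ a = d /\ b = c.
  move=> s q; have /eqP : (a - c) * (a - d) = 0.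
    transitivity (a ^+ 2 - (c + d) * a + c * d); first by ring.
    by rewrite -s -q; ring.
  rewrite mulf_eq0 !subr_eq0 => /orP[]/eqP ac; [left|right]; split=> //.
    by apply: (addrI a); rewrite s ac.
  by apply: (addrI a); rewrite s ac addrC.
have third (x y z a b c : F) : x + y + z = a + b + c ->
    x * y + x * z + y * z = a * b + a * c + b * c -> x = a ->
    y = b /\ z = c \/ y = c /\ z = b.
  move=> s q xa; rewrite xa in s q; apply: two.
    by apply: (addrI a); rewrite !addrA.
  have s' : y + z = b + c by apply: (addrI a); rewrite !addrA.
  by apply: (addrI (a * (y + z))); rewrite {2}s' !mulrDr.
have /eqP : (x1 - y1) * (x1 - y2) * (x1 - y3) = 0.
  transitivity (x1 ^+ 3 - (y1 + y2 + y3) * x1 ^+ 2 + (y1 * y2 + y1 * y3 + y2 * y3) * x1 - y1 * y2 * y3).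
    by ring.
  by rewrite -e1 -e2 -e3; ring.
rewrite !mulf_eq0 !subr_eq0 => /orP[/orP[]|] /eqP h.
- by apply: Or31; split => //; exact: (third x1 x2 x3 y1 y2 y3).
- by apply: Or32; split => //; apply: (third x1 x2 x3 y2 y1 y3) => //; rewrite ?e1 ?e2; ring.
- by apply: Or33; split => //; apply: (third x1 x2 x3 y3 y2 y1) => //; rewrite ?e1 ?e2; ring.
Qed.

(* The phases of the three characters of frequency norm one, as functions of the
   affine coordinates; up to permutations and integer shifts they determine the
   point, because the triangle is a fundamental domain of the affine Weyl group. *)
Definition ang1 (a : R * R) := 2 * pi * ((- (2 * a.1) - a.2) / 3).
Definition ang2 (a : R * R) := 2 * pi * ((a.1 - a.2) / 3).
Definition ang3 (a : R * R) := 2 * pi * ((a.1 + 2 * a.2) / 3).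

Definition cl_triangle : set (R * R) := [set a | [/\ 0 <= a.1, 0 <= a.2 & a.1 + a.2 <= 1]].

Lemma cis_eq_shift (x y : R) : `|x - y| <= 3 / 2 -> cis (2 * pi * x) = cis (2 * pi * y) ->
  [\/ x = y, x = y + 1 | x = y - 1].
Proof.
have pi0 := pi_gt0 R => xy cxy.
have c1 : cos (2 * pi * (x - y)) = 1.
  have : cis (2 * pi * (x - y)) = 1.
    rewrite mulrBr cisD cxy -cisD subrr; exact: cis0.
  by case.
have [|h|h|h] := cos_eq1 _ c1.
- rewrite normrM ger0_norm ?mulr_ge0//; last exact: ltW.
  by rewrite (_ : 3 * pi = 2 * pi * (3 / 2)); [rewrite ler_wpM2l// mulr_ge0// ltW|field].
- apply: Or31; apply/eqP; rewrite -subr_eq0; move/eqP: h.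
  by rewrite !mulf_eq0 pnatr_eq0 (gt_eqF pi0).
- apply: Or32; have : 2 * pi * (x - y - 1) = 0 by rewrite mulrBr h mulr1 subrr.
  move/eqP; rewrite !mulf_eq0 pnatr_eq0 (gt_eqF pi0)/= => /eqP; lra.
- apply: Or33; have : 2 * pi * (x - y + 1) = 0 by rewrite mulrDr h mulr1 addNr.
  move/eqP; rewrite !mulf_eq0 pnatr_eq0 (gt_eqF pi0)/= => /eqP; lra.
Qed.

(** For three numbers of modulus one and product one, the second symmetric function is the conjugate
    of the sum. The sum therefore determines the three numbers up to order, and it remains to
    compare angles modulo integers. *)
Lemma cis_alcove_inj a b : cl_triangle a -> cl_triangle b ->
  cis (ang1 a) + cis (ang2 a) + cis (ang3 a) = cis (ang1 b) + cis (ang2 b) + cis (ang3 b) ->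
  a = b.
Proof.
have prod1 c : cis (ang1 c) * cis (ang2 c) * cis (ang3 c) = 1.
  rewrite -!cisD -[RHS](@cis0 R); by congr cis; rewrite /ang1 /ang2 /ang3; field.
have e2 c : cis (ang1 c) * cis (ang2 c) + cis (ang1 c) * cis (ang3 c) + cis (ang2 c) * cis (ang3 c)
  = (cis (ang1 c) + cis (ang2 c) + cis (ang3 c))^*.
  rewrite !conjcD -!cisN -!cisD [in RHS]addrC [in RHS](addrC (cis (- ang1 c))) addrA.
  by congr (_ + _ + _); congr cis; rewrite /ang1 /ang2 /ang3; field.
case: a b => [s t] [s' t'] [/= s0 t0 st] [/= s'0 t'0 st'] e1.
have := @roots3_perm _ _ _ _ _ _ _ e1 _ _; rewrite !e2 !prod1 e1 => /(_ erefl erefl).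
rewrite /ang1 /ang2 /ang3 /=.
move=> perm; suff : s = s' /\ t = t' by case=> -> ->.
have shift (x y x' y' : R) : cis (2 * pi * x) = cis (2 * pi * x') ->
    cis (2 * pi * y) = cis (2 * pi * y') ->
    `|x - x'| <= 3 / 2 /\ `|y - y'| <= 3 / 2 ->
    [\/ x = x', x = x' + 1 | x = x' - 1] /\ [\/ y = y', y = y' + 1 | y = y' - 1].
  by move=> h1 h2 [k1 k2]; split; exact: cis_eq_shift.
move: perm; clear prod1 e2 e1.
(* Six permutations times nine integer shifts; in each case the linear equations and the
   inequalities of the triangle force equality or a contradiction. *)
by move=> [[h1 [[h2 h3]|[h2 h3]]]|[h1 [[h2 h3]|[h2 h3]]]|[h1 [[h2 h3]|[h2 h3]]]];
  (have [] := shift _ _ _ _ h1 h2;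
    first by split; rewrite ler_norml; apply/andP; split; lra);
  clear h1 h2 h3 shift; move=> [k1|k1|k1] [k2|k2|k2]; split; lra.
Qed.

End alcove.

(** * From trigonometric polynomials to Borel sets *)

Section borel_approximation.
Context {R : realType}.
Variables (L : R) (p : 'I_3 -> plane R).
Hypothesis p_eq : equilateral L p.
Notation M := (measurableTypeR R * measurableTypeR R)%type.
Notation T := (open_triangle p : set (lplane R)).
Notation Phi := (phi L p).

Let D0 := tri_det_neq0 p_eq.
Let mT := measurable_triangle D0.
Notation G := (trig_limit_set L p).

Lemma rtrigpoly_polystep f n : rtrigpoly L p f -> rtrigpoly L p (fun P => polystep n (f P)).
Proof.
move=> /(@rtrigpolyX _ _ _ _ n)/(@rtrigpoly_affine _ _ _ _ (-1) 1)/(@rtrigpolyX _ _ _ _ (n * 2 ^ n)).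
by apply: eq_trigpoly => P; rewrite mulN1r addrC.
Qed.

Lemma trig_limit_lt f (b a : R) : rtrigpoly L p f -> (forall P, `|f P| <= b) ->
  G (T `&` [set P | f P < a]).
Proof.
move=> tf fb; have mb : measurable (T `&` [set P | f P < a] : set (lplane R)).
  have := continuous_lplane_measurable (rtrigpoly_continuous tf) mT.
  move=> /(_ mT _ (measurable_itv `]-oo, a[)).
  by congr measurable; apply/seteqP; split => P /= []; rewrite in_itv.
have b0 : 0 <= b by apply: le_trans (fb (0, 0)).
pose c := b + `|a| + 1; have c0 : 0 < c by rewrite ltr_pwDr// addr_ge0.
(* An affine rescaling that takes values in [[0, 1]] and moves the threshold [a] to 1/2, where
   [polystep] jumps. *)
pose g P := (2 * c)^-1 * f P + (1 / 2 - (2 * c)^-1 * a).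
have gE P : g P = 1 / 2 + (f P - a) / (2 * c).
  by rewrite /g; field; rewrite gt_eqF.
have g01 P : 0 <= g P <= 1.
  have : `|(f P - a) / (2 * c)| <= 1 / 2.
    have c1 : 0 < (2 * c)^-1 by rewrite invr_gt0 mulr_gt0.
    rewrite normrM (gtr0_norm c1).
    rewrite ler_pdivrMr ?mulr_gt0// (_ : 1 / 2 * (2 * c) = c); last by field.
    by apply: le_trans (ler_normB _ _) _; rewrite /c; have := fb P; lra.
  by rewrite gE ler_norml => /andP[h1 h2]; apply/andP; split; lra.
split; [by move=> P []|exact: mb|exists (fun n P => polystep n (g P)); split].
- by move=> n; apply: rtrigpoly_polystep; exact: rtrigpoly_affine.
- by move=> n P _; exact: polystep_01.
- move=> P TP; have := cvg_polystep (g01 P); congr (_ --> _); rewrite indicE.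
  congr ((nat_of_bool _)%:R); rewrite gE gtrDl.
  rewrite pmulr_llt0 ?invr_gt0 ?mulr_gt0// subr_lt0.
  by apply/idP/idP => [h|/set_mem[]//]; apply/mem_set.
Qed.

Definition zmap (P : R * R) : R * R := (complex.Re (Phi (-1, 0) P), complex.Im (Phi (-1, 0) P)).

Lemma continuous_zmap : continuous zmap.
Proof.
have cr := rtrigpoly_continuous (rtrigpoly_Re L p (-1, 0)).
have ci := rtrigpoly_continuous (rtrigpoly_Im L p (-1, 0)).
exact: continuous_pair cr ci.
Qed.

Lemma trig_limit_box (a b c d : R) :
  G (T `&` zmap @^-1` (`]a, b[%classic `*` `]c, d[%classic)).
Proof.
have key f (u v : R) : rtrigpoly L p f -> (forall P, `|f P| <= 6) ->
    G (T `&` [set P | u < f P < v]).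
  move=> tf f6; have tNf := rtrigpoly_affine (-1) 0 tf.
  have Nf6 P : `|-1 * f P + 0| <= 6 by rewrite addr0 mulN1r normrN.
  have := trig_limit_setI (trig_limit_lt v tf f6) (trig_limit_lt (- u) tNf Nf6).
  congr (G _); apply/seteqP; split => P /=; rewrite addr0 mulN1r ltrN2.
    by move=> [[TP ->] [_ ->]].
  by move=> [TP /andP[-> ->]].
have := trig_limit_setI (key _ a b (rtrigpoly_Re L p (-1, 0)) (fun P => (phi_bounded L p _ P).1))
  (key _ c d (rtrigpoly_Im L p (-1, 0)) (fun P => (phi_bounded L p _ P).2)).
congr (G _); apply/seteqP; split => P /=; rewrite !in_itv/=.
  by move=> [[TP ->] [_ ->]].
by move=> [TP [-> ->]].
Qed.

Lemma phi_norm1 a : Phi (-1, 0) (tri_map p a) = 2 * (cis (ang1 a) + cis (ang2 a) + cis (ang3 a)).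
Proof.
rewrite /phi; under eq_bigr do rewrite /chi phase_map//.
rewrite !big_ord_recl big_ord0 /wact /=.
rewrite [RHS](_ : _ = cis (ang1 a) + (cis (ang2 a) + (cis (ang1 a) + (cis (ang2 a) + (cis (ang3 a) + (cis (ang3 a) + 0)))))); last by ring.
congr (cis _ + (cis _ + (cis _ + (cis _ + (cis _ + (cis _ + 0)))))).
all: by rewrite /ang1 /ang2 /ang3; field.
Qed.

Lemma zmap_inj a b : cl_triangle a -> cl_triangle b ->
  zmap (tri_map p a) = zmap (tri_map p b) -> a = b.
Proof.
move=> ta tb; rewrite /zmap !phi_norm1 => -[er ei]; apply: (cis_alcove_inj ta tb).
by apply/eqP; rewrite eq_complex /=; apply/andP; split; apply/eqP; lra.
Qed.

Lemma compact_cl_triangle : compact (cl_triangle : set (R * R)).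
Proof.
pose box : set (R * R) := `[0, 1]%classic `*` `[0, 1]%classic.
apply: (@subclosed_compact _ _ box).
- have -> : (cl_triangle : set (R * R)) =
      ([set a | 0 <= (0 + 1 * a.1 + 0 * a.2 : R)] `&` [set a | 0 <= (0 + 0 * a.1 + 1 * a.2 : R)]) `&`
      [set a : R * R | 0 <= (1 + (-1) * a.1 + (-1) * a.2 : R)].
    rewrite /cl_triangle; apply/seteqP; split => -[s t] /=.
      by move=> [? ? ?]; split; [split|]; lra.
    by move=> [[? ?] ?]; split => /=; lra.
  have cl (u a b : R) : closed [set x : R * R | 0 <= u + a * x.1 + b * x.2].
    have -> : [set x : R * R | 0 <= u + a * x.1 + b * x.2] =
       ~` [set x | 0 < (fun x : R * R => - u + (- a) * x.1 + (- b) * x.2) x].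
      apply/seteqP; split => x /=; first by move=> h; apply/negP; rewrite -leNgt; lra.
      by move=> /negP; rewrite -leNgt; lra.
    by apply: open_closedC; apply: open_gt0; exact: continuous_affine2.
  by apply: closedI; [apply: closedI|]; exact: cl.
- by apply: compact_setX; exact: segment_compact.
- by move=> [s t] [/= s0 t0 st]; split; rewrite /= in_itv/=; apply/andP; split; lra.
Qed.

(** The part of [E] in the closed triangle is compact, so its image under [zmap] is closed, and by
    injectivity the preimage of this image meets [T] exactly in [E]. Only preimages under [zmap]
    have to be generated, and for these boxes suffice. *)
Lemma generated_closed (E : set (R * R)) : closed E -> <<s T, G >> (T `&` E).
Proof.
move=> cE; have [S0 SC SU] := smallest_sigma_algebra T G.
have zo (O : set (R * R)) : open O -> <<s T, G >> (T `&` zmap @^-1` O).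
  apply: (sigma_algebra_open (S := fun O => <<s T, G >> (T `&` zmap @^-1` O))); last first.
    by move=> a b c d; apply: sub_sigma_algebra; exact: trig_limit_box.
  split.
  - by rewrite preimage_set0 setI0.
  - move=> A /SC; congr (<<s T, G >> _); apply/seteqP; split => P /=.
      by move=> [TP nA]; split=> //; split => // AP; apply: nA.
    by move=> [TP [_ nA]]; split=> // -[_ AP]; apply: nA.
  - by move=> A hA; rewrite preimage_bigcup setI_bigcupr; exact: SU.
pose K := tri_map p @` cl_triangle.
have cK : compact (K : set (R * R)).
  by apply: continuous_compact; [apply: continuous_subspaceT; exact: continuous_tri_map|exact: compact_cl_triangle].
pose F := zmap @` (E `&` K).
have cF : closed F.
  apply: compact_closed; first exact: norm_hausdorff.
  apply: continuous_compact; first by apply: continuous_subspaceT; exact: continuous_zmap.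
  by rewrite setIC; exact: compact_closedI.
have TK P : T P -> exists2 a, cl_triangle a & tri_map p a = P.
  move=> TP; exists (tri_coord p P); last by rewrite tri_coordK.
  by move: TP; rewrite (open_triangleE D0) => -[h1 h2 h3]; split; exact: ltW.
have := SC _ (zo _ (closed_openC cF)); congr (<<s T, G >> _); apply/seteqP; split => P /=.
  move=> [TP h]; split=> //; have FP : F (zmap P) by apply: contrapT => nF; apply: h.
  have [Q [EQ [b tb bQ]] QP] := FP; have [a ta aP] := TK P TP.
  by rewrite -aP (_ : a = b) ?bQ//; apply: (zmap_inj ta tb); rewrite aP bQ.
move=> [TP EP]; split=> // -[_ nF]; apply: nF; exists P => //; split=> //.
by have [a ta aP] := TK P TP; exists a.
Qed.

(** Dynkin's theorem: the limit sets form a pi-system inside the lambda-system of approximable sets,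
    and the sigma-algebra they generate contains the traces of all closed sets. *)
Lemma approx_borel (B : set M) : measurable B -> approx_set L p (T `&` B).
Proof.
move=> mB; have [S0 SC SU] := smallest_sigma_algebra T G.
pose S := [set B : set (R * R) | <<s T, G >> (T `&` B)].
have saS : sigma_algebra setT S.
  split; first by rewrite /S /= setI0.
  - move=> A /SC; rewrite /S /=; congr (<<s T, G >> _); apply/seteqP; split => P /=.
      by move=> [TP nA]; split=> //; split => // AP; apply: nA.
    by move=> [TP [_ nA]]; split=> // -[_ AP]; apply: nA.
  - by move=> A hA; rewrite /S /= setI_bigcupr; exact: SU.
have oS (O : set (R * R)) : open O -> S O.
  have [_ C_ _] := saS.
  move=> /open_closedC/generated_closed/(C_ _); by rewrite setTD setCK.
(* Measurability in [M] refers to the product sigma-algebra, which is reached from the open sets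
   through the two coordinate projections. *)
have mS (A : set (g_sigma_algebraType S)) : measurable A -> S A.
  by apply: smallest_sub => //; exact: saS.
have oMS (f : R * R -> R) : continuous f ->
    measurable_fun setT (f : g_sigma_algebraType S -> measurableTypeR R).
  move=> cf; apply: (measurability _ (RGenOpens.measurableE R)).
  move=> _ [_ [a [b ->] <-]]; rewrite setTI; apply: sub_sigma_algebra; apply: oS.
  by apply: open_comp => // x _; exact: cf.
have SB : S B.
  have cfst : continuous (fst : R * R -> R) by move=> x; exact: cvg_fst.
  have csnd : continuous (snd : R * R -> R) by move=> x; exact: cvg_snd.
  apply: mS; have := measurable_fun_pair (oMS _ cfst) (oMS _ csnd).
  by move=> /(_ measurableT _ mB); rewrite setTI; congr measurable; apply/seteqP; split => -[].
apply: (lambda_system_subset (@trig_limit_setI _ L p) (approx_lambda_system p_eq) _ _ SB).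
- by move=> A; exact: trig_limit_approx.
- apply: (smallest_sub (X := [set A | A `<=` T])); last by move=> A [].
  split; [exact: sub0set|by move=> A _ P []|by move=> A hA P [n _]; exact: hA].
Qed.

End borel_approximation.

(** * From Borel sets to square integrable functions *)

Section L2_density.
Import HBSimple HBNNSimple.
Context {R : realType}.
Variables (L : R) (p : 'I_3 -> plane R).
Hypothesis p_eq : equilateral L p.
Notation M := (measurableTypeR R * measurableTypeR R)%type.
Notation C := R[i].
Notation T := (open_triangle p : set (lplane R)).

Let D0 := tri_det_neq0 p_eq.
Let mT := measurable_triangle D0.

(** The completed measure is an outer measure, so a Lebesgue measurable [S] is contained in a
    countable union [B] of Borel sets of almost the same measure, and the squared distance of the
    two indicators is the measure of the excess. *)
Lemma L2closure_indic (S : set (lplane R)) : S `<=` T -> measurable S ->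
  L2closure L p (fun P => (\1_S P : R)%:C).
Proof.
move=> ST mS; apply: (L2closure_lim p_eq (indic_L2 p_eq mS)) => e e0.
have fS : (area R S < +oo)%E.
  by apply: le_lt_trans (area_triangle_fin p_eq); apply: le_measure => //; rewrite inE.
have finS : area R S \is a fin_num by rewrite ge0_fin_numE.
have [x [F [mF SF] <-] xlt] := lb_ereal_inf_adherent e0 (finS : mu_ext (borel_area R) S \is a fin_num).
pose B := \bigcup_n F n; have mB : measurable (B : set M) by apply: bigcup_measurable => n _.
have mBl : measurable (B : set (lplane R)) by exact: lplane_measurable.
exists (fun P => (\1_(T `&` B) P : R)%:C); first by have [] := approx_borel p_eq mB.
have mI : measurable (T `&` B : set (lplane R)) by exact: measurableI.
have mE : measurable ((T `&` B) `\` S) by exact: measurableD.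
have aE : (area R ((T `&` B) `\` S) <= e%:E)%E.
  have : (area R (T `&` B) <= area R S + e%:E)%E.
    apply: (@le_trans _ _ (area R (B : set (lplane R)))).
      by apply: le_measure; rewrite ?inE//; exact: subIsetr.
    rewrite area_borel//; apply: le_trans (ltW xlt).
    by apply: (@generalized_Boole_inequality _ _ _ (borel_area R)).
  have {1}-> : T `&` B = S `|` ((T `&` B) `\` S).
    by rewrite setDUK// => P SP; split; [exact: ST|exact: SF].
  rewrite measureU//; last by rewrite setDIK.
  by rewrite leeD2lE.
have NE : sqnorm (area R) T (fun P => (\1_S P)%:C - (\1_(T `&` B) P)%:C)
    = area R ((T `&` B) `\` S).
  rewrite /sqnorm -[RHS](_ : area R (((T `&` B) `\` S) `&` T) = _); last first.
    by rewrite setIidl// => P [[]].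
  rewrite -integral_indic//; apply: eq_integral => P _; congr EFin.
  rewrite /= !indicE; have [SP|nSP] := pselect (S P).
    have IP : (T `&` B) P by split; [exact: ST|exact: SF].
    by rewrite (mem_set SP) (mem_set IP) memNset /=; [ring|move=> []].
  rewrite (memNset nSP); have [IP|nIP] := pselect ((T `&` B) P).
    by rewrite (mem_set IP) mem_set//=; ring.
  by rewrite (memNset nIP) memNset /=; [ring|move=> []].
rewrite /normL2 NE -lee_fin fineK// ge0_fin_numE//; exact: le_lt_trans aE (ltry _).
Qed.

Lemma L2closure_sum (I : eqType) (s : seq I) (f : I -> plane R -> C) :
  (forall i, L2closure L p (f i)) -> L2closure L p (fun P => \sum_(i <- s) f i P).
Proof.
move=> hf; elim: s => [|i s IH].
  by under eq_fun do rewrite big_nil; apply: (trigpoly_L2closure p_eq); exact: trigpoly0.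
by under eq_fun do rewrite big_cons; exact: (L2closureD p_eq (hf i) IH).
Qed.

Lemma L2closure_nneg (f : lplane R -> R) : measurable_fun T f ->
  (forall P, T P -> 0 <= f P) -> L2 (area R) T (fun P => (f P)%:C) ->
  L2closure L p (fun P => (f P)%:C).
Proof.
move=> mf f0 Lf.
have mfE : measurable_fun T (EFin \o f) by exact/measurable_EFinP.
have f0E P : T P -> (0 <= (EFin \o f) P)%E by move=> TP; rewrite lee_fin f0.
have if2 : (area R).-integrable T (EFin \o (fun P => f P ^+ 2)).
  have -> : (fun P => f P ^+ 2) = (fun P => nsq ((f P)%:C)) by apply/funext => P; rewrite nsq_real.
  exact: L2_nsq_integrable.
pose g n := nnsfun_approx mT mfE n.
have gf n P : T P -> 0 <= g n P <= f P.
  move=> TP; apply/andP; split; first exact: fun_ge0.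
  by rewrite -lee_fin /g nnsfun_approxE; exact: (@le_approx _ _ _ _ _ n P f0E TP).
apply: (L2closure_dominated p_eq Lf (g := fun n P => g n P) (H := fun P => f P ^+ 2)).
- move=> n.
  have cg : L2closure L p (fun P => \sum_(y <- finmap.enum_fset (fset_set (range (g n))))
      y%:C * (\1_(T `&` g n @^-1` [set y]) P : R)%:C).
    apply: L2closure_sum => y; apply: (L2closureZ p_eq); apply: L2closure_indic.
      exact: subIsetl.
    by apply: measurableI => //; exact: measurable_sfunP.
  have Eg P : T P -> (g n P)%:C = \sum_(y <- finmap.enum_fset (fset_set (range (g n))))
      y%:C * (\1_(T `&` g n @^-1` [set y]) P : R)%:C :> C.
    move=> TP; rewrite [in LHS]fimfunE fsbig_finite; last exact: fimfunP.
    rewrite (raddf_sum (real_complex R)); apply: eq_bigr => y _ /=.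
    rewrite rmorphM /=; congr (_ * (_%:C)); rewrite indicI /= [X in _ = X * _]indicE mem_set//.
    by rewrite mul1r.
  apply: (eq_L2closure _ _ cg) => [P TP|]; first by rewrite Eg.
  apply: (@L2_dominated _ _ _ (area R) T mT _ (fun P => f P ^+ 2)) => /=.
  + by apply: measurable_funTS; exact: measurable_funP.
  + exact: measurable_cst.
  + exact: if2.
  + by move=> P TP; rewrite nsq_real lerXn2r ?nnegrE ?f0//; have /andP[] := gf n P TP.
- exact: if2.
- move=> n P TP; have /andP[h0 h1] := gf n P TP; rewrite lerXn2r ?nnegrE ?subr_ge0 ?f0//.
  by rewrite gerBl.
- move=> P TP; apply: (@fine_cvg _ _ _ _ (EFin \o (fun n => g n P)) (f P)).
  exact: (cvg_nnsfun_approx mT mfE f0E TP).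
Qed.

(** Writes [f] as [(f + |f|) - |f|], a difference of nonnegative functions. *)
Lemma L2closure_real (f : lplane R -> R) : measurable_fun T f ->
  L2 (area R) T (fun P => (f P)%:C) -> L2closure L p (fun P => (f P)%:C).
Proof.
move=> mf Lf; have iH := L2_nsq_integrable Lf.
have mnf : measurable_fun T (fun P => `|f P|) by exact: measurableT_comp.
have Ln : L2 (area R) T (fun P => (`|f P|)%:C).
  apply: (L2_dominated mT _ _ iH) => //=.
  by move=> P _; rewrite !nsq_real real_normK ?num_real.
have Ls : L2 (area R) T (fun P => (f P + `|f P|)%:C).
  by have := L2D mT Lf Ln; under eq_fun do rewrite -rmorphD.
have c1 := L2closure_nneg mnf (fun P _ => normr_ge0 _) Ln.
have c2 : L2closure L p (fun P => (f P + `|f P|)%:C).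
  apply: L2closure_nneg; [exact: measurable_funD| |exact: Ls].
  by move=> P _; rewrite -lerBlDr sub0r; exact: lerNnormlW.
apply: (eq_L2closure _ Lf (L2closureD p_eq c2 (L2closureZ p_eq (-1) c1))) => P _.
by rewrite mulN1r -rmorphB addrK.
Qed.

Lemma trigpoly_dense (u : plane R -> C) : L2 (area R) T u -> L2closure L p u.
Proof.
move=> Lu; have [mr mi _] := Lu; have iH := L2_nsq_integrable Lu.
have Lr : L2 (area R) T (fun P => (complex.Re (u P))%:C).
  apply: (L2_dominated mT _ _ iH) => //=.
  by move=> P _; rewrite nsq_real lerDl sqr_ge0.
have Li : L2 (area R) T (fun P => (complex.Im (u P))%:C).
  apply: (L2_dominated mT _ _ iH) => //=.
  by move=> P _; rewrite nsq_real lerDr sqr_ge0.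
apply: (eq_L2closure _ Lu (L2closureD p_eq (L2closure_real mr Lr)
  (L2closureZ p_eq (Complex 0 1) (L2closure_real mi Li)))) => P _.
by case: (u P) => a b; apply/eqP; rewrite eq_complex /=; apply/andP; split; apply/eqP; ring.
Qed.

End L2_density.

(** * Finite Weyl-invariant sets of frequencies *)

Section frequencies.

Definition int_range (n : nat) : seq int := [seq (i%:Z - n%:Z) | i <- iota 0 n.*2.+1].

Lemma mem_int_range n (j : int) : (j \in int_range n) = (`|j| <= n%:Z).
Proof.
apply/mapP/idP => [[k]|jn]; first by rewrite mem_iota => /andP[_ h] ->; lia.
by exists (absz (j + n%:Z)); [rewrite mem_iota; lia|lia].
Qed.

Lemma int_range_uniq n : uniq (int_range n).
Proof. by rewrite map_inj_uniq ?iota_uniq// => i j; lia. Qed.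

(** Exhausting the lattice by balls of the norm form, and not by boxes, keeps every stage invariant
    under the Weyl group, as the orthogonality relation [ip_phi_comb] requires. The box only serves
    to enumerate. *)
Definition freqs (n : nat) : seq (int * int) :=
  [seq x <- [seq (j, k) | j <- int_range n.*2, k <- int_range n.*2] | freq_norm x <= n%:Z].

Lemma mem_freqs n x : (x \in freqs n) = (freq_norm x <= n%:Z).
Proof.
rewrite mem_filter; have [|//] := boolP (freq_norm x <= n%:Z); rewrite andTb.
case: x => j k; rewrite /freq_norm => h; rewrite {}/fst {}/snd in h.
(* Its hypothesis comes from [4 * freq_norm (j, k) = 3 * j ^ 2 + (j + 2 * k) ^ 2] and the symmetric
   identity. *)
have abs_le (i : int) : 3 * i ^+ 2 <= 4 * n%:Z -> `|i| <= n.*2%:Z.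
  have : `|i| <= i ^+ 2 by case: i => i; nia.
  lia.
apply/allpairsP; exists (j, k); rewrite !mem_int_range; split=> //; apply: abs_le.
  by have := sqr_ge0 (j + 2 * k); rewrite /fst => h2; nia.
by have := sqr_ge0 (k + 2 * j); rewrite /snd => h2; nia.
Qed.

Lemma freqs_uniq n : uniq (freqs n).
Proof.
apply: filter_uniq; apply: allpairs_uniq; [exact: int_range_uniq..|].
by move=> [a b] [c d].
Qed.

Lemma freqs_wact n g m : (wact g m \in freqs n) = (m \in freqs n).
Proof. by rewrite !mem_freqs freq_normW. Qed.

Definition shell (q : nat) : seq (int * int) := [seq x <- freqs q | freq_norm x == q%:Z].

Lemma mem_shell q x : (x \in shell q) = (freq_norm x == q%:Z).
Proof. by rewrite mem_filter mem_freqs; case: eqP => //= ->; rewrite lexx. Qed.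

Lemma shell_uniq q : uniq (shell q).
Proof. exact/filter_uniq/freqs_uniq. Qed.

Lemma shell_wact q g m : (wact g m \in shell q) = (m \in shell q).
Proof. by rewrite !mem_shell freq_normW. Qed.

End frequencies.

(** * Bessel's inequality and Parseval's bound for the symmetrised exponentials *)

Section parseval.
Context {R : realType}.
Variables (L : R) (p : 'I_3 -> plane R).
Hypothesis p_eq : equilateral L p.
Notation C := R[i].
Notation T := (open_triangle p : set (lplane R)).
Notation Phi := (phi L p).
Notation N := (@normL2 _ _ R (area R) T).
Notation ipT := (@ip _ _ R (area R) T).
Notation freq := (int * int)%type.

Let D0 := tri_det_neq0 p_eq.
Let mT := measurable_triangle D0.
Let HT := @L2_hermitian _ _ R (area R) T mT.
Let A36 := 36 * tri_area p.

Let A36_gt0 : 0 < A36.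
Proof. by rewrite mulr_gt0// (tri_area_gt0 p_eq). Qed.

Definition combo (F : seq freq) (c : freq -> C) : plane R -> C :=
  \sum_(x <- F) c x *: (Phi x : plane R -> C^o).

Lemma comboE F c P : combo F c P = \sum_(x <- F) c x * Phi x P.
Proof. by rewrite /combo; elim: F => [|x F IH]; rewrite ?big_nil// !big_cons -IH. Qed.

Lemma combo_L2 F c : L2 (area R) T (combo F c).
Proof. by apply: (herm_closed_sum HT) => x; exact: phi_L2. Qed.

Lemma ip_combo F c y : uniq F -> (forall g m, (wact g m \in F) = (m \in F)) ->
  (forall g m, c (wact g m) = c m) -> y \in F ->
  ipT (combo F c) (Phi y) = A36%:C * c y.
Proof.
move=> uF Fw cw yF; rewrite -(ip_phi_comb p_eq uF Fw cw yF) /combo.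
exact: (herm_suml HT F c (phi_L2 p_eq) (phi_L2 p_eq y)).
Qed.

Definition coef (u : plane R -> C) (x : freq) : C := ipT u (Phi x).

Lemma coefW u g x : coef u (wact g x) = coef u x.
Proof. by rewrite /coef phiW. Qed.

Definition proj (F : seq freq) (u : plane R -> C) := combo F (fun x => A36^-1%:C * coef u x).

Let wF F u : uniq F -> (forall g m, (wact g m \in F) = (m \in F)) -> forall x, x \in F ->
  ipT (proj F u) (Phi x) = A36%:C * (A36^-1%:C * coef u x).
Proof. move=> uF Fw x xF; apply: (ip_combo uF Fw _ xF) => g m; by rewrite coefW. Qed.

Lemma proj_dist F u : uniq F -> (forall g m, (wact g m \in F) = (m \in F)) ->
  L2 (area R) T u ->
  N (fun P => u P - proj F u P) = N u - \sum_(x <- F) nsq (coef u x) / A36.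
Proof.
move=> uF Fw Lu; have := @herm_proj_dist _ _ _ _ HT _ F Phi (fun=> A36) u (phi_L2 p_eq) Lu (wF u uF Fw).
by rewrite !ip_self.
Qed.

Lemma bessel F u : uniq F -> (forall g m, (wact g m \in F) = (m \in F)) ->
  L2 (area R) T u -> \sum_(x <- F) nsq (coef u x) / A36 <= N u.
Proof. by move=> uF Fw Lu; rewrite -subr_ge0 -proj_dist// normL2_ge0. Qed.

Lemma combo_norm F c : uniq F -> (forall g m, (wact g m \in F) = (m \in F)) ->
  (forall g m, c (wact g m) = c m) -> N (combo F c) = \sum_(x <- F) A36 * nsq (c x).
Proof.
move=> uF Fw cw; have := @herm_comb_sqr _ _ _ _ HT _ F Phi (fun=> A36) c (phi_L2 p_eq).
by rewrite ip_self; apply => x xF; exact: ip_combo.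
Qed.

Lemma proj_best F u c : uniq F -> (forall g m, (wact g m \in F) = (m \in F)) ->
  (forall g m, c (wact g m) = c m) -> L2 (area R) T u ->
  N (fun P => u P - proj F u P) <= N (fun P => u P - combo F c P).
Proof.
move=> uF Fw cw Lu; rewrite proj_dist//.
have := @herm_dist_sqr _ _ _ _ HT _ F Phi (fun=> A36) c (phi_L2 p_eq) _ _ Lu.
move=> /(_ (fun x xF => ip_combo uF Fw cw xF)).
rewrite !ip_self => /= ->; rewrite -addrA lerD2l mulr_sumr -!sumrN -big_split /=.
apply: ler_sum => x _; rewrite -/(coef u x) -subr_ge0.
case: (c x) (coef u x) => [a b] [d e]; rewrite /nsq /=.
have -> : - (2 * (a * d - - b * e)) + A36 * (a ^+ 2 + b ^+ 2) - - ((d ^+ 2 + e ^+ 2) / A36)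
  = A36 * ((a - d / A36) ^+ 2 + (b - e / A36) ^+ 2) by field; rewrite gt_eqF.
by rewrite mulr_ge0 ?addr_ge0 ?sqr_ge0// ltW.
Qed.

(** Coefficients are averaged over Weyl orbits; the functions [Phi] do not change under the action,
    so the sum is the same, and the new coefficients are invariant. *)
Lemma trigpoly_combo a : trigpoly L p a -> exists n c,
  (forall g m, c (wact g m) = c m) /\ forall P, a P = combo (freqs n) c P.
Proof.
move=> [l al]; pose c (x : freq) : C := \sum_(q <- l) q.1 * (6^-1%:C *
  \sum_(g < 6) (x == wact g q.2)%:R).
pose n := \max_(q <- l) `|freq_norm q.2|%N; exists n, c; split.
  move=> g m; rewrite /c; apply: eq_bigr => q _; congr (_ * (_ * _)).
  transitivity (\sum_(h < 6) (m == wact h q.2)%:R : C) => //.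
  have -> : \sum_(h < 6) (m == wact h q.2)%:R = \sum_(h < 6) (wact g m == wact g (wact h q.2))%:R :> C.
    by apply: eq_bigr => h _; rewrite (inj_eq (@wact_inj g)).
  by rewrite (sum_wactl (fun y => (wact g m == y)%:R)).
move=> P; rewrite comboE al /c; under [RHS]eq_bigr do rewrite mulr_suml.
rewrite exchange_big /=; apply: eq_big_seq => q ql.
transitivity (q.1 * (6^-1%:C *
  \sum_(x <- freqs n) \sum_(g < 6) (x == wact g q.2)%:R * Phi x P)); last first.
  rewrite !mulr_sumr; apply: eq_bigr => x _.
  by rewrite -mulr_suml !mulrA.
congr (_ * _); rewrite exchange_big /=.
transitivity (6^-1%:C * \sum_(g < 6) Phi q.2 P).
  rewrite sumr_const card_ord mulrnAr -mulrnAl -(rmorphMn (real_complex R)) /= -mulr_natl.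
  by rewrite mulfV ?pnatr_eq0// mul1r.
congr (_ * _); apply: eq_bigr => g _.
have gF : wact g q.2 \in freqs n.
  rewrite freqs_wact mem_freqs; have := freq_norm_ge0 q.2.
  have : (`|freq_norm q.2| <= n)%N.
    by rewrite /n (big_rem q ql) /= leq_maxl.
  lia.
rewrite (bigD1_seq (wact g q.2)) ?freqs_uniq//= eqxx mul1r phiW big1 ?addr0// => x /negbTE ->.
by rewrite mul0r.
Qed.

Lemma coef_combo F c x : uniq F -> (forall g m, (wact g m \in F) = (m \in F)) ->
  (forall g m, c (wact g m) = c m) -> coef (combo F c) x = if x \in F then A36%:C * c x else 0.
Proof.
move=> uF Fw cw; case: ifPn => xF; first exact: ip_combo.
rewrite /coef (herm_suml HT); [|by move=> y; exact: phi_L2|exact: phi_L2].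
rewrite big_seq big1// => y yF; rewrite ip_phi// big1 ?mulr0// => h _.
by case: eqP => // yE; rewrite yE Fw (negbTE xF) in yF.
Qed.

(** Completeness in the form used later: an approximating trigonometric polynomial is supported in
    some [freqs n], and the projection on [freqs n] approximates [u] at least as well. *)
Lemma parseval_le u (b : R) : L2 (area R) T u ->
  (forall n, \sum_(x <- freqs n) nsq (coef u x) / A36 <= b) -> N u <= b.
Proof.
move=> Lu hb; apply/ler_addgt0Pl => e e0.
have [_ /(_ e e0)[a ta ua]] := trigpoly_dense p_eq Lu.
have [n [c [cw ac]]] := trigpoly_combo ta.
have Fw := @freqs_wact n; have := proj_best (freqs_uniq n) Fw cw Lu.
have -> : N (fun P => u P - combo (freqs n) c P) = N (fun P => u P - a P).
  by apply: eq_normL2 => P _; rewrite ac.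
rewrite (proj_dist (freqs_uniq n) Fw Lu); have := hb n; lra.
Qed.

End parseval.

(** * Boundary coefficients *)

Section weights.
Context {R : realType}.

(* [1 / (1 + y^2)] is dominated by the increments of the bounded monotone
   function [y / (1 + |y|)], so that its sums over the integers telescope. *)
Lemma inv_sqr_increment (y : R) :
  (1 + y ^+ 2)^-1 <= 4 * ((y + 1) / (1 + `|y + 1|) - y / (1 + `|y|)).
Proof.
have sq : 0 < 1 + y ^+ 2 by rewrite ltr_pwDl// sqr_ge0.
have [y0|y0] := leP 0 y.
  rewrite (ger0_norm y0) ger0_norm ?addr_ge0//.
  have -> : (y + 1) / (1 + (y + 1)) - y / (1 + y) = ((y + 1) * (y + 2))^-1.
    by field; apply/andP; split; rewrite gt_eqF//; lra.
  rewrite -[leLHS]mul1r ler_pdivrMr// mulrAC ler_pdivlMr ?mulr_gt0//; try lra.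
  by rewrite -subr_ge0; have := sqr_ge0 (y - 1 / 2); lra.
have [y1|y1] := leP y (-1).
  rewrite (ltr0_norm y0) ler0_norm; last lra.
  have -> : (y + 1) / (1 + - (y + 1)) - y / (1 + - y) = (- y * (1 - y))^-1.
    field; apply/and3P; split; first [by rewrite lt_eqF | by rewrite gt_eqF//; lra].
  rewrite -[leLHS]mul1r ler_pdivrMr// mulrAC ler_pdivlMr ?mulr_gt0//; try lra.
  by rewrite -subr_ge0; have := sqr_ge0 (y + 1 / 2); lra.
rewrite (ltr0_norm y0) ger0_norm; last lra.
apply: (@le_trans _ _ 1); first by rewrite invf_le1// lerDl sqr_ge0.
have h1 : (y + 1) / 2 <= (y + 1) / (1 + (y + 1)).
  by rewrite ler_pM2l ?lef_pV2 ?posrE//; lra.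
have h2 : - y / 2 <= - y / (1 - y).
  by rewrite ler_pM2l ?lef_pV2 ?posrE//; lra.
by move: h2; rewrite mulNr [leRHS]mulNr; lra.
Qed.

Lemma sum_inv_sqr (d : R) n : \sum_(m <- int_range n) (1 + (m%:~R - d) ^+ 2)^-1 <= 8.
Proof.
pose g (i : nat) : R := let y := (i%:Z - n%:Z)%:~R - d in y / (1 + `|y|).
have g1 i : `|g i| <= 1.
  rewrite /g; set y := _ - d; have y0 : 0 <= `|y| := normr_ge0 _.
  have d1 : 0 < 1 + `|y| by lra.
  by rewrite normrM normfV (gtr0_norm d1) ler_pdivrMr// mul1r; lra.
rewrite /int_range big_map; apply: (@le_trans _ _ (\sum_(0 <= i < n.*2.+1) 4 * (g i.+1 - g i))).
  rewrite /index_iota subn0; apply: ler_sum => i _; apply: le_trans (inv_sqr_increment _) _.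
  rewrite /g; have -> : (i.+1%:Z - n%:Z)%:~R - d = (i%:Z - n%:Z)%:~R - d + 1 :> R.
    by rewrite -addn1 PoszD -addrA (addrC 1) addrA rmorphD /= -addrA (addrC 1) addrA.
  exact: lexx.
rewrite -mulr_sumr telescope_sumr//.
by have := g1 n.*2.+1; have := g1 0%N; rewrite !ler_norml => /andP[? ?] /andP[? ?]; lra.
Qed.

(** For [a >= 0] and [3 * r ^ 2 = a], the value [3 * y ^ 2 - a] factors as [3 (|y| - r) (|y| + r)]
    and so is at least [3 (|y| - r) ^ 2] in absolute value; for negative [a] the same holds with
    [r = 0]. With the threshold 1/2 this bounds the weight by [3 / (1 + (|y| - r) ^ 2)], and 48 is 3
    times two sums of at most 8, one for each sign of [y]. *)
Lemma sum_quadratic_weight (a c : R) n :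
  \sum_(m <- int_range n) (if 1 / 2 <= `|3 * (m%:~R - c) ^+ 2 - a|
    then `|3 * (m%:~R - c) ^+ 2 - a|^-1 else 0) <= 48.
Proof.
pose r := Num.sqrt (Num.max a 0 / 3).
have r0 : 0 <= r by exact: sqrtr_ge0.
have r2 : 3 * r ^+ 2 = Num.max a 0.
  by rewrite sqr_sqrtr ?divr_ge0 ?le_max ?lexx ?orbT//; field.
have key (y : R) : (if 1 / 2 <= `|3 * y ^+ 2 - a| then `|3 * y ^+ 2 - a|^-1 else 0) <=
    3 * ((1 + (y - r) ^+ 2)^-1 + (1 + (y + r) ^+ 2)^-1).
  have p1 : 0 < (1 + (y - r) ^+ 2)^-1 by rewrite invr_gt0 ltr_pwDl ?sqr_ge0.
  have p2 : 0 < (1 + (y + r) ^+ 2)^-1 by rewrite invr_gt0 ltr_pwDl ?sqr_ge0.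
  case: ifP => [h|_]; last by lra.
  pose t := (`|y| - r) ^+ 2.
  have nk (z : R) : `|z| ^+ 2 = z ^+ 2 by rewrite real_normK ?num_real.
  have lt : 3 * t <= `|3 * y ^+ 2 - a|.
    have [a0|a0] := leP 0 a.
      have ar : a = 3 * r ^+ 2 by rewrite r2 max_l.
      have -> : 3 * y ^+ 2 - a = 3 * (`|y| - r) * (`|y| + r).
        by rewrite -(nk y) ar; ring.
      rewrite !normrM (ger0_norm (_ : 0 <= 3))// (ger0_norm (_ : 0 <= `|y| + r)) ?addr_ge0//.
      rewrite /t -mulrA ler_pM2l// -[X in X <= _]nk expr2 ler_wpM2l//.
      by apply: le_trans (ler_normB _ _) _; rewrite normr_id (ger0_norm r0).
    have rE : r = 0 by apply/eqP; rewrite -sqrf_eq0; apply/eqP; move: r2; rewrite max_r ?ltW//; lra.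
    rewrite /t rE subr0 nk ger0_norm; first lra.
    by have := sqr_ge0 y; lra.
  have t0 : 0 <= t by exact: sqr_ge0.
  have le3 : `|3 * y ^+ 2 - a|^-1 <= 3 * (1 + t)^-1.
    rewrite -[leLHS]mul1r ler_pdivrMr; last lra.
    rewrite mulrAC ler_pdivlMr; lra.
  apply: (le_trans le3); rewrite ler_pM2l//.
  by rewrite /t; case: (ger0P y) => _; [|rewrite -opprD sqrrN]; lra.
apply: le_trans (ler_sum _ (fun m _ => key (m%:~R - c))) _.
rewrite -mulr_sumr big_split /=.
have h1 := sum_inv_sqr (c + r) n; have h2 := sum_inv_sqr (c - r) n.
have -> : \sum_(m <- int_range n) (1 + (m%:~R - c - r) ^+ 2)^-1 =
  \sum_(m <- int_range n) (1 + (m%:~R - (c + r)) ^+ 2)^-1 :> R.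
  by apply: eq_bigr => m _; rewrite opprD addrA.
have -> : \sum_(m <- int_range n) (1 + (m%:~R - c + r) ^+ 2)^-1 =
  \sum_(m <- int_range n) (1 + (m%:~R - (c - r)) ^+ 2)^-1 :> R.
  by apply: eq_bigr => m _; rewrite opprB addrA addrAC.
lra.
Qed.

End weights.

Section sums.
Context {R : realType}.
Notation C := R[i].

Lemma nsq_sum_le (I : Type) (s : seq I) (f : I -> C) :
  nsq (\sum_(x <- s) f x) <= 2 ^+ size s * \sum_(x <- s) nsq (f x).
Proof.
elim: s => [|x s IH]; first by rewrite !big_nil /nsq /= expr0n/= addr0 mulr0.
rewrite !big_cons /=; apply: le_trans (nsqD_le _ _) _.
have h1 : 1 <= 2 ^+ size s :> R by rewrite exprn_ege1// ler1n.
have h2 := nsq_ge0 (f x).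
have h3 := ler_peMl h2 h1.
rewrite [2 ^+ (size s).+1]exprS -mulrA -mulrDr ler_pM2l// mulrDr.
exact: lerD.
Qed.

Lemma sum_subset_le (I : eqType) (s t : seq I) (G : I -> R) : uniq s -> uniq t ->
  {subset s <= t} -> (forall x, 0 <= G x) -> \sum_(x <- s) G x <= \sum_(x <- t) G x.
Proof.
move=> us ut st G0; have pst : perm_eq s [seq x <- t | x \in s].
  apply: uniq_perm => //; first exact: filter_uniq.
  by move=> x; rewrite mem_filter; have [/st ->|] := boolP (x \in s).
rewrite (perm_big _ pst) big_filter big_mkcond /=.
by apply: ler_sum => x _; case: ifP.
Qed.

Lemma sum_wact_seq (V : nmodType) (F : seq (int * int)) (f : int * int -> V) g : uniq F ->
  (forall g m, (wact g m \in F) = (m \in F)) ->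
  \sum_(x <- F) f (wact g x) = \sum_(x <- F) f x.
Proof.
move=> uF Fw; rewrite -(big_map (wact g) xpredT f); apply: perm_big; apply: uniq_perm => //.
  by rewrite map_inj_uniq//; exact: wact_inj.
move=> x; apply/mapP/idP => [[y yF ->]|xF]; first by rewrite Fw.
by exists (wact (winv g) x); rewrite ?Fw// wactVr.
Qed.

Lemma freqs_box n x : x \in freqs n -> `|x.1| <= n.*2%:Z /\ `|x.2| <= n.*2%:Z.
Proof.
rewrite mem_filter => /andP[_ /allpairsP[[j k]]]; rewrite !mem_int_range => -[h1 h2 ->].
by [].
Qed.

End sums.

(** * Bessel's inequality on one side of the triangle *)

Section segment.
Context {R : realType}.
Notation C := R[i].
Variable L : R.
Hypothesis L0 : 0 < L.
Notation leb := (@lebesgue_measure R).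
Notation seg := (`[0%R, L]%classic : set (measurableTypeR R)).

(** On a side the plane waves have frequencies in a lattice three times finer than the Fourier
    lattice of [[0, L]], so orthogonality holds only within a residue class modulo 3. *)
Definition cexp (eta : int) (s : R) : C := cis (2 * pi / (3 * L) * eta%:~R * s).

Let mseg : measurable seg. Proof. exact: measurable_itv. Qed.

Lemma segment_integrable (f : R -> R) : continuous f -> leb.-integrable seg (EFin \o f).
Proof.
move=> cf; apply: continuous_compact_integrable; first exact: segment_compact.
exact: continuous_subspaceT.
Qed.

Lemma segment_L2 (f : R -> C) : continuous (fun s : R => complex.Re (f s)) ->
  continuous (fun s : R => complex.Im (f s)) -> L2 leb seg f.
Proof.
move=> cr ci.
have ms (g : R -> R) : continuous g -> measurable_fun seg (g : measurableTypeR R -> measurableTypeR R).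
  by move=> cg; apply: measurable_funTS; exact: continuous_measurable_fun.
apply: (L2P (ms _ cr) (ms _ ci)); apply: segment_integrable => s.
by apply: cvgD; apply: cvgM; (exact: cr || exact: ci).
Qed.

Lemma cexp_L2 eta : L2 leb seg (cexp eta).
Proof.
by apply: segment_L2 => s; apply: (continuous_comp (f := fun s => 2 * pi / (3 * L) * eta%:~R * s));
  [apply: cvgM; [exact: cvg_cst|exact: cvg_id] | exact: continuous_cos |
   apply: cvgM; [exact: cvg_cst|exact: cvg_id] | exact: continuous_sin].
Qed.

Lemma Cintegral_cis (n : int) : n != 0 ->
  Cintegral leb seg (fun s => cis (2 * pi * n%:~R / L * s)) = 0.
Proof.
move=> n0; pose w := 2 * pi * n%:~R / L; rewrite -/w.
have pi0 := pi_gt0 R.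
have w0 : w != 0 by rewrite !mulf_neq0 ?invr_neq0 ?intr_eq0 ?pnatr_eq0 ?(gt_eqF pi0) ?(gt_eqF L0).
have wL : w * L = 0 + 2 * pi * n%:~R by rewrite add0r /w; field; rewrite gt_eqF.
have cl : continuous (fun s : R => w * s) by move=> s; apply: cvgM; [exact: cvg_cst|exact: cvg_id].
have := periodic2pi n (0 : R); rewrite -wL cos0 sin0 => -[cL sL].
have ds (s : R) : is_derive s 1 (fun s : R => w^-1 *: sin (s * w)) (cos (w * s)).
  by apply: is_derive_eq; rewrite scaler0 add0r -[LHS]/(w^-1 * (cos (s * w) * (w * 1))) mulr1 mulrCA mulVf// mulr1 mulrC.
have dc (s : R) : is_derive s 1 (fun s : R => - w^-1 *: cos (s * w)) (sin (w * s)).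
  by apply: is_derive_eq; rewrite scaler0 add0r -[LHS]/(- w^-1 * (- sin (s * w) * (w * 1))) mulr1 mulNr mulNr mulrN opprK mulrCA mulVf// mulr1 mulrC.
have cc : continuous (fun s : R => cos (w * s)).
  by move=> s; apply: (continuous_comp (f := fun s => w * s)); [exact: cl|exact: continuous_cos].
have cs : continuous (fun s : R => sin (w * s)).
  by move=> s; apply: (continuous_comp (f := fun s => w * s)); [exact: cl|exact: continuous_sin].
rewrite /Cintegral /Rintegral /= (FTC_segment L0 cc ds) (FTC_segment L0 cs dc) /=.
by rewrite !(mulrC L) cL sL !mul0r sin0 cos0 !subrr.
Qed.

Lemma cexp_mul_conj eta eta' s : cexp eta s * (cexp eta' s)^* = cexp (eta - eta') s.
Proof. by rewrite /cexp -cisN -cisD; congr cis; rewrite rmorphB; ring. Qed.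

Lemma ip_cexp eta eta' : (3 %| eta - eta')%Z ->
  ip leb seg (cexp eta) (cexp eta') = if eta == eta' then L%:C else 0.
Proof.
move=> /dvdzP[n nE]; have [->|ne] := eqVneq eta eta'.
  rewrite ip_self /normL2 /sqnorm; congr (_%:C).
  under eq_integral do rewrite -[X in X%:E]/(nsq _) nsq_cis.
  have := integral_cst leb mseg 1%E; rewrite mul1e => ->.
  have lE : leb `[0%R, L]%classic = L%:E by rewrite lebesgue_measure_itv/= lte_fin L0 sube0.
  set X := (X in fine X = _); have -> : X = L%:E by exact: lE.
  by [].
rewrite /ip; transitivity (Cintegral leb seg (fun s => cis (2 * pi * n%:~R / L * s))).
  apply: eq_Cintegral => s _; rewrite cexp_mul_conj /cexp nE; congr cis.
  by rewrite rmorphM /=; field; rewrite gt_eqF.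
apply: Cintegral_cis; apply: contra_neq ne => n0; apply/eqP; rewrite -subr_eq0 nE n0.
by rewrite mul0r.
Qed.

Lemma bessel_residue (f : R -> C) (s : seq int) : uniq s ->
  (forall x y, x \in s -> y \in s -> (3 %| x - y)%Z) -> L2 leb seg f ->
  \sum_(x <- s) nsq (ip leb seg f (cexp x)) <= L * normL2 leb seg f.
Proof.
move=> us s3 Lf; have HS := @L2_hermitian _ _ R leb seg mseg.
have := @herm_bessel _ _ _ _ HS _ s cexp (fun=> L) f cexp_L2 Lf.
rewrite ip_self /= -mulr_suml ler_pdivrMr// mulrC; apply => x xs.
rewrite (herm_suml HS _ _ cexp_L2 (cexp_L2 x)) (bigD1_seq x)//= ip_cexp ?subrr ?dvdz0// eqxx.
rewrite big_seq_cond big1 ?addr0 1?mulrC// => y /andP[ys yx].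
by rewrite ip_cexp ?s3// (negbTE yx) mulr0.
Qed.

(** Bessel's inequality is applied to each of the three residue classes, hence the factor 3. *)
Lemma bessel_segment (f : R -> C) (s : seq int) : uniq s -> L2 leb seg f ->
  \sum_(x <- s) nsq (ip leb seg f (cexp x)) <= 3 * L * normL2 leb seg f.
Proof.
move=> us Lf; pose r (x : int) : 'I_3 := inord (absz (x %% 3)%Z).
rewrite (partition_big r xpredT)//= -mulrA mulr_natl.
rewrite -[X in _ *+ X](card_ord 3) -sumr_const; apply: ler_sum => i _.
rewrite -big_filter; apply: bessel_residue => //; first exact: filter_uniq.
move=> x y; rewrite !mem_filter => /andP[/eqP rx _] /andP[/eqP ry _].
have : nat_of_ord (r x) = r y by rewrite rx ry.
by rewrite /r !inordK; lia.
Qed.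

End segment.

Section boundary.
Context {R : realType}.
Variables (L : R) (p : 'I_3 -> plane R).
Hypothesis p_eq : equilateral L p.
Notation C := R[i].
Notation leb := (@lebesgue_measure R).
Notation seg := (`[0%R, L]%classic : set (measurableTypeR R)).
Notation Phi := (phi L p).
Notation freq := (int * int)%type.

Let L0 := equilateral_gt0 p_eq.
Let mseg : measurable seg. Proof. exact: measurable_itv. Qed.
Let HS := @L2_hermitian _ _ R leb seg mseg.

Let size_index_enum n : size (index_enum 'I_n) = n.
Proof. by rewrite [index_enum _]unlock -enumT size_enum_ord. Qed.

Lemma side_lengthE i : side_length p i = L.
Proof. by apply: p_eq.2; case: i => -[|[|[|]]]. Qed.

(** The tangential frequency of the plane wave [m] along side [i], in the unit [2 * pi / (3 * L)];
    the signs follow the orientation of [side]. *)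
Definition side_freq (i : 'I_3) (m : freq) : int :=
  match nat_of_ord i with
  | 0%N => 2 * m.1 + m.2 | 1%N => m.2 - m.1 | _ => - (m.1 + 2 * m.2) end.

Lemma chi_side i m : exists z : C, nsq z = 1 /\
  forall s, chi L p m (side p i s) = z * cexp L (side_freq i m) s.
Proof.
have sideE (a : R -> R * R) : (forall s, side p i s = tri_map p (a s)) -> forall s,
    chi L p m (side p i s) = cis (2 * pi / 3 * ((2 * m.1 + m.2)%:~R * (a s).1 + (m.1 + 2 * m.2)%:~R * (a s).2)).
  by move=> h s; rewrite h /chi phase_map.
have Ln : L != 0 by rewrite gt_eqF.
have fin (t : R) (a : R -> R * R) : (forall s, side p i s = tri_map p (a s)) ->
  (forall s, 2 * pi / 3 * ((2 * m.1 + m.2)%:~R * (a s).1 + (m.1 + 2 * m.2)%:~R * (a s).2)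
    = t + 2 * pi / (3 * L) * (side_freq i m)%:~R * s) ->
  exists z : C, nsq z = 1 /\ forall s, chi L p m (side p i s) = z * cexp L (side_freq i m) s.
  by move=> h1 h2; exists (cis t); split; [exact: nsq_cis|move=> s; rewrite (sideE a)// h2 cisD].
move: fin {sideE}; rewrite /side /side_freq side_lengthE.
case: i => -[|[|[|//]]] ilt fin.
- apply: (fin 0 (fun s => (s / L, 0))) => s /=.
    rewrite /tri_map /vtx0 /vtx1 (_ : Ordinal ilt = ord0); last exact: val_inj.
    by congr (_, _) => /=; ring.
  by field.
- apply: (fin (2 * pi / 3 * (2 * m.1 + m.2)%:~R) (fun s => (1 - s / L, s / L))) => s /=.
    rewrite /tri_map /vtx0 /vtx1 /vtx2 (_ : Ordinal ilt = ordS ord0); last exact: val_inj.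
    by congr (_, _) => /=; ring.
  by rewrite !rmorphB !rmorphD !rmorphM /=; field.
- apply: (fin (2 * pi / 3 * (m.1 + 2 * m.2)%:~R) (fun s => (0, 1 - s / L))) => s /=.
    rewrite /tri_map /vtx0 /vtx2 (_ : Ordinal ilt = ordS (ordS ord0)); last exact: val_inj.
    rewrite (_ : ordS (ordS (ordS ord0)) = ord0); last exact: val_inj.
    by congr (_, _) => /=; ring.
  by rewrite !rmorphN !rmorphD !rmorphM /=; field.
Qed.

Definition bcoef (h : plane R -> C) (x : freq) : C :=
  boundary_integral p (fun P => h P * (Phi x P)^*).

Definition side_coef (h : plane R -> C) i (eta : int) : C :=
  ip leb seg (h \o side p i) (cexp L eta).

Definition bnorm (h : plane R -> C) : R := \sum_(i < 3) normL2 leb seg (h \o side p i).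

Lemma bnorm_ge0 h : 0 <= bnorm h.
Proof. by apply: sumr_ge0 => i _; exact: normL2_ge0. Qed.

Lemma boundary_L2E h : boundary_L2 p h -> forall i, L2 leb seg (h \o side p i).
Proof. by move=> hL i; have := hL i; rewrite side_lengthE. Qed.

Lemma nsq_bcoef_le h x : boundary_L2 p h ->
  nsq (bcoef h x) <= 2 ^+ 9 * \sum_(i < 3) \sum_(g < 6) nsq (side_coef h i (side_freq i (wact g x))).
Proof.
move=> hL; have Lh := boundary_L2E hL.
rewrite /bcoef /boundary_integral; apply: le_trans (nsq_sum_le _ _) _.
rewrite size_index_enum (exprD _ 3 6) -mulrA ler_pM2l// mulr_sumr; apply: ler_sum => i _.
rewrite side_lengthE.
have cL g : L2 leb seg (chi L p (wact g x) \o side p i).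
  have [z [_ zE]] := chi_side i (wact g x).
  rewrite (_ : _ \o _ = fun s => z * cexp L (side_freq i (wact g x)) s); last exact/funext.
  by apply: (L2Z mseg); exact: cexp_L2.
have -> : Cintegral leb seg ((fun P => h P * (Phi x P)^*) \o side p i) =
    \sum_(g < 6) ip leb seg (h \o side p i) (chi L p (wact g x) \o side p i).
  have := herm_sumr HS (index_enum 'I_6) (fun=> 1) cL (Lh i).
  under [X in _ = X -> _]eq_bigr do rewrite conjC1 mul1r.
  move=> <-; congr (ip leb seg); apply/funext => s; rewrite /phi /=.
  elim: (index_enum _) => [|g l IH]; first by rewrite !big_nil.
  by rewrite !big_cons IH scale1r.
apply: le_trans (nsq_sum_le _ _) _; rewrite size_index_enum ler_pM2l//.
apply: ler_sum => g _; have [z [z1 zE]] := chi_side i (wact g x).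
have -> : chi L p (wact g x) \o side p i = (fun s => z * cexp L (side_freq i (wact g x)) s).
  exact/funext.
have Lc := @cexp_L2 R L (side_freq i (wact g x)).
rewrite (hermC HS (hermZ HS z Lc) (Lh i)) (hermZl HS z Lc (Lh i)) nsq_conj nsqM z1 mul1r.
by rewrite (hermC HS (Lh i) Lc) nsq_conj.
Qed.

(** The inverse distance of a level to [a]. The cut-off at 1/2 discards the levels too close to be
    divided by, and makes the sums bounded uniformly in [a]. *)
Definition level_weight (a : R) (q : int) : R :=
  if 1 / 2 <= `|q%:~R - a| then `|q%:~R - a|^-1 else 0.

Lemma level_weight_ge0 a q : 0 <= level_weight a q.
Proof. by rewrite /level_weight; case: ifP => // _; rewrite invr_ge0. Qed.

(* Each side sees the frequency [eta] together with a transversal integer [k]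
   for which [freq_norm] is the quadratic polynomial [3 (k - c)^2 + eta^2 / 4]. *)
Definition side_split (i : 'I_3) (m : freq) : int * int :=
  (side_freq i m, if nat_of_ord i == 2%N then m.2 else m.1).

Lemma side_split_inj i : injective (side_split i).
Proof.
case: i => -[|[|[|//]]] ilt [j k] [j' k']; rewrite /side_split /side_freq /= => -[h1 h2];
  by congr (_, _); lia.
Qed.

(** The boundary coefficient depends on the tangential frequency alone, so the weights can be summed
    over the transversal integer first, with a bound 48 independent of [a] and of the tangential
    frequency; Bessel's inequality then sums the coefficients. *)
Lemma side_weight_sum h i a n : boundary_L2 p h ->
  \sum_(x <- freqs n) level_weight a (freq_norm x) * nsq (side_coef h i (side_freq i x)) <=
  144 * L * normL2 leb seg (h \o side p i).
Proof.
move=> hL; have Lh := boundary_L2E hL i.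
(* The vertex of the quadratic polynomial is [sgn * eta], found by completing the square. *)
pose sgn : R := if nat_of_ord i == 0%N then 1 / 2 else - (1 / 2).
pose W (z : int * int) : R := let y := 3 * (z.2%:~R - sgn * z.1%:~R) ^+ 2 - (a - z.1%:~R ^+ 2 / 4) in
  if 1 / 2 <= `|y| then `|y|^-1 else 0.
have WE x : level_weight a (freq_norm x) = W (side_split i x).
  rewrite /level_weight /W; suff -> : (freq_norm x)%:~R - a = 3 * ((side_split i x).2%:~R -
    sgn * (side_split i x).1%:~R) ^+ 2 - (a - (side_split i x).1%:~R ^+ 2 / 4) by [].
  rewrite /sgn /side_split /side_freq /freq_norm; case: i x {Lh sgn W} => -[|[|[|//]]] ilt [j k] /=;
    by rewrite ?(rmorphN, rmorphB, rmorphD, rmorphM, rmorphXn) /=; field.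
have W0 z : 0 <= W z by rewrite /W; case: ifP => // _; rewrite invr_ge0.
(* Frequencies in [freqs n] have coordinates at most [2 * n], hence tangential frequencies at most
   [6 * n]. *)
pose B := (n.*2 + n.*2 + n.*2)%N.
pose G z := W z * nsq (side_coef h i z.1).
have -> : \sum_(x <- freqs n) level_weight a (freq_norm x) * nsq (side_coef h i (side_freq i x)) =
    \sum_(z <- map (side_split i) (freqs n)) G z.
  by rewrite big_map; apply: eq_bigr => x _; rewrite WE.
apply: (@le_trans _ _ (\sum_(z <- [seq (e, k) | e <- int_range B, k <- int_range B]) G z)).
  apply: sum_subset_le.
  - by rewrite map_inj_uniq ?freqs_uniq//; exact: side_split_inj.
  - by apply: allpairs_uniq; rewrite ?int_range_uniq// => -[? ?] [? ?].
  - move=> z /mapP[[j k] /freqs_box[x1 x2] ->]; apply/allpairsP; exists (side_split i (j, k)).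
    rewrite !mem_int_range; split; last by [].
      by rewrite /side_split /side_freq /B /=; move: x1 x2 => /= x1 x2; case: i {Lh sgn W WE W0 G} => -[|[|[|//]]] ilt /=; lia.
    by rewrite /side_split /B /=; move: x1 x2 => /= x1 x2; case: ifP => _; lia.
  - by move=> z; rewrite mulr_ge0// nsq_ge0.
rewrite big_allpairs_dep /=.
apply: (@le_trans _ _ (\sum_(e <- int_range B) 48 * nsq (side_coef h i e))).
  apply: ler_sum => e _; rewrite /G /= -mulr_suml ler_wpM2r ?nsq_ge0//.
  exact: (sum_quadratic_weight (a - e%:~R ^+ 2 / 4) (sgn * e%:~R) B).
rewrite -mulr_sumr (_ : 144 * L * _ = 48 * (3 * L * normL2 leb seg (h \o side p i))); last by ring.
by rewrite ler_pM2l// (bessel_segment L0 (int_range_uniq B) Lh).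
Qed.

(** The factor [2 ^ 9] pays for squaring sums over three sides and six exponentials, 6 for the sum
    over the group, and [144 * L] is 48 times the Bessel constant [3 * L]. *)
Definition bdry_const : R := 2 ^+ 9 * 6 * (144 * L).

Lemma boundary_weight_sum h a n : boundary_L2 p h ->
  \sum_(x <- freqs n) level_weight a (freq_norm x) * nsq (bcoef h x) <= bdry_const * bnorm h.
Proof.
move=> hL; apply: (@le_trans _ _ (\sum_(x <- freqs n) \sum_(i < 3) \sum_(g < 6)
   2 ^+ 9 * (level_weight a (freq_norm (wact g x)) * nsq (side_coef h i (side_freq i (wact g x)))))).
  apply: ler_sum => x _.
  apply: le_trans (ler_wpM2l (level_weight_ge0 _ _) (nsq_bcoef_le x hL)) _.
  rewrite mulrCA !mulr_sumr; apply: ler_sum => i _; rewrite !mulr_sumr; apply: ler_sum => g _.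
  by rewrite freq_normW.
rewrite exchange_big /bdry_const /bnorm mulr_sumr /=; apply: ler_sum => i _.
rewrite exchange_big /=.
under eq_bigr do rewrite -mulr_sumr (sum_wact_seq (fun x => level_weight a (freq_norm x) *
  nsq (side_coef h i (side_freq i x))) _ (freqs_uniq n) (@freqs_wact n)).
rewrite -mulr_sumr; set S := \sum_(x <- freqs n) _.
have -> : \sum_(g < 6) S = 6 * S by rewrite sumr_const card_ord mulr_natl.
rewrite [leLHS]mulrA -[leRHS]mulrA ler_pM2l ?mulr_gt0 ?exprn_gt0//.
exact: side_weight_sum.
Qed.

End boundary.

(** * Observation of a single Neumann level *)

Section cocircular.
Notation freq := (int * int)%type.

Definition fsub (x y : freq) : freq := (x.1 - y.1, x.2 - y.2).

Lemma fsub_eq0 x y : fsub x y = (0, 0) -> x = y.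
Proof. by case: x y => [a b] [c d] [h1 h2]; congr (_, _); lia. Qed.

(* The circumradius formula [abc = 4 R S] for three lattice points on the circle
   [freq_norm = q]. *)
Lemma circumradius x y z q : freq_norm x = q -> freq_norm y = q -> freq_norm z = q ->
  3 * ((x.1 - y.1) * (x.2 - z.2) - (x.2 - y.2) * (x.1 - z.1)) ^+ 2 * q =
  freq_norm (fsub x y) * freq_norm (fsub x z) * freq_norm (fsub y z).
Proof.
case: x y z => [a b] [c d] [e f]; rewrite /freq_norm /fsub /= => h1 h2 h3.
pose B (s t : int * int) := 2 * s.1 * t.1 + s.1 * t.2 + s.2 * t.1 + 2 * s.2 * t.2.
pose Q (s : int * int) := s.1 ^+ 2 + s.1 * s.2 + s.2 ^+ 2.
pose u : int * int := (a - c, b - d); pose v : int * int := (a - e, b - f).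
have Bu : B (a, b) u = Q u.
  transitivity (Q u + (a ^+ 2 + a * b + b ^+ 2) - (c ^+ 2 + c * d + d ^+ 2)).
    by rewrite /B /Q /u /=; ring.
  by rewrite h1 h2 addrK.
have Bv : B (a, b) v = Q v.
  transitivity (Q v + (a ^+ 2 + a * b + b ^+ 2) - (e ^+ 2 + e * f + f ^+ 2)).
    by rewrite /B /Q /v /=; ring.
  by rewrite h1 h3 addrK.
(* This is the vanishing of the Gram determinant of three vectors of the plane, where
   [4 * Q u * Q v - B u v ^ 2] is three times the squared determinant of [u] and [v]. *)
transitivity (Q v * B (a, b) u ^+ 2 - B u v * B (a, b) u * B (a, b) v + Q u * B (a, b) v ^+ 2).
  by rewrite -h1 /Q /B /u /v /=; ring.
by rewrite Bu Bv /Q /B /u /v /=; ring.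
Qed.

(** Points [x] with [x] and [x - z] on the same circle satisfy one linear equation, that of a
    perpendicular bisector. Three of them would be collinear, and the circumradius formula with zero
    area makes two of them coincide. *)
Lemma shell_diff_le2 q z : z != (0, 0) ->
  (size [seq x <- shell q | fsub x z \in shell q] <= 2)%N.
Proof.
move=> z0; set s := [seq _ <- _ | _].
have us : uniq s by apply: filter_uniq; exact: shell_uniq.
have hs x : x \in s -> freq_norm x = q /\ freq_norm (fsub x z) = q.
  by rewrite mem_filter !mem_shell => /andP[/eqP h1 /eqP h2].
case: s us hs => [//|x [//|y [//|w s]]] us hs; exfalso; move: us => /= /and4P[].
rewrite !inE => /norP[xy /norP[xw _]] /norP[yw _] _ _.
have [x1 x2] := hs x (mem_head _ _).
have [y1 y2] := hs y ltac:(by rewrite !inE eqxx orbT).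
have [w1 w2] := hs w ltac:(by rewrite !inE eqxx !orbT).
have := circumradius x1 y1 w1.
set D := _ * _ - _ * _; have D0 : D = 0.
  have lin u : freq_norm u = q -> freq_norm (fsub u z) = q ->
    (2 * u.1 + u.2) * z.1 + (u.1 + 2 * u.2) * z.2 = freq_norm z.
    by case: u z {z0 hs x2 y2 w2} => [a b] [c d]; rewrite /freq_norm /fsub /= => h1 h2; lia.
  have lx := lin _ x1 x2; have ly := lin _ y1 y2; have lw := lin _ w1 w2.
  have perp u v : (2 * u.1 + u.2) * z.1 + (u.1 + 2 * u.2) * z.2 = freq_norm z ->
    (2 * v.1 + v.2) * z.1 + (v.1 + 2 * v.2) * z.2 = freq_norm z ->
    (2 * (u.1 - v.1) + (u.2 - v.2)) * z.1 + ((u.1 - v.1) + 2 * (u.2 - v.2)) * z.2 = 0.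
    by move=> hu hv; rewrite -[RHS](subrr (freq_norm z)) -{1}hu -hv; ring.
  have py := perp _ _ lx ly; have pw := perp _ _ lx lw.
  have e1 : 3 * (z.1 * D) = ((x.1 - w.1) + 2 * (x.2 - w.2)) * 0 - ((x.1 - y.1) + 2 * (x.2 - y.2)) * 0.
    by rewrite -{1}py -pw /D; ring.
  have e2 : 3 * (z.2 * D) = (2 * (x.1 - y.1) + (x.2 - y.2)) * 0 - (2 * (x.1 - w.1) + (x.2 - w.2)) * 0.
    by rewrite -{1}pw -py /D; ring.
  move/eqP: e1; move/eqP: e2; rewrite !mulr0 subrr !mulf_eq0 /=.
  move=> /orP[z2|/eqP//] /orP[z1|/eqP//]; move: z0.
  by rewrite (surjective_pairing z) (eqP z1) (eqP z2) eqxx.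
rewrite D0 expr0n/= mulr0 mul0r => /esym/eqP; rewrite !mulf_eq0.
by move=> /orP[/orP[]|] /eqP/freq_norm_eq0/fsub_eq0 h; [move: xy|move: xw|move: yw]; rewrite h eqxx.
Qed.

(** Two near neighbours would form with [x] a triangle with squared sides at most [K], [K] and
    [4 * K]. Its doubled area in lattice units is a nonzero integer, so the circumradius formula
    yields [3 * q <= 4 * K ^ 3]. *)
Lemma near_le1 (q K : nat) (x : freq) : (2 * K ^ 3 < q)%N -> x \in shell q ->
  (size [seq y <- shell q | (y != x) && (freq_norm (fsub x y) <= K%:Z)%R] <= 1)%N.
Proof.
move=> Kq; rewrite mem_shell => /eqP x1; set s := [seq _ <- _ | _].
have us : uniq s by apply: filter_uniq; exact: shell_uniq.
have hs y : y \in s -> [/\ freq_norm y = q, y != x & freq_norm (fsub x y) <= K%:Z].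
  by rewrite mem_filter mem_shell => /andP[/andP[h1 h2] /eqP h3].
case: s us hs => [//|y [//|w s]] us hs; exfalso; move: us => /= /and3P[].
rewrite !inE => /norP[yw _] _ _.
have [y1 yx yK] := hs y (mem_head _ _).
have [w1 wx wK] := hs w ltac:(by rewrite !inE eqxx orbT).
have := circumradius x1 y1 w1; set D := _ * _ - _ * _.
have nz (a b : freq) : a != b -> 1 <= freq_norm (fsub a b).
  move=> ab; have := freq_norm_ge0 (fsub a b); have : freq_norm (fsub a b) != 0.
    by apply: contra ab => /eqP/freq_norm_eq0/fsub_eq0 ->.
  lia.
have := nz _ _ yw; have := nz x y ltac:(by rewrite eq_sym); have := nz x w ltac:(by rewrite eq_sym).
have tri : freq_norm (fsub y w) <= 2 * freq_norm (fsub x y) + 2 * freq_norm (fsub x w).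
  have := freq_norm_ge0 (x.1 - y.1 + (x.1 - w.1), x.2 - y.2 + (x.2 - w.2)).
  by case: (x) (y) (w) => [a b] [c d] [e f]; rewrite /freq_norm /fsub /=; nia.
move: tri; set a := freq_norm (fsub x y) in yK *; set b := freq_norm (fsub x w) in wK *.
set c := freq_norm (fsub y w) => tri b1 a1 c1 E.
have abc : a * b * c <= K%:Z * K%:Z * (4 * K%:Z).
  by apply: ler_pM; [nia|lia|apply: ler_pM; lia|lia].
have D2 : 1 <= D ^+ 2.
  have := sqr_ge0 D; have : D ^+ 2 != 0.
    by apply/eqP => D0; rewrite D0 mulr0 mul0r in E; nia.
  by move: (D ^+ 2) => d; lia.
have : q%:Z * 3 <= 4 * K%:Z ^+ 3.
  apply: (@le_trans _ _ (a * b * c)); first by rewrite -E; move: (D ^+ 2) D2 => d; nia.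
  by apply: le_trans abc _; rewrite (_ : K%:Z ^+ 3 = K%:Z * K%:Z * K%:Z) ?exprS ?expr0 ?mulr1 ?mulrA//; lia.
move: Kq; rewrite -ltz_nat PoszM -(rmorphXn Posz) /= => Kq.
have : 0 <= K%:Z ^+ 3 by rewrite exprn_ge0.
by move: (K%:Z ^+ 3) Kq => k; lia.
Qed.

End cocircular.

(** * Zeros of trigonometric polynomials *)

Section trig_zeros.
Context {R : realType}.
Notation C := R[i].

Lemma cisX (x : R) n : cis (n%:R * x) = cis x ^+ n.
Proof.
elim: n => [|n IH]; first by rewrite mul0r cis0 expr0.
by rewrite -natr1 mulrDl mul1r cisD IH exprSr.
Qed.

(** Multiplying by a power of [cis (2 * pi * t)] gives a nonzero polynomial in this number. For
    [0 < t < 1 / 2] the angle lies in []0, pi[], where [acos] recovers [t] from the root. *)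
Lemma finite_trig_zeros (I : eqType) (F : seq I) (e : I -> int) (d : I -> C) x0 :
  uniq F -> {in F &, injective e} -> x0 \in F -> d x0 != 0 ->
  finite_set [set t : R | 0 < t < 1 / 2 /\ \sum_(x <- F) d x * cis (2 * pi * (e x)%:~R * t) = 0].
Proof.
move=> uF inj_e x0F d0; pose N := \max_(x <- F) `|e x|%N.
have eN x : x \in F -> (`|e x| <= N)%N by move=> xF; rewrite /N (big_rem x xF) /= leq_maxl.
pose n x := absz (e x + N%:Z).
have nE x : x \in F -> (n x)%:Z = e x + N%:Z by move=> /eN; rewrite /n; lia.
pose P : {poly C} := \sum_(x <- F) d x *: 'X^(n x).
have P0 : P != 0.
  apply: contra d0 => /eqP PE; have : P`_(n x0) = 0 by rewrite PE coef0.
  rewrite coef_sum (bigD1_seq x0)//= coefZ coefXn eqxx mulr1 big_seq_cond big1 ?addr0; first by move=> ->.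
  move=> x /andP[xF xx0]; rewrite coefZ coefXn; case: eqP => [nn|]; last by rewrite mulr0.
  have : e x0 = e x by have := nE _ xF; have := nE _ x0F; rewrite nn; lia.
  by move=> /(inj_e _ _ x0F xF) E; rewrite E eqxx in xx0.
have [r rE] := closed_field_poly_normal P.
have fr : finite_set ((fun z : C => acos (complex.Re z) / (2 * pi)) @` [set` r]).
  by apply: finite_image; exact: finite_seq.
apply: sub_finite_set fr => t [/andP[t0 t2] ft] /=.
have pi0 := pi_gt0 R.
exists (cis (2 * pi * t)); last first.
  have ac : acos (cos (2 * pi * t)) = 2 * pi * t.
    by apply: cosK; rewrite in_itv/= !mulr_ge0 ?(ltW pi0) ?(ltW t0)//=; nra.
  by rewrite /= ac mulrC mulKf// mulf_neq0 ?(gt_eqF pi0)// pnatr_eq0.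
have : root P (cis (2 * pi * t)).
  apply/rootP; rewrite /P horner_sum; transitivity (cis (N%:R * (2 * pi * t)) * \sum_(x <- F) d x * cis (2 * pi * (e x)%:~R * t)).
    rewrite mulr_sumr; apply: eq_big_seq => x xF; rewrite hornerZ hornerXn -cisX [RHS]mulrCA -[in RHS]cisD.
    by congr (_ * cis _); rewrite -[(n x)%:R]/((n x)%:Z%:~R) nE// rmorphD /=; ring.
  by rewrite ft mulr0.
rewrite rE rootZ ?lead_coef_eq0// root_prod_XsubC.
by [].
Qed.

End trig_zeros.

Section chi_null.
Context {R : realType}.
Variables (L : R) (p : 'I_3 -> plane R).
Hypothesis p_eq : equilateral L p.
Notation C := R[i].
Notation M := (measurableTypeR R * measurableTypeR R)%type.
Notation T := (open_triangle p : set (lplane R)).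
Notation freq := (int * int)%type.
Let D0 := tri_det_neq0 p_eq.

Definition chi_sum (F : seq freq) (c : freq -> C) (P : plane R) : C :=
  \sum_(x <- F) c x * chi L p x P.

Lemma continuous_chi x : continuous ((fun P => complex.Re (chi L p x P)) : R * R -> R) /\
  continuous ((fun P => complex.Im (chi L p x P)) : R * R -> R).
Proof.
have cp : continuous (phase L p x : R * R -> R).
  have -> : phase L p x = (fun P : R * R => (- ((waven L p x).1 * (vtx0 p).1 + (waven L p x).2 * (vtx0 p).2))
     + (waven L p x).1 * P.1 + (waven L p x).2 * P.2).
    by apply/funext => P; rewrite /phase; ring.
  exact: continuous_affine2.
split=> P.
  by apply: (continuous_comp (f := phase L p x : R * R -> R)); [exact: cp|exact: continuous_cos].
by apply: (continuous_comp (f := phase L p x : R * R -> R)); [exact: cp|exact: continuous_sin].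
Qed.

Lemma continuous_chi_sum F c : continuous ((fun P => complex.Re (chi_sum F c P)) : R * R -> R) /\
  continuous ((fun P => complex.Im (chi_sum F c P)) : R * R -> R).
Proof.
split.
- have -> : (fun P => complex.Re (chi_sum F c P)) = (fun P => \sum_(x <- F)
      (complex.Re (c x) * complex.Re (chi L p x P) - complex.Im (c x) * complex.Im (chi L p x P))).
    by apply/funext => P; rewrite /chi_sum Re_sum; apply: eq_bigr => x _; case: (c x).
  elim: F => [|x F IH] P.
    by rewrite /continuous_at; under eq_fun do rewrite big_nil; rewrite big_nil; exact: cvg_cst.
  rewrite /continuous_at; under eq_fun do rewrite big_cons; rewrite big_cons.
  apply: cvgD; last exact: IH.
  by apply: cvgB; apply: cvgM; (exact: cvg_cst || exact: (continuous_chi x).1 || exact: (continuous_chi x).2).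
- have -> : (fun P => complex.Im (chi_sum F c P)) = (fun P => \sum_(x <- F)
      (complex.Re (c x) * complex.Im (chi L p x P) + complex.Im (c x) * complex.Re (chi L p x P))).
    by apply/funext => P; rewrite /chi_sum Im_sum; apply: eq_bigr => x _; case: (c x).
  elim: F => [|x F IH] P.
    by rewrite /continuous_at; under eq_fun do rewrite big_nil; rewrite big_nil; exact: cvg_cst.
  rewrite /continuous_at; under eq_fun do rewrite big_cons; rewrite big_cons.
  apply: cvgD; last exact: IH.
  by apply: cvgD; apply: cvgM; (exact: cvg_cst || exact: (continuous_chi x).1 || exact: (continuous_chi x).2).
Qed.

(* Along the lines [r = cst] of the affine chart below the frequencies become
   the integers [j - m k], which are pairwise distinct when [m] is large. *)
Lemma chi_sum_null F c x0 : uniq F -> x0 \in F -> c x0 != 0 ->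
  area R (T `&` [set P | chi_sum F c P = 0]) = 0%E.
Proof.
move=> uF x0F c0; pose B := \max_(x <- F) `|x.1|%N; pose m := (B + B).+1.
have FB x : x \in F -> (`|x.1| <= B)%N by move=> xF; rewrite /B (big_rem x xF) /= leq_maxl.
pose e (x : freq) : int := x.1 - m%:Z * x.2.
have inj_e : {in F &, injective e}.
  move=> [j k] [j' k'] /FB /= h1 /FB /= h2; rewrite /e /= => h.
  have kk : k = k' by rewrite /m in h; nia.
  by move: h; rewrite kk => /addIr ->.
pose Z : set (R * R) := T `&` [set P | chi_sum F c P = 0].
have mZ : measurable (Z : set M).
  have [cr ci] := continuous_chi_sum F c.
  have mr := continuous_measurable2 cr measurableT (measurable_set1 (0 : R)).
  have mi := continuous_measurable2 ci measurableT (measurable_set1 (0 : R)).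
  have mTb : measurable (open_triangle p : set M).
    by apply: open_measurable2; exact: open_open_triangle.
  have := measurableI _ _ mTb (measurableI _ _ mr mi); congr measurable; rewrite !setTI.
  apply/seteqP; split => P /=.
    by move=> [TP [h1 h2]]; split=> //=; apply/eqP; rewrite eq_complex /= h1 h2 !eqxx.
  by move=> [TP h]; split => //; rewrite h.
rewrite area_borel//.
pose v1 : R * R := ((vtx1 p).1 - (vtx0 p).1, (vtx1 p).2 - (vtx0 p).2).
pose v2 : R * R := ((vtx2 p).1 - (vtx0 p).1, (vtx2 p).2 - (vtx0 p).2).
pose mr : R := m%:R.
(* In affine coordinates the lines have direction [(m + 2, - (2 * m + 1))], chosen because the phase
   of [(j, k)] then grows by [2 * pi * (j - m * k)] per unit of the parameter. *)
pose b := v1.1 * (mr + 2) - v2.1 * (2 * mr + 1); pose d := v1.2 * (mr + 2) - v2.2 * (2 * mr + 1).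
have m0 : 0 < mr by rewrite ltr0n.
have det0 : v2.1 * d - b * v2.2 != 0.
  have -> : v2.1 * d - b * v2.2 = - (mr + 2) * tri_det p by rewrite /tri_det /b /d /v1 /v2 /=; ring.
  by rewrite mulf_neq0// oppr_eq0 gt_eqF//; lra.
have := @borel_area_affine R (vtx0 p).1 v2.1 b (vtx0 p).2 v2.2 d Z det0 mZ.
set G := fun _ => _; have GE a : G a = tri_map p ((mr + 2) * a.2, a.1 - (2 * mr + 1) * a.2).
  by rewrite /G /tri_map /b /d /v1 /v2 /=; congr (_, _); ring.
have -> : borel_area R (G @^-1` Z) = 0%E.
  rewrite /borel_area /product_measure1; apply: integral0_eq => r _ /=.
  apply: countable_lebesgue_measure0; apply: finite_set_countable.
  have := @finite_trig_zeros R _ F e (fun x => c x * cis (2 * pi / 3 * (x.1 + 2 * x.2)%:~R * r)) x0 uF inj_e x0F.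
  have cn : cis (2 * pi / 3 * (x0.1 + 2 * x0.2)%:~R * r) != 0 :> C.
    by apply/eqP => h; have := nsq_cis (2 * pi / 3 * (x0.1 + 2 * x0.2)%:~R * r : R); rewrite h /nsq /=; lra.
  move=> /(_ (mulf_neq0 c0 cn)); apply: sub_finite_set => t.
  move=> /set_mem h; have {h} : Z (G (r, t)) by [].
  rewrite GE => -[Tt ft]; have : (tri_map p @^-1` open_triangle p) ((mr + 2) * t, r - (2 * mr + 1) * t) by exact: Tt.
  rewrite (open_triangle_map D0) => -[/= h1 h2 h3]; split.
    apply/andP; split; first by rewrite -(pmulr_rgt0 _ (_ : 0 < mr + 2))//; lra.
    have m3 : 1 <= mr by rewrite ler1n.
    nra.
  rewrite -[RHS]ft /chi_sum; apply: eq_bigr => x _; rewrite -mulrA -cisD; congr (_ * _).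
  rewrite /chi phase_map//=; congr cis; rewrite /e !rmorphB !rmorphD !rmorphM /= -/mr.
  by field.
by move=> /esym/eqP; rewrite mule_eq0 eqe invr_eq0 normr_eq0 (negbTE det0)/= => /eqP.
Qed.

End chi_null.

(** * Quantitative linear independence of finite families *)

Section lower_bound.
Context {R : realType}.
Notation C := R[i].
Variables (V : lmodType C) (S : V -> Prop) (B : V -> V -> C).
Hypothesis HB : herm_form S B.
Local Notation sq u := (complex.Re (B u u)).

Lemma herm_orthoD (u v : V) : S u -> S v -> B u v = 0 -> sq (u + v) = sq u + sq v.
Proof.
move=> Su Sv uv; have Svu : B v u = 0 by rewrite (hermC HB Su Sv) uv conjC0.
have SD := hermD HB Su Sv.
rewrite (hermDl HB Su Sv SD) (hermC HB SD Su) (hermC HB SD Sv).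
rewrite !(hermDl HB Su Sv) // uv Svu addr0 add0r -!(hermC HB) //.
by rewrite ReD.
Qed.

(** One Gram-Schmidt step at a time: the component along [e y] is removed from the other vectors,
    the induction hypothesis applies to what remains, and the square splits orthogonally. *)
Lemma herm_lower_bound (I : eqType) (F : seq I) (e : I -> V) : uniq F ->
  (forall x, S (e x)) ->
  (forall c : I -> C, (exists2 x, x \in F & c x != 0) -> 0 < sq (\sum_(x <- F) c x *: e x)) ->
  exists2 k : R, 0 < k & forall c : I -> C,
    k * \sum_(x <- F) nsq (c x) <= sq (\sum_(x <- F) c x *: e x).
Proof.
elim: F e => [|y F IH] e /=.
  move=> _ _ _; exists 1 => // c; rewrite !big_nil mulr0; apply: (herm_ge0 HB); exact: (herm0 HB).
move=> /andP[yF uF] Se pos; pose n0 := sq (e y).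
have neq x : x \in F -> (x == y) = false by move=> xF; apply: contraNF yF => /eqP <-.
have n0_gt0 : 0 < n0.
  have := pos (fun x => (x == y)%:R); rewrite big_cons eqxx scale1r big_seq_cond big1 ?addr0; last first.
    by move=> x; rewrite andbT => xF; rewrite neq// scale0r.
  by apply; exists y; rewrite ?mem_head// eqxx oner_neq0.
have ByE : B (e y) (e y) = n0%:C.
  have := hermC HB (Se y) (Se y); rewrite /n0; case: (B (e y) (e y)) => a b [bb].
  by congr (Complex _ _); lra.
pose al x := n0^-1%:C * B (e x) (e y).
pose e' x := e x - al x *: e y.
have Se' x : S (e' x) by apply: (herm_closedB HB) => //; exact: (hermZ HB).
have ort x : B (e' x) (e y) = 0.
  rewrite (hermBl HB (Se x) (hermZ HB _ (Se y)) (Se y)) (hermZl HB _ (Se y) (Se y)) ByE /al.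
  by rewrite mulrAC -rmorphM /= mulVf ?gt_eqF// mul1r subrr.
have split_sum (c : I -> C) : \sum_(x <- y :: F) c x *: e x =
    \sum_(x <- F) c x *: e' x + (c y + \sum_(x <- F) c x * al x) *: e y.
  rewrite big_cons scalerDl addrCA; congr (_ + _); rewrite scaler_suml -big_split /=.
  by apply: eq_bigr => x _; rewrite /e' scalerBr scalerA subrK.
have [|k k0 hk] := IH e' uF Se'.
  (* The coefficient at [y] is chosen to cancel the component along [e y], so positivity for the old
     family passes to the reduced one. *)
  move=> c [x xF cx]; pose c' z := if z == y then - \sum_(x <- F) c x * al x else c z.
  have eqF (G : I -> C -> V) : \sum_(x <- F) G x (c' x) = \sum_(x <- F) G x (c x).
    by apply: eq_big_seq => z zF; rewrite /c' neq.
  have eqC : \sum_(x <- F) c' x * al x = \sum_(x <- F) c x * al x.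
    by apply: eq_big_seq => z zF; rewrite /c' neq.
  have c'y : c' y = - \sum_(x <- F) c x * al x by rewrite /c' eqxx.
  have := pos c'; rewrite split_sum eqC c'y addNr scale0r addr0.
  rewrite (eqF (fun x z => z *: e' x)); apply; exists x; first by rewrite inE xF orbT.
  by rewrite /c' neq.
pose D := 2 * (2 ^+ size F * \sum_(x <- F) nsq (al x)).
have D0 : 0 <= D.
  by rewrite !mulr_ge0 ?exprn_ge0//; apply: sumr_ge0 => x _; exact: nsq_ge0.
(* The coefficient [c y] differs from the orthogonal one [c0] by a combination of the others, so
   that [nsq (c y) <= 2 * nsq c0 + D * X]; the two terms of the minimum balance the two parts. *)
exists (Num.min (n0 / 2) (k / (D + 1))).
  by rewrite lt_min !divr_gt0//; lra.
move=> c; set m := Num.min _ _.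
have m1 : m * 2 <= n0 by rewrite -ler_pdivlMr// /m ge_min lexx.
have m2 : m * (D + 1) <= k by rewrite -ler_pdivlMr ?/m ?ge_min ?lexx ?orbT//; lra.
have m0 : 0 <= m by rewrite /m le_min !divr_ge0//; lra.
have Sw : S (\sum_(x <- F) c x *: e' x) by exact: (herm_closed_sum HB).
set c0 := c y + \sum_(x <- F) c x * al x.
rewrite split_sum -/c0 (herm_orthoD Sw (hermZ HB _ (Se y))); last first.
  rewrite (hermC HB (hermZ HB _ (Se y)) Sw) (hermZl HB _ (Se y) Sw) (hermC HB Sw (Se y)).
  rewrite (herm_suml HB _ _ Se' (Se y)) big1 ?conjC0 ?mulr0 ?conjC0// => x _.
  by rewrite ort mulr0.
have -> : sq (c0 *: e y) = nsq c0 * n0.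
  rewrite (hermZl HB _ (Se y) (hermZ HB _ (Se y))) (hermC HB (hermZ HB _ (Se y)) (Se y)).
  rewrite (hermZl HB _ (Se y) (Se y)) conjcM mulrA Re_mulconj ByE.
  by rewrite /= oppr0 mulr0 subr0.
have hw := hk c; rewrite big_cons; set X := \sum_(x <- F) nsq (c x) in hw *.
have X0 : 0 <= X by apply: sumr_ge0 => x _; exact: nsq_ge0.
have cy : nsq (c y) <= 2 * nsq c0 + D * X.
  have -> : c y = c0 + - \sum_(x <- F) c x * al x by rewrite /c0 addrK.
  apply: le_trans (nsqD_le _ _) _; rewrite nsqN lerD2l /D -mulrA ler_pM2l//.
  apply: le_trans (nsq_sum_le _ _) _; rewrite -mulrA ler_pM2l ?exprn_gt0//.
  rewrite mulr_sumr big_seq [leRHS]big_seq; apply: ler_sum => x xF.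
  rewrite nsqM mulrC ler_wpM2r ?nsq_ge0// (big_rem x xF)/= lerDl.
  by apply: sumr_ge0 => z _; exact: nsq_ge0.
have := nsq_ge0 c0; nra.
Qed.

End lower_bound.

(** * Fourier coefficients of the observed set *)

Section observation.
Context {R : realType}.
Variables (L : R) (p : 'I_3 -> plane R).
Hypothesis p_eq : equilateral L p.
Variable V : set (lplane R).
Hypothesis mV : measurable V.
Notation C := R[i].
Notation T := (open_triangle p : set (lplane R)).
Hypothesis VT : V `<=` T.
Hypothesis V_pos : (0 < area R V)%E.
Notation Phi := (phi L p).
Notation NV := (@normL2 _ _ R (area R) V).
Notation NT := (@normL2 _ _ R (area R) T).
Notation ipV := (@ip _ _ R (area R) V).
Notation freq := (int * int)%type.

Let D0 := tri_det_neq0 p_eq.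
Let mT := measurable_triangle D0.
Let HV := @L2_hermitian _ _ R (area R) V mV.

Let V_fin : (area R V < +oo)%E.
Proof. by apply: le_lt_trans (area_triangle_fin p_eq); apply: le_measure => //; rewrite inE. Qed.

Definition vol : R := fine (area R V).

Lemma vol_gt0 : 0 < vol.
Proof. by rewrite /vol fine_gt0// V_pos. Qed.

Lemma L2_restrict (f : plane R -> C) : L2 (area R) T f -> L2 (area R) V f /\ NV f <= NT f.
Proof.
move=> Lf; have [mr mi fin] := Lf.
have le : (sqnorm (area R) V f <= sqnorm (area R) T f)%E.
  apply: (ge0_subset_integral _ mV mT _ _ VT).
    apply/measurable_EFinP; exact: (measurable_nsq mr mi).
  by move=> P _; rewrite lee_fin; exact: nsq_ge0.
have LV : L2 (area R) V f.
  split; [exact: measurable_funS mr|exact: measurable_funS mi|exact: le_lt_trans le fin].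
by split=> //; move: le; rewrite (sqnorm_fin LV) (sqnorm_fin Lf) lee_fin.
Qed.

Lemma chi_L2 x : L2 (area R) V (chi L p x).
Proof.
by have [cr ci] := continuous_chi L p x; have [] := L2_restrict (continuous_L2 p_eq cr ci).
Qed.

(** A vanishing norm would make the sum zero almost everywhere on [V], and [V] would be covered by
    two null sets, one of them the zero set of a nontrivial trigonometric sum. *)
Lemma chi_sum_gt0 (F : seq freq) c : uniq F -> (exists2 x, x \in F & c x != 0) ->
  0 < NV (chi_sum L p F c).
Proof.
move=> uF [x xF cx]; have [cr ci] := continuous_chi_sum L p F c.
have [LV _] := L2_restrict (continuous_L2 p_eq cr ci).
have [mr mi _] := LV; have mn := measurable_nsq mr mi.
rewrite lt_def normL2_ge0 andbT; apply/eqP => N0.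
pose f P := nsq (chi_sum L p F c P).
have mf : measurable_fun V (EFin \o f) by exact/measurable_EFinP.
have f0 : (\int[area R]_(P in V) `|(EFin \o f) P| = 0)%E.
  transitivity (sqnorm (area R) V (chi_sum L p F c)); last by rewrite (sqnorm_fin LV) N0.
  apply: eq_integral => P _.
  by rewrite gee0_abs// lee_fin nsq_ge0.
have [Z [mZ Z0 VZ]] := (ae_eq_integral_abs (area R) mV mf).1 f0.
pose W : set (lplane R) := T `&` [set P | chi_sum L p F c P = 0].
have mW : measurable W.
  have := measurableI _ _ (continuous_lplane_measurable cr mT mT (measurable_set1 (0 : R)))
    (continuous_lplane_measurable ci mT mT (measurable_set1 (0 : R))).
  congr measurable; apply/seteqP; split => P /=.
    by move=> [[TP h1] [_ h2]]; split=> //=; apply/eqP; rewrite eq_complex /= h1 h2 !eqxx.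
  by move=> [TP h]; rewrite h.
have W0 : area R W = 0%E by exact: (chi_sum_null p_eq uF xF cx).
have VZW : V `<=` Z `|` W.
  move=> P VP; have [fP|fP] := eqVneq (chi_sum L p F c P) 0.
    by right; split => //; exact: VT.
  left; apply: VZ => /= h; move/negP: fP; apply.
  by apply/eqP; apply: nsq_eq0; case: (h VP).
have : (area R V <= area R Z + area R W)%E.
  apply: le_trans (measureU2 (area R) mZ mW).
  by apply: le_measure; rewrite ?inE//; exact: measurableU.
by rewrite Z0 W0 adde0 leNgt V_pos.
Qed.

Lemma chi_sumE (F : seq freq) (c : freq -> C) :
  \sum_(x <- F) c x *: (chi L p x : plane R -> C^o) = chi_sum L p F c.
Proof.
apply/funext => P; rewrite /chi_sum; elim: F => [|x F IH]; first by rewrite !big_nil.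
by rewrite !big_cons -IH.
Qed.

Lemma chi_lower_bound (F : seq freq) : uniq F ->
  exists2 k : R, 0 < k & forall c : freq -> C,
    k * \sum_(x <- F) nsq (c x) <= NV (chi_sum L p F c).
Proof.
move=> uF; have [c hc|k k0 hk] := herm_lower_bound HV uF chi_L2.
  by rewrite chi_sumE ip_self; exact: chi_sum_gt0.
by exists k => // c; have := hk c; rewrite chi_sumE ip_self.
Qed.

Lemma ip_chi x : ipV (chi L p x) (chi L p x) = vol%:C.
Proof.
rewrite ip_self /normL2 /sqnorm; congr (_%:C).
under eq_integral do rewrite -[X in X%:E]/(nsq _) nsq_cis.
by have := integral_cst (area R) mV 1%E; rewrite mul1e => ->.
Qed.

Definition vchi (x : freq) : C := Cintegral (area R) V (chi L p x).

Lemma chi_integrable x : Cintegrable (area R) V (chi L p x).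
Proof.
have := L2M_integrable mV (chi_L2 x) (chi_L2 (0, 0)).
by apply: eq_Cintegrable => P; rewrite /chi phase0 cis0 conjC1 mulr1.
Qed.

Lemma vchi_ip x : ipV (chi L p x) (chi L p (0, 0)) = vchi x.
Proof. by apply: eq_Cintegral => P _; rewrite /chi phase0 cis0 conjC1 mulr1. Qed.

(** The strict case of Cauchy-Schwarz: [chi x] and the constant 1 are independent on [V], so the
    residue of projecting one on the other has positive norm. *)
Lemma vchi_lt x : x != (0, 0) -> nsq (vchi x) < vol ^+ 2.
Proof.
move=> x0; have v0 := vol_gt0.
pose F : seq freq := [:: (0, 0)]; pose w := \sum_(y <- F) (vol^-1%:C * ipV (chi L p x) (chi L p y)) *: (chi L p y : plane R -> C^o).
have Bw y : y \in F -> ipV w (chi L p y) = vol%:C * (vol^-1%:C * ipV (chi L p x) (chi L p y)).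
  rewrite inE => /eqP ->; rewrite /w big_seq1 (hermZl HV _ (chi_L2 _) (chi_L2 _)) ip_chi.
  by rewrite mulrC.
have := @herm_proj_dist _ _ _ _ HV _ F (chi L p) (fun=> vol) (chi L p x) chi_L2 (chi_L2 x) Bw.
rewrite -/w (ip_self (area R) V (chi L p x - w)) ip_chi big_seq1 vchi_ip => h.
have {}h : NV (chi L p x - w) = vol - nsq (vchi x) / vol by exact: h.
have : 0 < vol - nsq (vchi x) / vol.
  rewrite -h; pose c (y : freq) : C := if y == x then 1 else - (vol^-1%:C * vchi x).
  have := @chi_sum_gt0 [:: x; (0, 0)] c.
  rewrite /= inE x0 /= => /(_ isT) hpos.
  have : 0 < NV (chi_sum L p [:: x; (0, 0)] c).
    by apply: hpos; exists x; rewrite ?mem_head// /c eqxx oner_neq0.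
  congr (_ < NV _); apply/funext => P.
  rewrite /chi_sum !big_cons big_nil addr0 /c eqxx mul1r eq_sym (negbTE x0) mulNr.
  by rewrite /w big_seq1 vchi_ip.
by rewrite subr_gt0 ltr_pdivrMr// expr2.
Qed.

Definition vphi (x : freq) : C := Cintegral (area R) V (Phi x).

Lemma vphiE x : vphi x = \sum_(g < 6) vchi (wact g x).
Proof. by rewrite -Cintegral_sum// => g; exact: chi_integrable. Qed.

Lemma vphi0 : vphi (0, 0) = (6 * vol)%:C.
Proof.
rewrite vphiE; under eq_bigr do rewrite wact0 -vchi_ip ip_chi.
by rewrite sumr_const card_ord -(rmorphMn (real_complex R)) /= mulr_natl.
Qed.

Lemma sqr_sum_le n (x : 'I_n -> R) : (\sum_i x i) ^+ 2 <= n%:R * \sum_i x i ^+ 2.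
Proof.
elim: n x => [|n IH] x; first by rewrite !big_ord0 expr0n/= mul0r.
rewrite !big_ord_recl; have := IH (fun i => x (lift ord0 i)).
set S := \sum_i x _; set U := \sum_i _ ^+ 2; set a := x ord0 => h.
case: n x IH @S @U @a h => [|n] x IH S U a h; first by rewrite /S /U !big_ord0 !addr0 mul1r.
have n0 : 0 < n.+1%:R :> R by rewrite ltr0n.
rewrite -(natr1 n.+1); move: (n.+1%:R) n0 h => m m0 h.
rewrite -subr_ge0 -(pmulr_rge0 _ m0).
have -> : m * ((m + 1) * (a ^+ 2 + U) - (a + S) ^+ 2) = (m * a - S) ^+ 2 + (m + 1) * (m * U - S ^+ 2) by ring.
by rewrite addr_ge0 ?sqr_ge0// mulr_ge0 ?subr_ge0//; lra.
Qed.

Lemma vphi_lt x : x != (0, 0) -> nsq (vphi x) < (6 * vol) ^+ 2.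
Proof.
move=> x0; apply: (@le_lt_trans _ _ (6 * \sum_(g < 6) nsq (vchi (wact g x)))).
  rewrite vphiE /nsq Re_sum Im_sum big_split mulrDr.
  by apply: lerD; exact: sqr_sum_le.
have -> : (6 * vol) ^+ 2 = 6 * \sum_(g < 6) vol ^+ 2.
  by rewrite sumr_const card_ord -mulr_natl; ring.
have key g : nsq (vchi (wact g x)) < vol ^+ 2.
  apply: vchi_lt; apply: contra x0 => /eqP gx.
  by apply/eqP; apply: (@wact_inj g); rewrite gx wact0.
rewrite ltr_pM2l// big_ord_recl [ltRHS]big_ord_recl ltr_leD//.
by apply: ler_sum => g _; apply: ltW.
Qed.

Let LI : L2 (area R) T (fun P => (\1_V P : R)%:C) := indic_L2 p_eq mV.

Lemma nsq_coef_indic x : nsq (coef L p (fun P => (\1_V P : R)%:C) x) = nsq (vphi x).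
Proof.
have HT := @L2_hermitian _ _ R (area R) T mT.
rewrite /coef (hermC HT (phi_L2 p_eq x) LI) nsq_conj; congr nsq.
rewrite /ip /vphi /Cintegral /Rintegral.
have key (f g : plane R -> R) : (forall P, g P = f P * \1_V P) ->
    (\int[area R]_(P in T) (g P)%:E = \int[area R]_(P in V) (f P)%:E)%E.
  move=> fg; rewrite -[in RHS](setIidr VT) integral_mkcondr; apply: eq_integral => P _.
  by rewrite fg /patch indicE; case: (P \in V); rewrite ?mulr1 ?mulr0.
by congr (Complex (fine _) (fine _)); apply: key => P; case: (Phi x P) => a b /=; ring.
Qed.

Lemma sum_vphi_bounded n : \sum_(x <- freqs n) nsq (vphi x) <= 36 * tri_area p * NT (fun P => (\1_V P : R)%:C).
Proof.
have := bessel p_eq (freqs_uniq n) (@freqs_wact n) LI.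
have a0 : 0 < 36 * tri_area p by rewrite mulr_gt0// (tri_area_gt0 p_eq).
rewrite -mulr_suml ler_pdivrMr// mulrC; apply: le_trans.
by apply: ler_sum => x _; rewrite nsq_coef_indic.
Qed.

Lemma vphi_tail (e : R) : 0 < e -> exists K : nat, forall n : nat,
  \sum_(x <- freqs n | K%:Z < freq_norm x) nsq (vphi x) <= e.
Proof.
move=> e0; pose E := range (fun n : nat => \sum_(x <- freqs n) nsq (vphi x)).
have hE : has_sup E.
  split; first by exists (\sum_(x <- freqs 0) nsq (vphi x)), 0%N.
  by exists (36 * tri_area p * NT (fun P => (\1_V P : R)%:C)) => _ [n _ <-]; exact: sum_vphi_bounded.
have [_ [K _ <-] hK] := sup_adherent e0 hE; exists K => n.
have : \sum_(x <- [seq x <- freqs n | K%:Z < freq_norm x] ++ freqs K) nsq (vphi x)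
    <= \sum_(x <- freqs (n + K)) nsq (vphi x).
  apply: sum_subset_le; [|exact: freqs_uniq| |by move=> x; exact: nsq_ge0].
    rewrite cat_uniq filter_uniq ?freqs_uniq//= andbT; apply/hasPn => x.
    by rewrite mem_freqs => h; rewrite mem_filter negb_and -leNgt h.
  move=> x; rewrite mem_cat => /orP[|]; last by rewrite !mem_freqs; lia.
  by rewrite mem_filter => /andP[_]; rewrite !mem_freqs; lia.
have : \sum_(x <- freqs (n + K)) nsq (vphi x) <= sup E by apply: ub_le_sup; [exact: hE.2|exists (n + K)%N].
rewrite big_cat /= big_filter; lra.
Qed.

(** Strict inequality for each frequency does not give a uniform gap. The tail of the convergent
    series puts all but finitely many coefficients below the arbitrary value [3 * vol], and a
    maximum takes care of the others. *)
Lemma vphi_gap : exists eta : R, [/\ 0 <= eta, eta < 6 * vol &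
  forall x, x != (0, 0) -> nsq (vphi x) <= eta ^+ 2].
Proof.
have v0 := vol_gt0; have e0 : 0 < (3 * vol) ^+ 2 by rewrite exprn_gt0// mulr_gt0.
have [K hK] := vphi_tail e0.
have far x : K%:Z < freq_norm x -> nsq (vphi x) <= (3 * vol) ^+ 2.
  move=> Kx; apply: le_trans (hK `|freq_norm x|%N).
  have xF : x \in freqs `|freq_norm x|%N by rewrite mem_freqs; have := freq_norm_ge0 x; lia.
  rewrite (big_rem x xF)/= Kx lerDl; apply: sumr_ge0 => y _; exact: nsq_ge0.
have fin (s : seq freq) : exists M : R, [/\ (3 * vol) ^+ 2 <= M, M < (6 * vol) ^+ 2 &
    forall x, x \in s -> x != (0, 0) -> nsq (vphi x) <= M].
  elim: s => [|y s [M [M0 M1 hM]]]; first by exists ((3 * vol) ^+ 2); split=> //; nra.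
  have [->|y0] := eqVneq y (0, 0).
    by exists M; split => // x; rewrite inE => /orP[/eqP ->|]; [rewrite eqxx|exact: hM].
  exists (Num.max M (nsq (vphi y))); split.
  - by rewrite le_max M0.
  - by rewrite gt_max M1 vphi_lt.
  - by move=> x; rewrite inE le_max => /orP[/eqP -> _|xs x0]; rewrite ?lexx ?orbT// hM.
have [M [M0 M1 hM]] := fin (freqs K).
have M0' : 0 <= M by apply: le_trans M0; exact: sqr_ge0.
exists (Num.sqrt M); split; first exact: sqrtr_ge0.
  by rewrite -(@ltr_pXn2r _ 2) ?nnegrE ?sqrtr_ge0 ?mulr_ge0 ?ltW// sqr_sqrtr.
move=> x x0; rewrite sqr_sqrtr//; have [Kx|xK] := ltP K%:Z (freq_norm x).
  by apply: le_trans M0; exact: far.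
by apply: hM; rewrite ?mem_freqs.
Qed.

End observation.

Section real_bounds.
Context {R : realType}.
Notation C := R[i].

Lemma Re_mul_ge (z w : C) (s : R) : 0 < s ->
  - (s * nsq z + nsq w / s) / 2 <= complex.Re (z * w).
Proof.
move=> s0; case: z w => [a b] [c d]; rewrite /nsq /= -subr_ge0.
have -> : a * c - b * d - - (s * (a ^+ 2 + b ^+ 2) + (c ^+ 2 + d ^+ 2) / s) / 2 =
  ((s * a + c) ^+ 2 + (s * b - d) ^+ 2) / (2 * s) by field; rewrite gt_eqF.
by rewrite divr_ge0 ?addr_ge0 ?sqr_ge0 ?mulr_ge0 ?ltW.
Qed.

Lemma Re_mul3_ge (z w v : C) (eta : R) : 0 <= eta -> nsq v <= eta ^+ 2 ->
  - (eta * (nsq z + nsq w) / 2) <= complex.Re (z * w^* * v).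
Proof.
move=> e0 ve; set Y := z * w^* * v.
have z0 := nsq_ge0 z; have w0 := nsq_ge0 w.
have Y2 : complex.Re Y ^+ 2 <= (eta * (nsq z + nsq w) / 2) ^+ 2.
  apply: (@le_trans _ _ (nsq Y)); first by rewrite lerDl sqr_ge0.
  rewrite !nsqM nsq_conj; apply: (@le_trans _ _ (nsq z * nsq w * eta ^+ 2)).
    by rewrite ler_wpM2l// mulr_ge0.
  rewrite -subr_ge0.
  have -> : (eta * (nsq z + nsq w) / 2) ^+ 2 - nsq z * nsq w * eta ^+ 2 =
    (eta * (nsq z - nsq w) / 2) ^+ 2 by field.
  exact: sqr_ge0.
have h0 : 0 <= eta * (nsq z + nsq w) / 2 by rewrite divr_ge0// mulr_ge0// addr_ge0.
suff : `|complex.Re Y| <= eta * (nsq z + nsq w) / 2 by rewrite ler_norml => /andP[].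
by rewrite -(@ler_pXn2r _ 2) ?nnegrE// real_normK ?num_real.
Qed.

Lemma sum_indic (I : Type) (F : seq I) (b : pred I) (g : R) :
  \sum_(x <- F | b x) g = (size [seq x <- F | b x])%:R * g.
Proof. by rewrite -big_filter big_const_seq count_predT iter_addr_0 mulr_natl. Qed.

End real_bounds.

(** * Zygmund's inequality on the circles of the lattice *)

Section zygmund.
Context {R : realType}.
Variables (L : R) (p : 'I_3 -> plane R).
Hypothesis p_eq : equilateral L p.
Variable V : set (lplane R).
Hypothesis mV : measurable V.
Notation C := R[i].
Notation T := (open_triangle p : set (lplane R)).
Hypothesis VT : V `<=` T.
Hypothesis V_pos : (0 < area R V)%E.
Notation Phi := (phi L p).
Notation NV := (@normL2 _ _ R (area R) V).
Notation NT := (@normL2 _ _ R (area R) T).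
Notation ipV := (@ip _ _ R (area R) V).
Notation freq := (int * int)%type.
Notation v := (vphi L p V).
Notation mu := (vol V).
Let HV := @L2_hermitian _ _ R (area R) V mV.

Let phi_L2V x : L2 (area R) V (Phi x).
Proof. by have [] := L2_restrict p_eq mV VT (phi_L2 p_eq x). Qed.

Lemma fsub_norm_le x y : freq_norm (fsub x y) <= 2 * freq_norm x + 2 * freq_norm y.
Proof.
have := freq_norm_ge0 (x.1 + y.1, x.2 + y.2).
by case: x y => [a b] [c d]; rewrite /freq_norm /fsub /=; nia.
Qed.

(** Pairing two orbit sums produces six translates of the second frequency. Invariance of [c] and of
    the shell makes the six sums equal, which leaves a quadratic form in the Fourier coefficients of
    [V]. *)
Lemma combo_quadratic q c : (forall g m, c (wact g m) = c m) ->
  NV (combo L p (shell q) c) =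
  6 * \sum_(x <- shell q) \sum_(y <- shell q) complex.Re (c x * (c y)^* * v (fsub x y)).
Proof.
move=> cw; have Sw : L2 (area R) V (combo L p (shell q) c) by exact: (herm_closed_sum HV).
have ipE x y : ipV (Phi x) (Phi y) = \sum_(h < 6) v (fsub x (wact h y)).
  transitivity (Cintegral (area R) V (fun P => \sum_(h < 6) Phi (fsub x (wact h y)) P)).
    by apply: eq_Cintegral => P _; exact: phi_mul_conj.
  rewrite Cintegral_sum// => h.
  have := L2M_integrable mV (phi_L2V (fsub x (wact h y))) (chi_L2 p_eq mV VT (0, 0)).
  by apply: eq_Cintegrable => P; rewrite /chi phase0 cis0 conjC1 mulr1.
have key : ipV (combo L p (shell q) c) (combo L p (shell q) c) =
    6%:R%:C * \sum_(x <- shell q) \sum_(y <- shell q) (c x * (c y)^* * v (fsub x y)).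
  rewrite {1}/combo (herm_suml HV _ _ phi_L2V Sw) mulr_sumr; apply: eq_bigr => x _.
  rewrite /combo (herm_sumr HV _ _ phi_L2V (phi_L2V x)).
  transitivity (\sum_(h < 6) \sum_(y <- shell q) c x * (c y)^* * v (fsub x (wact h y))).
    rewrite mulr_sumr exchange_big /=; apply: eq_bigr => y _.
    by rewrite ipE mulrA mulr_sumr.
  transitivity (\sum_(h < 6) \sum_(y <- shell q) c x * (c y)^* * v (fsub x y)).
    apply: eq_bigr => h _; rewrite -[RHS](sum_wact_seq _ h (shell_uniq q) (@shell_wact q)).
    by apply: eq_bigr => y _; rewrite cw.
  by rewrite sumr_const card_ord -[LHS]mulr_natl rmorph_nat.
have := ip_self (area R) V (combo L p (shell q) c); rewrite key => /(congr1 (@complex.Re _)) /= <-.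
rewrite Re_realM; congr (_ * _).
by rewrite Re_sum; apply: eq_bigr => x _; rewrite Re_sum.
Qed.

Lemma far_sum K q (e : R) : (forall n : nat, \sum_(x <- freqs n | K%:Z < freq_norm x) nsq (v x) <= e) ->
  \sum_(x <- shell q) \sum_(y <- shell q)
    (if K%:Z < freq_norm (fsub x y) then nsq (v (fsub x y)) else 0) <= 2 * e.
Proof.
(* Differences of two points of the circle have norm at most [2 * q + 2 * q]. *)
move=> hK; pose n := (4 * q)%N.
have E x y : x \in shell q -> y \in shell q ->
  (if K%:Z < freq_norm (fsub x y) then nsq (v (fsub x y)) else 0) =
  \sum_(z <- freqs n | K%:Z < freq_norm z) nsq (v z) * (z == fsub x y)%:R.
  rewrite !mem_shell => /eqP xq /eqP yq.
  have zF : fsub x y \in freqs n by rewrite mem_freqs; have := fsub_norm_le x y; lia.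
  rewrite (big_rem _ zF) /= eqxx mulr1 big_seq_cond big1 ?addr0; first by case: ifP => // _; rewrite addr0.
  move=> z /andP[+ _]; rewrite mem_rem_uniq ?freqs_uniq// inE => /andP[/negbTE -> _].
  by rewrite mulr0.
have -> : \sum_(x <- shell q) \sum_(y <- shell q)
    (if K%:Z < freq_norm (fsub x y) then nsq (v (fsub x y)) else 0) =
  \sum_(z <- freqs n | K%:Z < freq_norm z) \sum_(x <- shell q) \sum_(y <- shell q)
    nsq (v z) * (z == fsub x y)%:R.
  rewrite [RHS]exchange_big /=; apply: eq_big_seq => x xF.
  by rewrite [RHS]exchange_big /=; apply: eq_big_seq => y yF; exact: E.
apply: (@le_trans _ _ (\sum_(z <- freqs n | K%:Z < freq_norm z) 2 * nsq (v z))).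
  apply: ler_sum => z Kz; under eq_bigr do rewrite -mulr_sumr.
  rewrite -mulr_sumr mulrC ler_wpM2r ?nsq_ge0//.
  have z0 : z != (0, 0) by apply/eqP => z0; move: Kz; rewrite z0.
  apply: (@le_trans _ _ (\sum_(x <- shell q | fsub x z \in shell q) 1)).
    rewrite [leRHS]big_mkcond /=; apply: ler_sum => x _.
    have zy y : (z == fsub x y) = (y == fsub x z).
      case: x y z {Kz z0} => [a b] [d f] [g h]; rewrite /fsub /= !xpair_eqE.
      by apply/idP/idP => /andP[/eqP -> /eqP ->]; apply/andP; split; apply/eqP; ring.
    under eq_bigr do rewrite zy; case: ifPn => xz.
      rewrite (big_rem _ xz)/= eqxx big_seq big1 ?addr0// => y.
      by rewrite mem_rem_uniq ?shell_uniq// inE => /andP[/negbTE -> _].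
    rewrite big_seq big1// => y yF; case: eqP => // yE.
    by rewrite yE (negbTE xz) in yF.
  by rewrite sum_indic mulr1 ler_nat; exact: shell_diff_le2.
by rewrite -mulr_sumr ler_pM2l.
Qed.

Lemma near_sum K q (c : freq -> C) : (2 * K ^ 3 < q)%N ->
  \sum_(x <- shell q) \sum_(y <- shell q)
    (if (y != x) && (freq_norm (fsub x y) <= K%:Z) then nsq (c x) else 0)
  <= \sum_(x <- shell q) nsq (c x).
Proof.
move=> Kq; rewrite big_seq [leRHS]big_seq; apply: ler_sum => x xF.
rewrite -big_mkcond /= sum_indic -[leRHS]mul1r ler_wpM2r ?nsq_ge0//.
by rewrite (_ : 1 = 1%:R)// ler_nat; exact: near_le1.
Qed.

Lemma zygmund_large : exists q0 : nat, exists2 k : R, 0 < k &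
  forall q c, (q0 < q)%N -> (forall g m, c (wact g m) = c m) ->
  k * \sum_(x <- shell q) nsq (c x) <= NV (combo L p (shell q) c).
Proof.
have [eta [e0 elt gap]] := vphi_gap p_eq mV VT V_pos.
(* After division by 6, the diagonal gives [6 * mu * N] and the near pairs cost at most [eta * N],
   since each point has at most one near neighbour. The far pairs are allowed [t * N], half of the
   gap, so [delta / 2 * N] survives. *)
pose delta := 6 * mu - eta; have d0 : 0 < delta by rewrite subr_gt0.
pose t := delta / 2; have t0 : 0 < t by rewrite divr_gt0.
have t20 : 0 < t ^+ 2 / 2 by rewrite divr_gt0// exprn_gt0.
have [K hK] := vphi_tail p_eq mV VT V_pos t20.
exists (2 * K ^ 3)%N; exists (3 * delta) => [|q c Kq cw]; first by rewrite mulr_gt0.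
set N := \sum_(x <- shell q) nsq (c x).
have N0 : 0 <= N by apply: sumr_ge0 => x _; exact: nsq_ge0.
have [NE|Nn] := eqVneq N 0; first by rewrite NE mulr0 normL2_ge0.
have Np : 0 < N by rewrite lt_def Nn.
rewrite combo_quadratic// (_ : 3 * delta * N = 6 * (N * (delta / 2))); last by field.
rewrite ler_pM2l//.
pose near x y := (y != x) && (freq_norm (fsub x y) <= K%:Z).
pose nr x y : R := if near x y then nsq (c x) else 0.
pose nr' x y : R := if near y x then nsq (c y) else 0.
pose far x y : R := if K%:Z < freq_norm (fsub x y) then nsq (v (fsub x y)) else 0.
have nearC x y : near x y = near y x.
  rewrite /near eq_sym; congr (_ && (_ <= _)); rewrite /freq_norm /fsub /=; ring.
have term x y : (if x == y then 6 * mu * nsq (c x) else 0) - eta / 2 * (nr x y + nr' x y)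
    - t / 2 * (nsq (c x) * nsq (c y) / N) - N / (2 * t) * far x y
    <= complex.Re (c x * (c y)^* * v (fsub x y)).
  have cx := nsq_ge0 (c x); have cy := nsq_ge0 (c y).
  have s0 : 0 <= t / 2 * (nsq (c x) * nsq (c y) / N) by apply: mulr_ge0; apply: divr_ge0 => //; [exact: ltW|exact: mulr_ge0].
  have f0 : 0 <= N / (2 * t) * far x y.
    apply: mulr_ge0; first by apply: divr_ge0 => //; apply: mulr_ge0 => //; exact: ltW.
    by rewrite /far; case: ifP => // _; exact: nsq_ge0.
  have [xy|xy] := eqVneq x y.
    have nn : nr x y = 0 /\ nr' x y = 0 by rewrite /nr /nr' /near xy eqxx.
    rewrite nn.1 nn.2 addr0 mulr0 subr0 xy (_ : fsub y y = (0, 0)); last by rewrite /fsub !subrr.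
    rewrite vphi0// Re_mulconj -rmorphM /= (mulrC (nsq _)); move: s0 f0; rewrite xy; lra.
  have [nxy|nxy] := boolP (near x y).
    have -> : nr x y = nsq (c x) by rewrite /nr nxy.
    have -> : nr' x y = nsq (c y) by rewrite /nr' (nearC y x) nxy.
    have f1 : fsub x y != (0, 0) by apply: contra xy => /eqP/fsub_eq0 ->.
    by have := Re_mul3_ge (c x) (c y) e0 (gap _ f1); lra.
  have nn : nr x y = 0 /\ nr' x y = 0 by rewrite /nr /nr' (nearC y x) (negbTE nxy).
  rewrite nn.1 nn.2 addr0 mulr0 subr0 sub0r.
  have fK : K%:Z < freq_norm (fsub x y).
    by move: nxy; rewrite /near eq_sym xy /= -ltNge.
  have -> : far x y = nsq (v (fsub x y)) by rewrite /far fK.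
  (* Young's inequality with weight [t / N] makes the product of coefficients and the tail of the
     series each cost at most [t * N / 2]. *)
  have tN : 0 < t / N by rewrite divr_gt0.
  have := @Re_mul_ge _ (c x * (c y)^*) (v (fsub x y)) _ tN; rewrite nsqM nsq_conj.
  apply: le_trans; rewrite le_eqVlt; apply/orP; left; apply/eqP.
  by field; rewrite !gt_eqF.
apply: (@le_trans _ _ (\sum_(x <- shell q) \sum_(y <- shell q)
  ((if x == y then 6 * mu * nsq (c x) else 0) - eta / 2 * (nr x y + nr' x y)
    - t / 2 * (nsq (c x) * nsq (c y) / N) - N / (2 * t) * far x y))); last first.
  by apply: ler_sum => x _; apply: ler_sum => y _; exact: term.
have -> : \sum_(x <- shell q) \sum_(y <- shell q)
  ((if x == y then 6 * mu * nsq (c x) else 0) - eta / 2 * (nr x y + nr' x y)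
    - t / 2 * (nsq (c x) * nsq (c y) / N) - N / (2 * t) * far x y) =
  \sum_(x <- shell q) \sum_(y <- shell q) (if x == y then 6 * mu * nsq (c x) else 0)
  - eta / 2 * (\sum_(x <- shell q) \sum_(y <- shell q) nr x y + \sum_(x <- shell q) \sum_(y <- shell q) nr' x y)
  - t / 2 * \sum_(x <- shell q) \sum_(y <- shell q) (nsq (c x) * nsq (c y) / N)
  - N / (2 * t) * \sum_(x <- shell q) \sum_(y <- shell q) far x y.
  rewrite -big_split /= !mulr_sumr -!sumrB; apply: eq_bigr => x _.
  by rewrite -big_split /= !mulr_sumr -!sumrB; apply: eq_bigr => y _.
have -> : \sum_(x <- shell q) \sum_(y <- shell q) (if x == y then 6 * mu * nsq (c x) else 0) = 6 * mu * N.
  rewrite /N mulr_sumr; apply: eq_big_seq => x xF.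
  rewrite (big_rem _ xF)/= eqxx big_seq big1 ?addr0// => y.
  by rewrite mem_rem_uniq ?shell_uniq// inE eq_sym => /andP[/negbTE -> _].
have -> : \sum_(x <- shell q) \sum_(y <- shell q) (nsq (c x) * nsq (c y) / N) = N.
  under eq_bigr do rewrite -mulr_suml -mulr_sumr.
  by rewrite -/N -!mulr_suml -/N mulfK.
have h1 : \sum_(x <- shell q) \sum_(y <- shell q) nr x y <= N by exact: near_sum.
have h2 : \sum_(x <- shell q) \sum_(y <- shell q) nr' x y <= N by rewrite exchange_big; exact: near_sum.
have h3 := far_sum q hK.
have h4 : N / (2 * t) * \sum_(x <- shell q) \sum_(y <- shell q) far x y <= N / (2 * t) * (2 * (t ^+ 2 / 2)).
  by rewrite ler_wpM2l// divr_ge0// mulr_ge0// ltW.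
have h5 : N / (2 * t) * (2 * (t ^+ 2 / 2)) = N * t / 2 by field; rewrite gt_eqF.
have h6 : eta / 2 * (\sum_(x <- shell q) \sum_(y <- shell q) nr x y + \sum_(x <- shell q) \sum_(y <- shell q) nr' x y)
  <= eta / 2 * (N + N) by rewrite ler_wpM2l ?divr_ge0// lerD.
move: h4 h6; rewrite h5 /t /delta.
set X1 := N / _ * _; set X2 := eta / 2 * (\sum_(x <- _) _ + _); move=> h4 h6; lra.
Qed.

Lemma combo_chi_sum q c : (forall g m, c (wact g m) = c m) ->
  combo L p (shell q) c = chi_sum L p (shell q) (fun x => 6%:R%:C * c x).
Proof.
move=> cw; apply/funext => P; rewrite comboE /chi_sum.
transitivity (\sum_(g < 6) \sum_(x <- shell q) c x * chi L p (wact g x) P).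
  by rewrite exchange_big /=; apply: eq_bigr => x _; rewrite /phi mulr_sumr.
transitivity (\sum_(g < 6) \sum_(x <- shell q) c x * chi L p x P).
  apply: eq_bigr => g _; rewrite -[RHS](sum_wact_seq _ g (shell_uniq q) (@shell_wact q)).
  by apply: eq_bigr => x _; rewrite cw.
rewrite sumr_const card_ord -[LHS]mulr_natl mulr_sumr; apply: eq_bigr => x _.
by rewrite mulrA rmorph_nat.
Qed.

Lemma zygmund_bound : exists2 k : R, 0 < k &
  forall q c, (forall g m, c (wact g m) = c m) ->
  k * NT (combo L p (shell q) c) <= NV (combo L p (shell q) c).
Proof.
have [q0 [k0 k0_gt0 large]] := zygmund_large.
have [k k_gt0 hk] : exists2 k : R, 0 < k & forall (q : nat) c, (forall g m, c (wact g m) = c m) ->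
    k * \sum_(x <- shell q) nsq (c x) <= NV (combo L p (shell q) c).
  have [k1 k1_gt0 small] : exists2 k : R, 0 < k & forall (q : nat) c, (q < q0.+1)%N ->
      (forall g m, c (wact g m) = c m) -> k * \sum_(x <- shell q) nsq (c x) <= NV (combo L p (shell q) c).
    elim: q0.+1 => [|n [k1 k1_gt0 small]]; first by exists 1.
    have [k2 k2_gt0 hk2] := chi_lower_bound p_eq mV VT V_pos (shell_uniq n).
    exists (Num.min k1 k2) => [|q c]; first by rewrite lt_min k1_gt0.
    have s0 : 0 <= \sum_(x <- shell q) nsq (c x) by apply: sumr_ge0 => x _; exact: nsq_ge0.
    rewrite ltnS leq_eqVlt => /orP[/eqP qn|qn] cw; last first.
      by apply: le_trans (small q c qn cw); rewrite ler_wpM2r// ge_min lexx.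
    rewrite combo_chi_sum// qn; apply: le_trans (hk2 _); rewrite -qn.
    apply: (@le_trans _ _ (k2 * \sum_(x <- shell q) nsq (c x))).
      by rewrite ler_wpM2r// ge_min lexx orbT.
    rewrite ler_pM2l//; apply: ler_sum => x _; rewrite nsqM nsq_real.
    by have := nsq_ge0 (c x); nra.
  exists (Num.min k0 k1) => [|q c cw]; first by rewrite lt_min k0_gt0.
  have s0 : 0 <= \sum_(x <- shell q) nsq (c x) by apply: sumr_ge0 => x _; exact: nsq_ge0.
  have [qq|qq] := ltnP q0 q.
    by apply: le_trans (large q c qq cw); rewrite ler_wpM2r// ge_min lexx.
  by apply: le_trans (small q c _ cw); rewrite ?ler_wpM2r ?ge_min ?lexx ?orbT.
have a0 : 0 < 36 * tri_area p by rewrite mulr_gt0// (tri_area_gt0 p_eq).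
exists (k / (36 * tri_area p)) => [|q c cw]; first by rewrite divr_gt0.
rewrite (combo_norm p_eq (shell_uniq q) (@shell_wact q) cw) -mulr_sumr mulrA divfK ?gt_eqF//.
exact: hk.
Qed.

End zygmund.

(** * Robin eigenfunctions *)

Section weak_form.
Context {R : realType}.
Variables (L : R) (p : 'I_3 -> plane R).
Hypothesis p_eq : equilateral L p.
Notation C := R[i].
Notation M := (measurableTypeR R * measurableTypeR R)%type.
Notation T := (open_triangle p : set (lplane R)).
Notation Phi := (phi L p).
Notation NT := (@normL2 _ _ R (area R) T).
Notation ipT := (@ip _ _ R (area R) T).
Notation kap := (kappa L).

Let D0 := tri_det_neq0 p_eq.
Let mT := measurable_triangle D0.
Let HT := @L2_hermitian _ _ R (area R) T mT.

Lemma continuous_tri_integrable (f : plane R -> R) : continuous (f : R * R -> R) ->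
  (area R).-integrable T (EFin \o f).
Proof. exact: (triangle_integrable p_eq). Qed.

(** The field [a * f] times a coordinate vector vanishes on the boundary, hence is trivially tangent
    to the sides, and the divergence lemma applies. *)
Lemma ibp_compact_support (a f : plane R -> R) (i : 'I_2) : Cn 1 a -> Cn 1 f ->
  (forall P, ~ open_triangle p P -> f P = 0) ->
  \int[area R]_(P in T) (a P * partial i f P + partial i a P * f P) = 0.
Proof.
move=> Ca Cf f0.
have cont1 (b : plane R -> R) : Cn 1 b -> continuous (b : R * R -> R) /\
    forall j, continuous (partial j b : R * R -> R).
  by move=> [cb h]; split=> // j; case: (h j) => _ [].
have [ca cda] := cont1 _ Ca; have [cf cdf] := cont1 _ Cf.
rewrite (Rintegral_triangle p_eq); last first.
  by move=> P; apply: cvgD; apply: cvgM; [exact: ca|exact: cdf|exact: cda|exact: cf].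
pose v1 : R * R := ((vtx1 p).1 - (vtx0 p).1, (vtx1 p).2 - (vtx0 p).2).
pose v2 : R * R := ((vtx2 p).1 - (vtx0 p).1, (vtx2 p).2 - (vtx0 p).2).
pose d (b : plane R -> R) (v : R * R) (c : R * R) := v.1 * partial ord0 b (tri_map p c)
  + v.2 * partial ord_max b (tri_map p c).
have cm (b : plane R -> R) : continuous (b : R * R -> R) -> continuous (b \o tri_map p : R * R -> R).
  by move=> cb c; apply: continuous_comp; [exact: continuous_tri_map|exact: cb].
have cd (b : plane R -> R) v : Cn 1 b -> continuous (d b v : R * R -> R).
  move=> /cont1[_ cdb] c; apply: cvgD; apply: cvgM; try exact: cvg_cst.
    by apply: (continuous_comp (g := partial ord0 b)); [exact: continuous_tri_map|exact: cdb].
  by apply: (continuous_comp (g := partial ord_max b)); [exact: continuous_tri_map|exact: cdb].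
have e1 (t r : R) : tri_map p (r, t) =
    ((tri_map p (0, t)).1 + r * v1.1, (tri_map p (0, t)).2 + r * v1.2).
  by rewrite /tri_map /v1 /=; congr (_, _); ring.
have e2 (s r : R) : tri_map p (s, r) =
    ((tri_map p (s, 0)).1 + r * v2.1, (tri_map p (s, 0)).2 + r * v2.2).
  by rewrite /tri_map /v2 /=; congr (_, _); ring.
have D1 (b : plane R -> R) (s t : R) : Cn 1 b ->
    is_derive s 1 (fun s => b (tri_map p (s, t))) (d b v1 (s, t)).
  move=> Cb; have := is_derive_C1 (tri_map p (s, t)) v1 Cb; rewrite -/(d b v1 (s, t)) (e1 t s).
  move/is_derive_plane_line; congr (is_derive _ _ _ _).
  by apply/funext => r; rewrite (e1 t r).
have D2 (b : plane R -> R) (s t : R) : Cn 1 b ->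
    is_derive t 1 (fun t => b (tri_map p (s, t))) (d b v2 (s, t)).
  move=> Cb; have := is_derive_C1 (tri_map p (s, t)) v2 Cb; rewrite -/(d b v2 (s, t)) (e2 s t).
  move/is_derive_plane_line; congr (is_derive _ _ _ _).
  by apply/funext => r; rewrite (e2 s r).
(* The components of the coordinate vector [basis_vec R i] in the basis of the two sides. *)
pose al : R * R := if i == ord0 then (v2.2 / tri_det p, - v1.2 / tri_det p)
  else (- v2.1 / tri_det p, v1.1 / tri_det p).
have dE (b : plane R -> R) c : partial i b (tri_map p c) = al.1 * d b v1 c + al.2 * d b v2 c.
  have detE : tri_det p = v1.1 * v2.2 - v2.1 * v1.2 by [].
  have D0' : v1.1 * v2.2 - v2.1 * v1.2 != 0 by rewrite -detE.
  rewrite /al /d detE; have [->|i1] := eqVneq i ord0; first by rewrite /=; field.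
  have -> : i = ord_max by apply/eqP; move: i1; case: i {al} => -[|[|//]] ? h; rewrite -(inj_eq val_inj) in h *.
  by rewrite /=; field.
pose G1 c := al.1 * (a (tri_map p c) * f (tri_map p c)).
pose G2 c := al.2 * (a (tri_map p c) * f (tri_map p c)).
pose g1 c := al.1 * (a (tri_map p c) * d f v1 c + f (tri_map p c) * d a v1 c).
pose g2 c := al.2 * (a (tri_map p c) * d f v2 c + f (tri_map p c) * d a v2 c).
have out c : ~ std_triangle c -> a (tri_map p c) * f (tri_map p c) = 0.
  by move=> nc; rewrite f0 ?mulr0// => Tc; apply: nc; rewrite -(open_triangle_map D0).
transitivity (`|tri_det p| *
    \int[borel_area R]_(c in (std_triangle : set M)) (g1 c + g2 c)).
  congr (_ * _); apply: eq_Rintegral => c _; rewrite /g1 /g2 !dE; ring.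
suff -> : \int[borel_area R]_(c in (std_triangle : set M)) (g1 c + g2 c) = 0.
  by rewrite mulr0.
have cG (k : R) : continuous ((fun c => k * (a (tri_map p c) * f (tri_map p c))) : R * R -> R).
  by move=> c; apply: cvgM; [exact: cvg_cst|apply: cvgM; [exact: (cm _ ca)|exact: (cm _ cf)]].
have cg (k : R) v : continuous ((fun c => k * (a (tri_map p c) * d f v c + f (tri_map p c) * d a v c)) : R * R -> R).
  move=> c; apply: cvgM; [exact: cvg_cst|apply: cvgD; apply: cvgM].
  - exact: (cm _ ca).
  - exact: cd.
  - exact: (cm _ cf).
  - exact: cd.
refine (std_triangle_divergence (G1 := G1) (G2 := G2) _ _ _ _ _ _ _ _ _).
- exact: cG.
- exact: cG.
- exact: cg.
- exact: cg.
- by move=> s t; exact: (is_deriveZ al.1 (is_deriveM (D1 _ s t Ca) (D1 _ s t Cf))).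
- by move=> s t; exact: (is_deriveZ al.2 (is_deriveM (D2 _ s t Ca) (D2 _ s t Cf))).
- by move=> t; rewrite /G1 out ?mulr0// => -[/=]; rewrite ltxx.
- by move=> s; rewrite /G2 out ?mulr0// => -[_ /=]; rewrite ltxx.
- by move=> s; rewrite /G1 /G2 out ?mulr0 ?addr0// => -[_ _ /=]; rewrite addrC subrK ltxx.
Qed.

Lemma phi_H1_grad x : H1_grad (open_triangle p) (Phi x) (fun i => Cpartial i (Phi x)).
Proof.
have sx := Csmooth_phi L p x; have [sr si] := sx.
split; [exact: (phi_L2 p_eq)|by move=> i; exact: (Csmooth_partial_L2 p_eq)|].
move=> i f [sf [K [_ KT f0]]].
have f0' P : ~ open_triangle p P -> f P = 0 by move=> nP; apply: f0 => /KT.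
have cont1 (b : plane R -> R) : Cn 1 b -> continuous (b : R * R -> R) /\
    continuous (partial i b : R * R -> R).
  by move=> [cb h]; split=> //; case: (h i) => _ [].
have [cf cdf] := cont1 _ (sf 1%N).
have key (a : plane R -> R) : Cn 1 a -> \int[area R]_(P in T) (a P * partial i f P) =
    - \int[area R]_(P in T) (partial i a P * f P).
  move=> Ca; have [ca cda] := cont1 _ Ca; apply/eqP; rewrite -addr_eq0; apply/eqP.
  rewrite -RintegralD; first exact: ibp_compact_support.
  - exact: mT.
  - by apply: continuous_tri_integrable => P; apply: cvgM; [exact: ca|exact: cdf].
  - by apply: continuous_tri_integrable => P; apply: cvgM; [exact: cda|exact: cf].
rewrite /Cintegral; apply/eqP; rewrite eq_complex /=; apply/andP; split; apply/eqP.
- transitivity (\int[area R]_(P in T) (complex.Re (Phi x P) * partial i f P)).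
    by apply: eq_Rintegral => P _; case: (Phi x P) => u v /=; ring.
  rewrite (key _ (sr 1%N)); congr (- _).
  by apply: eq_Rintegral => P _; rewrite /Cpartial /=; ring.
- transitivity (\int[area R]_(P in T) (complex.Im (Phi x P) * partial i f P)).
    by apply: eq_Rintegral => P _; case: (Phi x P) => u v /=; ring.
  rewrite (key _ (si 1%N)); congr (- _).
  by apply: eq_Rintegral => P _; rewrite /Cpartial /=; ring.
Qed.

Lemma sqnorm_subrr d (X : measurableType d) (mu : {measure set X -> \bar R}) (D : set X) (f : X -> C) :
  sqnorm mu D (fun P => f P - f P) = 0%E.
Proof.
apply: integral0_eq => P _; rewrite subrr; congr EFin.
by rewrite /= expr0n /= addr0.
Qed.

Lemma phi_H1_data x : H1_data p (Phi x) (fun i => Cpartial i (Phi x)) (Phi x).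
Proof.
split; first exact: phi_H1_grad.
have [sr si] := Csmooth_phi L p x.
split.
  move=> i; rewrite (side_lengthE p_eq).
  have cs : continuous (side p i : R -> R * R).
    apply: continuous_pair => s; (apply: cvgD; [exact: cvg_cst|]);
      (apply: cvgM; [|exact: cvg_cst]); by apply: cvgM; [exact: cvg_id|exact: cvg_cst].
  apply: segment_L2 => s.
    by apply: (continuous_comp (f := side p i) (g := fun P => complex.Re (Phi x P))); [exact: cs|exact: (sr 0%N).1].
  by apply: (continuous_comp (f := side p i) (g := fun P => complex.Im (Phi x P))); [exact: cs|exact: (si 0%N).1].
exists (fun=> Phi x); split.
- by move=> n; exact: Csmooth_phi.
- by rewrite sqnorm_subrr; exact: cvg_cst.
- by move=> i; rewrite sqnorm_subrr; exact: cvg_cst.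
- rewrite /boundary_sqnorm; under eq_fun do under eq_bigr do rewrite sqnorm_subrr.
  by rewrite big1//; exact: cvg_cst.
Qed.

(** Green's formula holds for the smooth functions that approximate [u] and its gradient in the
    definition of the trace, and passes to the limit by Cauchy-Schwarz. No boundary term appears
    because [Phi x] satisfies the Neumann condition. *)
Lemma weak_green u g h x : L2 (area R) T u -> (forall i, L2 (area R) T (g i)) ->
  is_trace p u g h ->
  \sum_(i < 2) ipT (g i) (Cpartial i (Phi x)) = (kap * (freq_norm x)%:~R)%:C * ipT u (Phi x).
Proof.
have arith (X Y S K e : R) : X <= 2 * S * e -> Y <= K * e -> 0 < e ->
  2 * X + 2 * Y <= e * (4 * S + 2 * K + 1) by lra.
move=> Lu Lg [_ [f [sf fu fg _]]]; set k := (_ : R)%:C.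
have Lp := phi_L2 p_eq x; have Ld i := Csmooth_partial_L2 p_eq i (Csmooth_phi L p x).
have Lf n := Csmooth_L2 p_eq (sf n); have Ldf i n := Csmooth_partial_L2 p_eq i (sf n).
pose S := \sum_(i < 2) NT (Cpartial i (Phi x)); pose K := nsq k * NT (Phi x).
have S0 : 0 <= S by apply: sumr_ge0 => i _; exact: normL2_ge0.
have K0 : 0 <= K by rewrite mulr_ge0 ?nsq_ge0 ?normL2_ge0.
pose B := 4 * S + 2 * K + 1.
have B0 : 0 < B by rewrite ltr_wpDl// addr_ge0// mulr_ge0.
suff D_eps (e : R) : 0 < e -> nsq (\sum_(i < 2) ipT (g i) (Cpartial i (Phi x)) - k * ipT u (Phi x)) <= e * B.
  apply/eqP; rewrite -subr_eq0; apply/eqP; apply: nsq_eq0; apply/eqP; rewrite eq_le nsq_ge0 andbT.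
  apply/ler_addgt0Pl => e e0; rewrite addr0.
  by have := D_eps (e / B); rewrite divfK ?gt_eqF//; apply; rewrite divr_gt0.
move=> e0.
have small (F : nat -> plane R -> C) : sqnorm (area R) T (F n) @[n --> \oo] --> 0%E ->
    exists n0, forall n, (n0 <= n)%N -> NT (F n) <= e.
  move=> cF; have cF0 : NT (F n) @[n --> \oo] --> (0 : R) by exact: (fine_cvg cF).
  have /cvgrPdist_le hc := cF0; have [n0 _ hn] := hc e e0.
  by exists n0 => n nn; have := hn n nn; rewrite sub0r normrN ger0_norm ?normL2_ge0.
have [m1 h1] := small _ fu; have [m2 h2] := small _ (fg ord0); have [m3 h3] := small _ (fg ord_max).
pose n := maxn m1 (maxn m2 m3).
have hu : NT (fun P => f n P - u P) <= e by apply: h1; rewrite /n; lia.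
have hg i : NT (fun P => Cpartial i (f n) P - g i P) <= e.
  case: i => -[|[|//]] ilt.
    by rewrite (_ : Ordinal ilt = ord0); [apply: h2; rewrite /n; lia|exact: val_inj].
  by rewrite (_ : Ordinal ilt = ord_max); [apply: h3; rewrite /n; lia|exact: val_inj].
have Ldu := herm_closedB HT (Lf n) Lu; have Ldg i := herm_closedB HT (Ldf i n) (Lg i).
have E : \sum_(i < 2) ipT (g i) (Cpartial i (Phi x)) - k * ipT u (Phi x) =
    - \sum_(i < 2) ipT (Cpartial i (f n) - g i) (Cpartial i (Phi x)) + k * ipT (f n - u) (Phi x).
  rewrite (hermBl HT (Lf n) Lu Lp) mulrBr -(green_complex p_eq x (sf n)).
  under [X in _ = - X + _]eq_bigr do rewrite (hermBl HT (Ldf _ n) (Lg _) (Ld _)).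
  by rewrite sumrB opprB addrA subrK.
rewrite E; apply: le_trans (nsqD_le _ _) _; rewrite nsqN.
apply: arith => //; last first.
  rewrite nsqM /K -mulrA ler_wpM2l ?nsq_ge0//; apply: le_trans (herm_CS HT Ldu Lp) _.
  by rewrite !ip_self mulrC ler_wpM2l ?normL2_ge0.
have bi i : nsq (ipT (Cpartial i (f n) - g i) (Cpartial i (Phi x))) <= NT (Cpartial i (Phi x)) * e.
  apply: le_trans (herm_CS HT (Ldg i) (Ld i)) _.
  by rewrite !ip_self mulrC ler_wpM2l ?normL2_ge0// hg.
rewrite /S !sum2E; apply: le_trans (nsqD_le _ _) _.
by rewrite -mulrDr -mulrA ler_pM2l// mulrDl; apply: lerD; exact: bi.
Qed.

End weak_form.

Lemma nearest_nat (R : realType) (a : R) : exists q : nat, forall z : int, 0 <= z ->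
  z != q%:Z -> 1 / 2 <= `|z%:~R - a|.
Proof.
have [[q qa]|nq] := pselect (exists q : nat, `|q%:R - a| < 1 / 2).
  exists q => z _; apply: contraNT; rewrite -ltNge => za.
  have : `|(z - q%:Z)%:~R : R| < 1.
    rewrite rmorphB /= (_ : _ - _ = (z%:~R - a) - (q%:R - a)); last by ring.
    by apply: le_lt_trans (ler_normB _ _) _; lra.
  rewrite -intr_norm -[ltRHS]/(1%:~R) ltr_int => {za qa} hh; apply/eqP; lia.
(* No natural number is within 1/2 of [a], so any choice will do and 0 is taken. *)
exists 0%N => z z0 _; rewrite leNgt; apply/negP => za; apply: nq; exists (absz z).
by rewrite -[(absz z)%:R]/((absz z)%:Z%:~R) gez0_abs.
Qed.

Lemma Re_mul_le (R : realType) (z w : R[i]) (s : R) : 0 < s ->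
  complex.Re (z * w) <= (s * nsq z + nsq w / s) / 2.
Proof.
move=> s0; have := Re_mul_ge (- z) w s0; rewrite nsqN.
have -> : complex.Re (- z * w) = - complex.Re (z * w) by case: z w => [a b] [c d] /=; ring.
by rewrite mulNr lerN2.
Qed.

(** Here [s] is [sigma ^ 2], [b] and [v] are the squared boundary and interior coefficients, [k] is
    [kappa] and [d] the distance to the level. The coefficient equation is solved once for the
    energy term and once for the coefficient itself. *)
Lemma far_arith (R : realFieldType) (s b k d v : R) : 0 < k -> 0 < d ->
  s * b = k ^+ 2 * d ^+ 2 * v ->
  s / k * (d^-1 * b) = k * d * v /\ 2 * s / k ^+ 2 * (d^-1 * b) = 2 * d * v.
Proof.
move=> k0 d0 E; split.
  transitivity (s * b / (k * d)); first by field; rewrite !gt_eqF.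
  by rewrite E; field; rewrite !gt_eqF.
transitivity (2 * (s * b) / (k ^+ 2 * d)); first by field; rewrite !gt_eqF.
by rewrite E; field; rewrite !gt_eqF.
Qed.

(** * Distance of a Robin eigenfunction to the nearest Neumann level *)

Section eigenfunction.
Context {R : realType}.
Variables (L : R) (p : 'I_3 -> plane R).
Hypothesis p_eq : equilateral L p.
Notation C := R[i].
Notation T := (open_triangle p : set (lplane R)).
Notation Phi := (phi L p).
Notation NT := (@normL2 _ _ R (area R) T).
Notation ipT := (@ip _ _ R (area R) T).
Notation kap := (kappa L).
Notation A36 := (36 * tri_area p).
Notation leb := (@lebesgue_measure R).

Let D0 := tri_det_neq0 p_eq.
Let mT := measurable_triangle D0.
Let HT := @L2_hermitian _ _ R (area R) T mT.
Let L0 := equilateral_gt0 p_eq.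
Let kap0 := kappa_gt0 p_eq.

Let A36_gt0 : 0 < A36.
Proof. by rewrite mulr_gt0// (tri_area_gt0 p_eq). Qed.

Variables (sigma : R) (l : C) (u : plane R -> C) (g : 'I_2 -> plane R -> C) (h : plane R -> C).
Hypothesis Hu : H1_data p u g h.
Hypothesis weak : forall v w k, H1_data p v w k ->
  robin_form p sigma g h w k = inner (open_triangle p) (fun P => l * u P) v.

Let Lu : L2 (area R) T u. Proof. by case: Hu => -[]. Qed.
Let Lg i : L2 (area R) T (g i). Proof. by case: Hu => -[]. Qed.
Let Lh : boundary_L2 p h. Proof. by case: Hu => _ []. Qed.

Let inner_ip f v : L2 (area R) T f -> L2 (area R) T v ->
  inner (open_triangle p) (fun P => l * f P) v = l * ipT f v.
Proof. by move=> Lf Lv; exact: (hermZl HT l Lf Lv). Qed.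

Lemma eig_coef x :
  (kap * (freq_norm x)%:~R)%:C * coef L p u x + sigma%:C * bcoef L p h x = l * coef L p u x.
Proof.
have := weak (phi_H1_data p_eq x); rewrite (inner_ip Lu (phi_L2 p_eq x)) => <-.
rewrite /robin_form; congr (_ + _).
by rewrite -(weak_green p_eq x Lu Lg Hu.2).
Qed.

Lemma eig_energy : (\sum_(i < 2) NT (g i) + sigma * bnorm L p h)%:C = l * (NT u)%:C.
Proof.
have := weak Hu; rewrite (inner_ip Lu Lu) ip_self => <-.
rewrite /robin_form rmorphD rmorphM /= rmorph_sum; congr (_ + _ * _).
  by apply: eq_bigr => i _; exact: esym (ip_self (area R) T (g i)).
rewrite /bnorm /boundary_integral rmorph_sum; apply: eq_bigr => i _.
by rewrite (side_lengthE p_eq); symmetry; exact: (ip_self leb (`[0%R, L]%classic : set (measurableTypeR R)) (h \o side p i)).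
Qed.

Lemma gradient_herm_form : herm_form
  (fun G : 'I_2 -> plane R -> C^o => forall i, L2 (area R) T (G i))
  (fun G H => \sum_(i < 2) ipT (G i) (H i)).
Proof.
split.
- by move=> i; exact: L2_0.
- by move=> G H LG LH i; exact: (hermD HT (LG i) (LH i)).
- by move=> c G LG i; exact: (hermZ HT c (LG i)).
- move=> G H K LG LH LK; rewrite -big_split /=; apply: eq_bigr => i _.
  exact: (hermDl HT (LG i) (LH i) (LK i)).
- move=> c G K LG LK; rewrite mulr_sumr; apply: eq_bigr => i _.
  exact: (hermZl HT c (LG i) (LK i)).
- move=> G H LG LH; rewrite conjc_sum; apply: eq_bigr => i _.
  exact: (hermC HT (LG i) (LH i)).
- by move=> G LG; rewrite Re_sum; apply: sumr_ge0 => i _; exact: (herm_ge0 HT (LG i)).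
Qed.

(** By Green's formula the gradients of the [Phi x] satisfy the same orthogonality relations, with
    constants multiplied by the eigenvalues. The inequality goes the way the energy identity
    requires, as a lower bound for the gradient. *)
Lemma gradient_bessel n :
  \sum_(x <- freqs n) kap * (freq_norm x)%:~R * nsq (coef L p u x) / A36 <= \sum_(i < 2) NT (g i).
Proof.
pose e (x : int * int) : 'I_2 -> plane R -> C^o := fun i => Cpartial i (Phi x).
pose m (x : int * int) : R := A36 * (kap * (freq_norm x)%:~R).
have Le x i : L2 (area R) T (e x i) := Csmooth_partial_L2 p_eq i (Csmooth_phi L p x).
pose B2 (G H : 'I_2 -> plane R -> C^o) := \sum_(i < 2) ipT (G i) (H i).
have ge x : B2 g (e x) = (kap * (freq_norm x)%:~R)%:C * coef L p u x := weak_green p_eq x Lu Lg Hu.2.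
have ee x y : B2 (e x) (e y) = (kap * (freq_norm y)%:~R)%:C * ipT (Phi x) (Phi y) :=
  green_complex p_eq y (Csmooth_phi L p x).
pose c x : C := (m x)^-1%:C * B2 g (e x).
have cw a x : c (wact a x) = c x by rewrite /c /m !ge freq_normW coefW.
have Bw x : x \in freqs n -> B2 (\sum_(y <- freqs n) c y *: e y) (e x) = (m x)%:C * c x.
  move=> xF; rewrite /B2 (herm_suml gradient_herm_form (freqs n) c Le (Le x)).
  under eq_bigr do rewrite -/(B2 _ _) ee mulrCA.
  rewrite -mulr_sumr (ip_phi_comb p_eq (freqs_uniq n) (@freqs_wact n) cw xF) mulrA.
  by congr (_ * _); rewrite -rmorphM; congr (_%:C); rewrite /m [RHS]mulrC.
have := herm_bessel gradient_herm_form (F := freqs n) (n := m) Le Lg Bw.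
rewrite Re_sum; under [X in _ <= X -> _]eq_bigr do rewrite ip_self /=.
apply: le_trans; rewrite le_eqVlt; apply/orP; left; apply/eqP; apply: eq_bigr => x _.
rewrite -/(B2 _ _) ge nsqM nsq_real /m; have [->|q0] := eqVneq (freq_norm x) 0.
  by rewrite mulr0 expr0n /= !mul0r.
have z0 : (freq_norm x)%:~R != 0 :> R by rewrite intr_eq0.
have t0 : tri_area p != 0 by rewrite gt_eqF// (tri_area_gt0 p_eq).
have k0 : kap != 0 by rewrite gt_eqF.
by field; rewrite k0 z0 t0.
Qed.

Notation uh := (coef L p u).
Notation bh := (bcoef L p h).
Notation C1 := (bdry_const L).

Let C1_gt0 : 0 < C1.
Proof. by rewrite /bdry_const !mulr_gt0 ?exprn_gt0. Qed.

Lemma parseval_approx (v : plane R -> C) (e : R) : L2 (area R) T v -> 0 < e ->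
  exists n, NT v - \sum_(x <- freqs n) nsq (coef L p v x) / A36 <= e.
Proof.
move=> Lv e0; apply: contrapT => /forallNP hn.
have : NT v <= NT v - e.
  apply: (parseval_le p_eq Lv) => n; have /negP := hn n; rewrite -ltNge => /ltW.
  by rewrite lerBrDr addrC -lerBrDr.
by rewrite lerBrDr gerDl leNgt e0.
Qed.

Hypothesis sigma0 : 0 <= sigma.
Hypothesis sigma_small : sigma * C1 * 4 <= kap * A36.
Hypothesis u_neq0 : 0 < NT u.

(** The eigenvalue in the unit [kappa], in which the Neumann levels are integers. It is real by the
    energy identity. *)
Let a : R := complex.Re l / kap.

Let lE : l = (kap * a)%:C.
Proof.
rewrite /a mulrCA mulfV ?gt_eqF// mulr1; have := eig_energy; case: l => x y [_ /eqP].
by rewrite mulr0 add0r eq_sym mulf_eq0 [NT u == 0]gt_eqF// orbF => /eqP ->.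
Qed.

Let energy : \sum_(i < 2) NT (g i) + sigma * bnorm L p h = kap * a * NT u.
Proof. by have := eig_energy; rewrite lE -rmorphM => -[]. Qed.

Let a_ge0 : 0 <= a.
Proof.
have : 0 <= kap * a * NT u.
  rewrite -energy addr_ge0 ?mulr_ge0 ?bnorm_ge0//.
  by apply: sumr_ge0 => i _; exact: normL2_ge0.
by rewrite pmulr_lge0// pmulr_rge0.
Qed.

Let coef_eq x : sigma%:C * bh x = (kap * (a - (freq_norm x)%:~R))%:C * uh x.
Proof.
have := eig_coef x; rewrite lE => /eqP; rewrite eq_sym addrC -subr_eq => /eqP <-.
by rewrite -mulrBl -rmorphB -mulrBr.
Qed.

Let nsq_eq x : sigma ^+ 2 * nsq (bh x) = kap ^+ 2 * (a - (freq_norm x)%:~R) ^+ 2 * nsq (uh x).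
Proof. by have /(congr1 nsq) := coef_eq x; rewrite !nsqM !nsq_real exprMn. Qed.

Section level.
Variable q : nat.
Hypothesis qP : forall x, freq_norm x != q%:Z -> 1 / 2 <= `|(freq_norm x)%:~R - a|.
Let W := \sum_(x <- shell q) nsq (uh x).
Let bn := bnorm L p h.

Let lw_far x : freq_norm x != q%:Z -> level_weight a (freq_norm x) = `|(freq_norm x)%:~R - a|^-1.
Proof. by move=> /qP xa; rewrite /level_weight xa. Qed.

(** On the near level the distance may vanish, so the coefficient equation is not divided: one
    factor of the coefficient is traded for [sigma] times the boundary coefficient, and Young's
    inequality separates the two. *)
Let term_near x (s : R) : 0 < s ->
  kap * (a - (freq_norm x)%:~R) * nsq (uh x) <= sigma / 2 * (s * nsq (bh x) + nsq (uh x) / s).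
Proof.
move=> s0; have -> : kap * (a - (freq_norm x)%:~R) * nsq (uh x) = sigma * complex.Re (bh x * (uh x)^*).
  rewrite -Re_realM mulrA coef_eq -[in RHS]mulrA Re_realM Re_mulconj.
  by [].
rewrite mulrAC -mulrA; apply: ler_wpM2l => //.
by rewrite -[nsq (uh x)]nsq_conj; exact: Re_mul_le.
Qed.

Let term_far x : freq_norm x != q%:Z ->
  kap * (a - (freq_norm x)%:~R) * nsq (uh x) <=
  sigma ^+ 2 / kap * (level_weight a (freq_norm x) * nsq (bh x)).
Proof.
move=> xq; rewrite (lw_far xq); have d0 := qP xq; have E := nsq_eq x.
set d := `|_| in d0 *; have dp : 0 < d by lra.
have dE : (a - (freq_norm x)%:~R) ^+ 2 = d ^+ 2 by rewrite /d real_normK ?num_real// -sqrrN opprB.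
rewrite dE in E; have -> : sigma ^+ 2 / kap * (d^-1 * nsq (bh x)) = kap * d * nsq (uh x).
  by rewrite (far_arith kap0 dp E).1.
rewrite ler_wpM2r ?nsq_ge0// ler_pM2l// /d distrC; exact: ler_norm.
Qed.

(** The factor 2 is the inverse of the minimal distance 1/2; it allows one power of the inverse
    distance to be given away. *)
Let coef_far x : freq_norm x != q%:Z ->
  nsq (uh x) <= 2 * sigma ^+ 2 / kap ^+ 2 * (level_weight a (freq_norm x) * nsq (bh x)).
Proof.
move=> xq; rewrite (lw_far xq); have d0 := qP xq; have E := nsq_eq x.
set d := `|_| in d0 *; have dp : 0 < d by lra.
have dE : (a - (freq_norm x)%:~R) ^+ 2 = d ^+ 2 by rewrite /d real_normK ?num_real// -sqrrN opprB.
rewrite dE in E; have -> : 2 * sigma ^+ 2 / kap ^+ 2 * (d^-1 * nsq (bh x)) = 2 * d * nsq (uh x).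
  by rewrite (far_arith kap0 dp E).2.
by rewrite ler_peMl ?nsq_ge0//; lra.
Qed.

(** The weighted boundary estimate holds for every real parameter; at [q + 1 / 2] the level [q] sits
    exactly on the cut-off and has weight 2. *)
Let near_b n : \sum_(x <- freqs n | freq_norm x == q%:Z) nsq (bh x) <= C1 * bn / 2.
Proof.
have := boundary_weight_sum p_eq (q%:R + 1 / 2) n Lh.
rewrite ler_pdivlMr// mulr_suml; apply: le_trans.
rewrite big_mkcond /=; apply: ler_sum => x _; case: eqP => [->|_]; last first.
  by rewrite mulr_ge0 ?level_weight_ge0// nsq_ge0.
rewrite [leLHS]mulrC ler_wpM2r ?nsq_ge0// /level_weight (_ : q%:Z%:~R - _ = - (1 / 2)); last first.
  by rewrite -[q%:Z%:~R]/(q%:R); ring.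
by rewrite normrN ger0_norm// lexx; lra.
Qed.

Let near_u n : \sum_(x <- freqs n | freq_norm x == q%:Z) nsq (uh x) <= W.
Proof.
rewrite -big_filter /W; apply: sum_subset_le; [exact/filter_uniq/freqs_uniq|exact: shell_uniq| |].
  by move=> x; rewrite mem_filter mem_shell => /andP[].
by move=> x; exact: nsq_ge0.
Qed.

Let far_b n : \sum_(x <- freqs n | freq_norm x != q%:Z) level_weight a (freq_norm x) * nsq (bh x) <= C1 * bn.
Proof.
apply: le_trans (boundary_weight_sum p_eq a n Lh).
rewrite big_mkcond; apply: ler_sum => x _; case: ifP => // _.
by rewrite mulr_ge0 ?level_weight_ge0// nsq_ge0.
Qed.

(** The energy identity minus Bessel's inequality for the gradient leaves [sigma * bn] below the sum
    of [kap * (a - freq_norm x) * nsq (uh x) / A36], up to truncation. Its near and far parts each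
    return at most a quarter of [sigma * bn], which is absorbed; what remains involves only the near
    coefficients [W]. *)
Let boundary_bound : sigma * bn <= sigma * C1 / A36 ^+ 2 * W.
Proof.
have arith (X Y s2 e : R) : X <= e + (X / 4 + Y / 2 + X * s2) -> s2 <= 1 / 4 -> 0 <= X ->
  X <= Y + 2 * e by nra.
apply/ler_addgt0Pl => e e0; have X0 : 0 <= sigma * bn by rewrite mulr_ge0// bnorm_ge0.
have e2 : 0 < e / 2 by rewrite divr_gt0.
have ka1 : 0 < kap * a + 1 by rewrite ltr_wpDl// mulr_ge0// ltW.
(* The truncated mass is later multiplied by the eigenvalue [kap * a], hence this tolerance. The
   truncation [n] depends on the eigenvalue, the final bound does not. *)
have [n hn] := parseval_approx Lu (divr_gt0 e2 ka1).
pose s2 := sigma / kap * C1 / A36.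
have s2_le : s2 <= 1 / 4.
  rewrite /s2 ler_pdivrMr// mulrAC ler_pdivrMr//; move: sigma_small; lra.
rewrite addrC (_ : e = 2 * (e / 2)); last by field.
apply: (arith _ _ s2) => //.
have gb := gradient_bessel n.
have T_le : \sum_(x <- freqs n) kap * (a - (freq_norm x)%:~R) * nsq (uh x) <=
    sigma / 2 * (A36 / C1 * (C1 * bn / 2) + W / (A36 / C1)) + sigma ^+ 2 / kap * (C1 * bn).
  rewrite (bigID (fun x => freq_norm x == q%:Z)) /=; apply: lerD.
    (* The Young parameter [A36 / C1] is chosen so that the boundary half of the near part equals
       [sigma * bn / 4] after division by [A36]. *)
    apply: (@le_trans _ _ (\sum_(x <- freqs n | freq_norm x == q%:Z)
        sigma / 2 * (A36 / C1 * nsq (bh x) + nsq (uh x) / (A36 / C1)))).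
      by apply: ler_sum => x _; apply: term_near; rewrite divr_gt0.
    rewrite -mulr_sumr big_split /= -mulr_sumr -mulr_suml.
    apply: ler_wpM2l; first by rewrite divr_ge0.
    apply: lerD; first by rewrite ler_pM2l ?near_b// divr_gt0.
    by rewrite ler_pM2r ?near_u// invr_gt0 divr_gt0.
  apply: (@le_trans _ _ (\sum_(x <- freqs n | freq_norm x != q%:Z)
      sigma ^+ 2 / kap * (level_weight a (freq_norm x) * nsq (bh x)))).
    by apply: ler_sum => x; exact: term_far.
  rewrite -mulr_sumr ler_wpM2l ?far_b// divr_ge0 ?sqr_ge0//; exact: ltW.
have split_T : \sum_(x <- freqs n) kap * (a - (freq_norm x)%:~R) * nsq (uh x) =
    A36 * (kap * a * (\sum_(x <- freqs n) nsq (uh x) / A36)) -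
    A36 * \sum_(x <- freqs n) kap * (freq_norm x)%:~R * nsq (uh x) / A36.
  rewrite !mulr_sumr -sumrB; apply: eq_bigr => x _; field.
  by rewrite (gt_eqF (tri_area_gt0 p_eq)).
rewrite split_T in T_le.
have : kap * a * (NT u - \sum_(x <- freqs n) nsq (uh x) / A36) <= e / 2.
  apply: (@le_trans _ _ (kap * a * (e / 2 / (kap * a + 1)))).
    by apply: ler_wpM2l hn; rewrite mulr_ge0// ltW.
  rewrite mulrA ler_pdivrMr// mulrC; apply: ler_wpM2l; first exact: ltW.
  by rewrite lerDl.
have Eg := energy; move: T_le gb Eg.
have -> : sigma / 2 * (A36 / C1 * (C1 * bn / 2) + W / (A36 / C1)) + sigma ^+ 2 / kap * (C1 * bn) =
   A36 * (sigma * bn / 4 + sigma * C1 / A36 ^+ 2 * W / 2 + sigma * bn * s2).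
  rewrite /s2; field; rewrite !gt_eqF//; exact: tri_area_gt0 p_eq.
rewrite -mulrBr ler_pM2l//.
move: (\sum_(i < 2) NT (g i)) (\sum_(x <- freqs n) nsq (uh x) / A36)
  (\sum_(x <- freqs n) kap * (freq_norm x)%:~R * nsq (uh x) / A36) => G S1 S2.
rewrite -/bn; move: (sigma * bn) (sigma * C1 / A36 ^+ 2 * W) (NT u) (kap * a) => X Y Nu ka h1 h2 h3.
rewrite mulrBr => h4; lra.
Qed.

(** The squared coefficients off the level are bounded by [sigma ^ 2] times weighted boundary
    coefficients, hence by [sigma ^ 2 * bn], and [boundary_bound] replaces [bn] by the mass on the
    level. *)
Lemma eigenfunction_near_level :
  NT (fun P => u P - proj L p (shell q) u P) <=
  2 * C1 ^+ 2 / (kap ^+ 2 * A36 ^+ 2) * sigma ^+ 2 * NT (proj L p (shell q) u).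
Proof.
pose c x : C := A36^-1%:C * uh x.
have cw (k : 'I_6) m : c (wact k m) = c m by rewrite /c coefW.
have Lw := combo_L2 p_eq (shell q) c.
have NwE : NT (proj L p (shell q) u) = W / A36.
  rewrite (combo_norm p_eq (shell_uniq q) (@shell_wact q) cw) /W mulr_suml.
  by apply: eq_bigr => x _; rewrite nsqM nsq_real; field; rewrite (gt_eqF (tri_area_gt0 p_eq)).
rewrite NwE; apply: (parseval_le p_eq (herm_closedB HT Lu Lw)) => n.
have cE x : coef L p (fun P => u P - proj L p (shell q) u P) x = if freq_norm x == q%:Z then 0 else uh x.
  rewrite [LHS](hermBl HT Lu Lw (phi_L2 p_eq x)) -/(coef L p u x).
  rewrite -/(coef L p (combo L p (shell q) c) x).
  rewrite (coef_combo p_eq x (shell_uniq q) (@shell_wact q) cw) mem_shell.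
  case: ifP => _; last by rewrite subr0.
  by rewrite /c mulrA -rmorphM /= mulfV ?gt_eqF// mul1r subrr.
apply: (@le_trans _ _ (2 * sigma ^+ 2 / kap ^+ 2 * (C1 * bn) / A36)).
  rewrite -mulr_suml ler_pM2r ?invr_gt0//.
  apply: (@le_trans _ _ (\sum_(x <- freqs n | freq_norm x != q%:Z)
      2 * sigma ^+ 2 / kap ^+ 2 * (level_weight a (freq_norm x) * nsq (bh x)))).
    rewrite [leRHS]big_mkcond /=; apply: ler_sum => x _; rewrite cE; case: ifPn => //= xq.
      by rewrite /nsq /= expr0n /= addr0.
    exact: coef_far.
  rewrite -mulr_sumr; apply: ler_wpM2l (far_b n).
  by apply: divr_ge0; [apply: mulr_ge0 => //|]; exact: sqr_ge0.
have key := ler_wpM2l sigma0 boundary_bound.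
have c0 : 0 <= 2 * C1 / (kap ^+ 2 * A36) 
  by apply/ltW/divr_gt0; apply: mulr_gt0 => //; exact: exprn_gt0.
have := ler_wpM2l c0 key; congr (_ <= _); rewrite ?/bn; field;
  by rewrite (gt_eqF kap0) (gt_eqF (tri_area_gt0 p_eq)).
Qed.

End level.

End eigenfunction.

Lemma robin_observability (R : realType) (L : R) (p : 'I_3 -> plane R)
    (p_eq : equilateral L p) (V : set (lplane R)) (mV : measurable V)
    (VT : V `<=` open_triangle p) (V_pos : (0 < area R V)%E) :
  exists2 sigma0 : R, 0 < sigma0 &
    exists2 c : R, 0 < c & forall sigma : R, 0 <= sigma <= sigma0 ->
      forall (l : R[i]) (u : plane R -> R[i]), robin_eigenspace p sigma l u ->
        L2 (area R) (open_triangle p) u /\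
        (c%:E * sqnorm (area R) (open_triangle p) u <= sqnorm (area R) V u)%E.
Proof.
(* The hypotheses give [N <= 4 * Nw] and [k * Nw <= 2 * v + k / 2 * Nw], whence
   [v >= k / 4 * Nw >= k / 16 * N]. *)
have arith (k m N Nw Nd v vw vd : R) : 0 <= m -> m <= k / 4 -> m <= 1 -> 0 <= Nw ->
    vw <= 2 * v + 2 * vd -> vd <= Nd -> k * Nw <= vw -> N <= 2 * Nw + 2 * Nd ->
    Nd <= m * Nw -> k / 16 * N <= v.
  move=> m0 mk m1 Nw0 h1 h2 h3 h4 h5.
  have h6 : m * Nw <= k / 4 * Nw by rewrite ler_wpM2r.
  have h7 : m * Nw <= Nw by rewrite ler_piMl.
  have h8 : k / 16 * N <= k / 16 * (4 * Nw) by rewrite ler_wpM2l//; lra.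
  lra.
have [k k0 hk] := zygmund_bound p_eq mV VT V_pos.
have kap0 := kappa_gt0 p_eq; have A0 : 0 < 36 * tri_area p by rewrite mulr_gt0// (tri_area_gt0 p_eq).
have L0 := equilateral_gt0 p_eq.
pose C1 := bdry_const L; have C10 : 0 < C1 by rewrite /C1 /bdry_const !mulr_gt0 ?exprn_gt0.
pose D := 2 * C1 ^+ 2 / (kappa L ^+ 2 * (36 * tri_area p) ^+ 2).
have Dp : 0 < D by apply: divr_gt0; apply: mulr_gt0 => //; exact: exprn_gt0.
pose m0 := Num.min (k / 4) 1; have m0p : 0 < m0 by rewrite lt_min ltr01 divr_gt0.
(* The first bound permits the absorption of the boundary norm, the second gives
   [sigma ^ 2 <= sigma], and the third then makes the relative error [D * sigma ^ 2] at most
   [min (k / 4, 1)]. *)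
exists (Num.min (kappa L * (36 * tri_area p) / (C1 * 4)) (Num.min 1 (m0 / D))).
  have r1 : 0 < kappa L * (36 * tri_area p) / (C1 * 4).
    by apply: divr_gt0; [exact: mulr_gt0|apply: mulr_gt0].
  by rewrite !lt_min r1 ltr01 (divr_gt0 m0p Dp).
exists (k / 16) => [|sigma]; first by rewrite divr_gt0.
rewrite !le_min => /and4P[s0 s1 s2 s3] l u [_ [g [h [Hu weak]]]].
have Lu : L2 (area R) (open_triangle p) u by case: Hu => -[].
split=> //; have [LuV _] := L2_restrict p_eq mV VT Lu.
rewrite (sqnorm_fin Lu) (sqnorm_fin LuV) -EFinM lee_fin.
have [u0|u0] := eqVneq (normL2 (area R) (open_triangle p) u) 0.
  by rewrite u0 mulr0 normL2_ge0.
have up : 0 < normL2 (area R) (open_triangle p) u by rewrite lt_def u0 normL2_ge0.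
have small : sigma * bdry_const L * 4 <= kappa L * (36 * tri_area p).
  by rewrite -mulrA -ler_pdivlMr// mulr_gt0.
have [q hq] := nearest_nat (complex.Re l / kappa L).
have qP x := hq (freq_norm x) (freq_norm_ge0 x).
have near := eigenfunction_near_level p_eq Hu weak s0 small up qP.
have Lw := combo_L2 p_eq (shell q) (fun x => (36 * tri_area p)^-1%:C * coef L p u x).
set w := proj L p (shell q) u in near.
have mT := measurable_triangle (tri_det_neq0 p_eq).
have Ldiff := herm_closedB (L2_hermitian (area R) mT) Lu Lw.
have Ldiff' := herm_closedB (L2_hermitian (area R) mT) Lw Lu.
have normC (E : set (lplane R)) : normL2 (area R) E (fun P => w P - u P) = normL2 (area R) E (fun P => u P - w P).
  rewrite /normL2 /sqnorm; congr fine; apply: eq_integral => P _; congr EFin.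
  by case: (w P) (u P) => [a b] [c d] /=; ring.
have LV f : L2 (area R) (open_triangle p) f -> L2 (area R) V f by move=> /(L2_restrict p_eq mV VT)[].
have Ds : D * sigma ^+ 2 <= m0.
  apply: (@le_trans _ _ (D * sigma)); last by rewrite mulrC -ler_pdivlMr.
  by rewrite ler_pM2l// expr2 ler_piMr.
have m4 : m0 <= k / 4 by rewrite ge_min lexx.
have m1 : m0 <= 1 by rewrite ge_min lexx orbT.
have wE : w = (fun P => u P + (w P - u P)) by apply/funext => P; rewrite addrC subrK.
have uE : u = (fun P => w P + (u P - w P)) by apply/funext => P; rewrite addrC subrK.
apply: (arith k (D * sigma ^+ 2) _ (normL2 (area R) (open_triangle p) w)
  (normL2 (area R) (open_triangle p) (fun P => u P - w P)) _
  (normL2 (area R) V w) (normL2 (area R) V (fun P => u P - w P))).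
- by rewrite mulr_ge0 ?sqr_ge0// ltW.
- exact: le_trans Ds m4.
- exact: le_trans Ds m1.
- exact: normL2_ge0.
- have := herm_sqrD_le (L2_hermitian (area R) mV) LuV (LV _ Ldiff').
  rewrite !ip_self -normC => hh.
  apply: (@le_trans _ _ (normL2 (area R) V (fun P => u P + (w P - u P)))); last exact: hh.
  by rewrite -wE.
- by have [] := L2_restrict p_eq mV VT Ldiff.
- by apply: hk => a x; rewrite coefW.
- have hh := normL2D_le p_eq Lw Ldiff.
  apply: (@le_trans _ _ (normL2 (area R) (open_triangle p) (fun P => w P + (u P - w P)))); last exact: hh.
  by rewrite -uE.
- exact: near.
Qed.

Theorem theorem3p8 (R : realType) (L : R) (p : 'I_3 -> plane R)
    (p_eq : equilateral L p)
    (V : set (lplane R)) (V_meas : measurable V)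
    (V_sub : V `<=` open_triangle p) (V_pos : (0 < area R V)%E) :
  exists2 sigma0 : R, 0 < sigma0 &
    (exists2 c : R, 0 < c &
       forall sigma : R, 0 <= sigma <= sigma0 ->
       forall l : R[i], robin_spectrum p sigma l ->
       forall u : plane R -> R[i], robin_eigenspace p sigma l u ->
         (c%:E * sqnorm (area R) (open_triangle p) u <= sqnorm (area R) V u)%E)
    /\
    (0 < ereal_inf [set
           ereal_inf [set
             ereal_inf [set
               (fine (sqnorm (area R) V u)
                / fine (sqnorm (area R) (open_triangle p) u))%R%:E
             | u in [set u | robin_eigenspace p sigma l u /\
                             sqnorm (area R) (open_triangle p) u != 0%E]]
           | l in robin_spectrum p sigma]
         | sigma in [set sigma : R | (0 <= sigma <= sigma0)%R]])%E.
Proof.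
have [sigma0 s0 [c c0 hc]] := robin_observability p_eq V_meas V_sub V_pos.
exists sigma0 => //; split.
  by exists c => // sigma sP l _ u eu; have [_] := hc sigma sP l u eu.
apply: (@lt_le_trans _ _ c%:E); first by rewrite lte_fin.
apply: le_ereal_inf_tmp => _ [sigma sP <-]; apply: le_ereal_inf_tmp => _ [l _ <-].
apply: le_ereal_inf_tmp => _ [u [eu u0] <-]; have [Lu hu] := hc sigma sP l u eu.
have [LuV _] := L2_restrict p_eq V_meas V_sub Lu.
move: u0 hu; rewrite (sqnorm_fin Lu) (sqnorm_fin LuV) -EFinM !lee_fin eqe => u0 hu.
by rewrite ler_pdivlMr// lt_def u0 normL2_ge0.
Qed.
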